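(* Let $E$ be a Euclidean space and let $\nu$ be a proximal and strongly irreducible probability distribution on $\mathrm{End}(E)$. Let $(\gamma_n)\sim\nu^{\otimes\mathbb{N}}$, $\overline\gamma_n=\gamma_0\cdots\gamma_{n-1}$, and let $l^\infty$ be a $\mathrm{P}(E)$-valued random variable on the same probability space such that for every $\alpha<\lambda_{1-2}(\nu)$ there are $C,\beta>0$ with $\mathbb{P}(\mathrm{dist}([\overline\gamma_nv],l^\infty)\ge e^{-\alpha n}\mid\overline\gamma_nv\neq0)\le Ce^{-\beta n}$ for all $v\in E\setminus\{0\}$ and all $n$. Then for all $\alpha<\lambda_{1-2}(\nu)$ there exist $C,\beta>0$ such that for all $n>0$, $$\mathbb{P}\big(\rho_2(\overline\gamma_n)\ge e^{-\alpha n}\rho_1(\overline\gamma_n)\ \cup\ \mathrm{dist}(E^+(\overline\gamma_n),l^\infty)\ge e^{-\alpha n}\big)\le Ce^{-\beta n}.$$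
   Context: $E=\mathbb{R}^d$, $d\ge2$, with the Euclidean norm; $\mathrm{P}(E)$ the projective space with metric $\mathrm{dist}([x],[y])=\|x\wedge y\|/(\|x\|\|y\|)$. $\rho_1(g)\ge\rho_2(g)\ge\cdots$ are the moduli of the eigenvalues of $g$; when $\rho_1(g)>\rho_2(g)$ the top eigenvalue is simple and real and $E^+(g)\in\mathrm{P}(E)$ denotes its eigenline. For $g\neq0$, $\sigma(g)=s_2(g)/s_1(g)$ (ratio of top two singular values), and $\lambda_{1-2}(\nu)\in(0,+\infty]$ is the almost sure limit of $-\frac1n\log\sigma(\overline\gamma_n)$, which exists for such $\nu$. Proximal: $\nu^{*n}\{0\}=0$ for all $n$ and $\nu^{*n}\{g:\rho_1(g)>\rho_2(g)\}>0$ for some $n$ ($\nu^{*n}$ the law of a product of $n$ i.i.d. $\nu$-distributed matrices). Strongly irreducible: (a) for all $N\ge1$, $f_1,\dots,f_N\in E^*\setminus\{0\}$, $v\in E\setminus\{0\}$ there is $n$ with $\nu^{*n}\{g:\prod_if_igv\neq0\}>0$; (b) for all $N\ge1$, $f\in E^*\setminus\{0\}$, $v_1,\dots,v_N\in E\setminus\{0\}$ there is $n$ with $\nu^{*n}\{g:\prod_jfgv_j\neq0\}>0$. *)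

(* Defs.v *)
From HB Require Import structures.
From mathcomp Require Import all_boot all_order all_algebra.
From mathcomp Require Import all_classical all_reals all_analysis.
From mathcomp Require Import complex.

Set Implicit Arguments.
Unset Strict Implicit.
Unset Printing Implicit Defensive.

Import Order.TTheory GRing.Theory Num.Theory.
Import numFieldNormedType.Exports.

Local Open Scope classical_set_scope.
Local Open Scope ring_scope.

Section Defs.
Context {R : realType} {d : nat}.

Definition eigvals (g : 'M[R]_d) : seq (complex.complex R) :=
  let gC : 'M[complex.complex (R : rcfType)]_d :=
    map_mx (fun x : R => (complex.Complex x 0)) g in
  projT1 (closed_field_poly_normal (char_poly gC)).

Definition eigmoduli (g : 'M[R]_d) : seq R :=
  sort (fun x y : R => y <= x) [seq ComplexField.Normc.normc z | z <- eigvals g].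

Definition rho (k : nat) (g : 'M[R]_d) : R := nth 0 (eigmoduli g) k.-1.

Definition sing (k : nat) (g : 'M[R]_d) : R := Num.sqrt (rho k (g^T *m g)).

Definition sigma (g : 'M[R]_d) : R := sing 2 g / sing 1 g.

Definition mlog_sigma (g : 'M[R]_d) : \bar R :=
  if sigma g == 0 then +oo%E else (- ln (sigma g))%:E.

Definition vnorm (x : 'cV[R]_d) : R := Num.sqrt (\sum_i x i 0 ^+ 2).

(* norm of x /\ y in the standard basis e_i /\ e_j (i < j) of Lambda^2 E *)
Definition wedge_norm (x y : 'cV[R]_d) : R :=
  Num.sqrt (\sum_(i : 'I_d) \sum_(j : 'I_d | (i < j)%N)
              (x i 0 * y j 0 - x j 0 * y i 0) ^+ 2).

(* projective distance between the lines [x] and [y] (x, y nonzero) *)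
Definition pdist (x y : 'cV[R]_d) : R := wedge_norm x y / (vnorm x * vnorm y).

Definition top_eigvec (g : 'M[R]_d) (v : 'cV[R]_d) : Prop :=
  v != 0 /\ exists lam : R, g *m v = lam *: v /\ `|lam| = rho 1 g.

(* E^+(g): a vector spanning the top eigenline (meaningful when
   rho 1 g > rho 2 g, in which case the top eigenvalue is simple and real) *)
Definition Eplus (g : 'M[R]_d) : 'cV[R]_d := xget 0 (top_eigvec g).

Definition mxBorel (A : set 'M[R]_d) : Prop :=
  <<s [set S : set 'M[R]_d | exists (i j : 'I_d) (B : set R),
        measurable B /\ S = (fun M : 'M[R]_d => M i j) @^-1` B] >> A.

End Defs.

Section Prob.
Context {R : realType} {d : nat} {dT : measure_display} {T : measurableType dT}.

Definition gbar (g : nat -> T -> 'M[R]_d) (n : nat) (w : T) : 'M[R]_d :=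
  \prod_(k < n) g k w.

(* (g_n)_n is i.i.d.: for every n and Borel sets A_0,...,A_(n-1) of End(E),
   P(g_0 in A_0, ..., g_(n-1) in A_(n-1)) = prod_k P(g_0 in A_k).
   (This is mutual independence of the sequence together with the fact that
   all g_k have the same law nu := law of g_0.) *)
Definition iid_seq (P : probability T R) (g : nat -> T -> 'M[R]_d) : Prop :=
  forall (n : nat) (A : 'I_n -> set 'M[R]_d), (forall k, mxBorel (A k)) ->
    P [set w | forall k : 'I_n, A k (g k w)] =
    (\prod_(k < n) P [set w | A k (g 0%N w)])%E.

End Prob.

(* Main.v *)
Require Import Defs.
From HB Require Import structures.
From mathcomp Require Import all_boot all_order all_algebra.
From mathcomp Require Import all_classical all_reals all_analysis.
From mathcomp Require Import complex.
From mathcomp Require Import measurable_realfun zify ring lra.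
Import Order.TTheory GRing.Theory Num.Theory.
Import numFieldNormedType.Exports.

Set Implicit Arguments.
Unset Strict Implicit.
Unset Printing Implicit Defensive.

Local Open Scope classical_set_scope.
Local Open Scope ring_scope.

(* For alpha >= 0 the event is controlled on a good event of probability
   1 - O(exp(-beta n)).  Write g = gamma_0 ... gamma_(n-1) as a product A X H of
   three long blocks.  By the convergence hypothesis all columns of a word of
   length r lie within exp(-a r) of a common line, so a long block is nearly of
   rank one.  Strong irreducibility and compactness provide, with exponentially
   small failure probability, cut points at which neither g nor its cyclic
   conjugate X H A loses more than a constant factor in norm.  Then X H A is a
   rank-one matrix of comparable trace plus an error of relative size
   exp(-a(n-m)), which gives the spectral gap, and its top eigenline is close to
   the line of its columns; applying A moves it close to the columns of g, hence
   to the limit line.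
   For alpha < 0 the event says that rho_1(g) = 0.  If r is the smallest rank
   reached by a word with positive probability, both halves U, V of g have rank r
   outside an exponentially small event, and so almost surely do U V and V U; by
   Frobenius' rank inequality no power of g = U V vanishes.
   The measure is only meaningful on measurable sets, so the event itself must be
   shown measurable: it is a projection of a closed condition on the roots of the
   characteristic polynomial and a unit eigenvector. *)

(** * Norms and the projective distance *)

(** The hypothesis controls images only: it tells where the columns of a prefix point, and nothing
    about the directions that a word contracts. Those enter through the cuts alone. The cut [i],
    placed before the block [Z], relates the row direction of the word read from 0 to that of [X],
    which is read from [j]; rotating the letters turns the seam between the end and the beginning of
    g into an ordinary cut. A prescribed cut is good only with a probability bounded below. So m
    cuts are tried in each window, with a restart after each failure, and none is good with
    probability at most exp(-tau m). Here m = n / q is a small proportion of n, because exp(-a(n-m))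
    must still beat exp(-alpha n); this is why the convergence is used at some a strictly between
    alpha and lambda. Probabilities are computed on the space of sequences, where independence takes
    two forms: invariance under injective relabelling, which gives the rotations, and replacement of
    the letters after time t by a fresh copy, which gives the restarts. *)

Section L2.
Context {R : realType} {I : finType}.
Implicit Types a b : I -> R.

Definition l2norm a : R := Num.sqrt (\sum_i a i ^+ 2).

Lemma sumsq_ge0 a : 0 <= \sum_i a i ^+ 2.
Proof. by apply: sumr_ge0 => i _; exact: sqr_ge0. Qed.

Lemma sqr_l2norm a : l2norm a ^+ 2 = \sum_i a i ^+ 2.
Proof. by rewrite sqr_sqrtr ?sumsq_ge0. Qed.

Lemma l2norm_ge0 a : 0 <= l2norm a.
Proof. exact: sqrtr_ge0. Qed.

Lemma lagrange_identity a b :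
  \sum_i \sum_j (a i * b j - a j * b i) ^+ 2 =
  ((\sum_i a i ^+ 2) * (\sum_i b i ^+ 2) - (\sum_i a i * b i) ^+ 2) *+ 2.
Proof.
have -> : (\sum_i a i ^+ 2) * (\sum_i b i ^+ 2) =
    \sum_i \sum_j a i ^+ 2 * b j ^+ 2.
  by rewrite mulr_suml; apply: eq_bigr => i _; rewrite mulr_sumr.
have -> : (\sum_i a i * b i) ^+ 2 = \sum_i \sum_j (a i * b i) * (a j * b j).
  by rewrite expr2 mulr_suml; apply: eq_bigr => i _; rewrite mulr_sumr.
have E : \sum_i \sum_j a i ^+ 2 * b j ^+ 2 = \sum_i \sum_j a j ^+ 2 * b i ^+ 2.
  by rewrite exchange_big.
rewrite mulrnBl mulr2n {2}E -big_split/= -sumrMnl -sumrB.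
apply: eq_bigr => i _; rewrite -big_split/= -sumrMnl -sumrB.
by apply: eq_bigr => j _; ring.
Qed.

Lemma cauchy_schwarz_sqr a b :
  (\sum_i a i * b i) ^+ 2 <= (\sum_i a i ^+ 2) * (\sum_i b i ^+ 2).
Proof.
rewrite -subr_ge0 -(pmulrn_lge0 _ (n := 2))// -lagrange_identity.
by apply: sumr_ge0 => i _; apply: sumr_ge0 => j _; exact: sqr_ge0.
Qed.

Lemma cauchy_schwarz a b : `|\sum_i a i * b i| <= l2norm a * l2norm b.
Proof.
rewrite -ler_sqr ?nnegrE ?mulr_ge0 ?l2norm_ge0// real_normK ?num_real//.
by rewrite exprMn !sqr_l2norm cauchy_schwarz_sqr.
Qed.

Lemma ler_l2normD a b : l2norm (fun i => a i + b i) <= l2norm a + l2norm b.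
Proof.
rewrite -ler_sqr ?nnegrE ?addr_ge0 ?l2norm_ge0// sqrrD !sqr_l2norm.
have -> : \sum_i (a i + b i) ^+ 2 =
    \sum_i a i ^+ 2 + (\sum_i a i * b i) *+ 2 + \sum_i b i ^+ 2.
  by rewrite -sumrMnl -!big_split/=; apply: eq_bigr => i _; ring.
by rewrite lerD2r lerD2l lerMn2r/= (le_trans (ler_norm _) (cauchy_schwarz _ _)).
Qed.

Lemma le_coord_l2norm a i : `|a i| <= l2norm a.
Proof.
rewrite -ler_sqr ?nnegrE ?l2norm_ge0// real_normK ?num_real// sqr_l2norm.
by rewrite (bigD1 i)//= lerDl; apply: sumr_ge0 => j _; exact: sqr_ge0.
Qed.

Lemma le_l2norm a (k : R) : 0 <= k -> (forall i, `|a i| <= k) ->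
  l2norm a <= #|I|%:R * k.
Proof.
move=> k0 ak.
rewrite -ler_sqr ?nnegrE ?mulr_ge0 ?l2norm_ge0// sqr_l2norm.
apply: (@le_trans _ _ (\sum_(i : I) k ^+ 2)).
  apply: ler_sum => i _; rewrite -(real_normK (num_real (a i))).
  by rewrite ler_sqr ?nnegrE.
rewrite sumr_const exprMn -[leLHS]mulr_natl; apply: ler_wpM2r; rewrite ?sqr_ge0//.
rewrite -natrX ler_nat; case: #|I| => // n; by rewrite expnS expn1 leq_pmulr.
Qed.

End L2.

Section Frobenius.
Context {R : realType}.
Implicit Types m n p : nat.

Definition fnorm m n (A : 'M[R]_(m, n)) : R :=
  l2norm (fun p : 'I_m * 'I_n => A p.1 p.2).

Lemma fnorm_ge0 m n (A : 'M[R]_(m, n)) : 0 <= fnorm A.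
Proof. exact: l2norm_ge0. Qed.

Lemma sqr_fnorm m n (A : 'M[R]_(m, n)) :
  fnorm A ^+ 2 = \sum_i \sum_j A i j ^+ 2.
Proof. by rewrite sqr_l2norm pair_bigA. Qed.

Lemma fnorm_cV d (x : 'cV[R]_d) : fnorm x = vnorm x.
Proof.
rewrite /fnorm /l2norm /vnorm; congr Num.sqrt.
rewrite -(pair_bigA _ (fun i j => x i j ^+ 2))/=.
by apply: eq_bigr => i _; rewrite big_ord1.
Qed.

Lemma le_coord_fnorm m n (A : 'M[R]_(m, n)) i j : `|A i j| <= fnorm A.
Proof. exact: (le_coord_l2norm (fun p : 'I_m * 'I_n => A p.1 p.2) (i, j)). Qed.

Lemma fnorm0 m n : fnorm (0 : 'M[R]_(m, n)) = 0.
Proof.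
rewrite /fnorm /l2norm big1 ?sqrtr0// => p _; by rewrite mxE expr0n.
Qed.

Lemma fnorm_eq0 m n (A : 'M[R]_(m, n)) : (fnorm A == 0) = (A == 0).
Proof.
apply/eqP/eqP => [A0|->]; last exact: fnorm0.
apply/matrixP => i j; rewrite mxE; apply/eqP; rewrite -normr_le0 -A0.
exact: le_coord_fnorm.
Qed.

Lemma fnorm_gt0 m n (A : 'M[R]_(m, n)) : (0 < fnorm A) = (A != 0).
Proof. by rewrite lt_def fnorm_ge0 fnorm_eq0 andbT. Qed.

Lemma ler_fnormD m n (A B : 'M[R]_(m, n)) : fnorm (A + B) <= fnorm A + fnorm B.
Proof.
rewrite /fnorm; apply: le_trans (ler_l2normD _ _).
by rewrite le_eqVlt; apply/orP; left; apply/eqP; congr l2norm; apply/funext=> p;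
  rewrite mxE.
Qed.

Lemma fnormZ m n (k : R) (A : 'M[R]_(m, n)) : fnorm (k *: A) = `|k| * fnorm A.
Proof.
apply/eqP; rewrite -(@eqrXn2 _ 2) ?mulr_ge0 ?fnorm_ge0// exprMn !sqr_fnorm.
rewrite real_normK ?num_real// mulr_sumr; apply/eqP/eq_bigr => i _.
by rewrite mulr_sumr; apply/eq_bigr => j _; rewrite mxE exprMn.
Qed.

Lemma fnormN m n (A : 'M[R]_(m, n)) : fnorm (- A) = fnorm A.
Proof. by rewrite -scaleN1r fnormZ normrN1 mul1r. Qed.

Lemma ler_fnormB m n (A B : 'M[R]_(m, n)) : fnorm (A - B) <= fnorm A + fnorm B.
Proof. by rewrite -(fnormN B) ler_fnormD. Qed.

Lemma fnormM m n p (A : 'M[R]_(m, n)) (B : 'M[R]_(n, p)) :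
  fnorm (A *m B) <= fnorm A * fnorm B.
Proof.
rewrite -ler_sqr ?nnegrE ?mulr_ge0 ?fnorm_ge0// exprMn !sqr_fnorm.
rewrite [X in _ * X]exchange_big mulr_suml.
apply: ler_sum => i _; rewrite mulr_sumr; apply: ler_sum => k _.
rewrite mxE; exact: (cauchy_schwarz_sqr (fun j => A i j) (fun j => B j k)).
Qed.

Lemma sqr_fnorm_col m n (A : 'M[R]_(m, n)) :
  fnorm A ^+ 2 = \sum_j fnorm (col j A) ^+ 2.
Proof.
rewrite sqr_fnorm exchange_big/=; apply: eq_bigr => j _.
by rewrite sqr_fnorm; apply: eq_bigr => i _; rewrite big_ord1 mxE.
Qed.

Lemma fnorm_col_le m n (A : 'M[R]_(m, n)) j : fnorm (col j A) <= fnorm A.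
Proof.
rewrite -ler_sqr ?nnegrE ?fnorm_ge0// (sqr_fnorm_col A) (bigD1 j)//= lerDl.
by apply: sumr_ge0 => k _; exact: sqr_ge0.
Qed.

Lemma fnorm_row_le m n (A : 'M[R]_(m, n)) i : fnorm (row i A) <= fnorm A.
Proof.
rewrite -ler_sqr ?nnegrE ?fnorm_ge0// !sqr_fnorm big_ord1 (bigD1 i)//=.
under eq_bigr do rewrite mxE.
by rewrite lerDl; apply: sumr_ge0 => k _; apply: sumr_ge0 => l _; exact: sqr_ge0.
Qed.

Lemma ler_fnorm_cols m n p (A : 'M[R]_(m, n)) (B : 'M[R]_(p, n)) (k : R) :
  0 <= k -> (forall j, fnorm (col j A) <= k * fnorm (col j B)) ->
  fnorm A <= k * fnorm B.
Proof.
move=> k0 AB; rewrite -ler_sqr ?nnegrE ?mulr_ge0 ?fnorm_ge0//.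
rewrite exprMn !sqr_fnorm_col mulr_sumr; apply: ler_sum => j _.
by rewrite -exprMn ler_sqr ?nnegrE ?mulr_ge0 ?fnorm_ge0.
Qed.

Lemma nz_col m n (A : 'M[R]_(m, n)) : A != 0 -> exists j, col j A != 0.
Proof.
move=> A0; apply/existsP; apply: contraNT A0.
rewrite negb_exists => /forallP A0; apply/eqP/matrixP => i j.
have /negPn/eqP/matrixP/(_ i 0) := A0 j.
by rewrite !mxE.
Qed.

Lemma col_mulmx m n p (A : 'M[R]_(m, n)) (B : 'M[R]_(n, p)) j :
  col j (A *m B) = A *m col j B.
Proof. by rewrite !colE mulmxA. Qed.

Lemma fnorm_tr_le n (A : 'M[R]_n) : `|\tr A| <= n%:R * fnorm A.
Proof.
rewrite /mxtrace; apply: le_trans (ler_norm_sum _ _ _) _.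
apply: (@le_trans _ _ (\sum_(i < n) fnorm A)).
  by apply: ler_sum => i _; exact: le_coord_fnorm.
by rewrite sumr_const card_ord mulr_natl.
Qed.

End Frobenius.

Section Projective.
Context {R : realType} {d : nat}.
Implicit Types x y z : 'cV[R]_d.

Lemma sqr_vnorm x : fnorm x ^+ 2 = \sum_i x i 0 ^+ 2.
Proof. by rewrite fnorm_cV sqr_sqrtr// (sumsq_ge0 (fun i => x i 0)). Qed.

Definition dot x y : R := \sum_i x i 0 * y i 0.

Lemma dotE x y : \sum_i x i 0 * y i 0 = dot x y.
Proof. by []. Qed.

Lemma dot_le x y : `|dot x y| <= fnorm x * fnorm y.
Proof.
rewrite -ler_sqr ?nnegrE ?mulr_ge0 ?fnorm_ge0// real_normK ?num_real//.
rewrite exprMn !sqr_vnorm.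
exact: (cauchy_schwarz_sqr (fun i => x i 0) (fun i => y i 0)).
Qed.

Lemma wedge_norm_ge0 x y : 0 <= wedge_norm x y.
Proof. exact: sqrtr_ge0. Qed.

(** Lagrange's identity sums over ordered pairs: each pair [i < j] occurs twice and the diagonal
    vanishes, so half of it is the squared wedge norm. *)
Lemma wedge_normE x y :
  wedge_norm x y = Num.sqrt ((fnorm x * fnorm y) ^+ 2 - dot x y ^+ 2).
Proof.
rewrite /wedge_norm; congr Num.sqrt; rewrite exprMn !sqr_vnorm.
have /(congr1 (fun t => t / 2)) := lagrange_identity (fun i => x i 0) (fun i => y i 0).
rewrite -[X in _ = X / 2]mulr_natr mulfK// => <-.
rewrite pair_bigA/= (bigID (fun p : 'I_d * 'I_d => (p.1 < p.2)%N))/=.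
rewrite [X in _ + X](bigID (fun p : 'I_d * 'I_d => (p.2 < p.1)%N))/=.
rewrite [X in _ + (_ + X)]big1 ?addr0; last first.
  move=> [i j] /=; rewrite -!leqNgt => /andP[ji ij].
  by have -> : i = j; [apply/val_inj/eqP; rewrite eqn_leq ij ji|ring].
have -> : \sum_(i : 'I_d * 'I_d | ~~ (i.1 < i.2)%N && (i.2 < i.1)%N)
      (x i.1 0 * y i.2 0 - x i.2 0 * y i.1 0) ^+ 2 =
    \sum_(p : 'I_d * 'I_d | (p.1 < p.2)%N)
      (x p.1 0 * y p.2 0 - x p.2 0 * y p.1 0) ^+ 2.
  rewrite (reindex_inj (h := fun p : 'I_d * 'I_d => (p.2, p.1))) /=; last first.
    by move=> [i j] [k l] [-> ->].
  apply: eq_big => [[i j]|[i j] _] /=; last by ring.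
  by rewrite -leqNgt andb_idl// => /ltnW.
rewrite -mulr2n -[X in X / 2]mulr_natr mulfK//.
by rewrite pair_big_dep.
Qed.

Lemma wedge_normC x y : wedge_norm x y = wedge_norm y x.
Proof.
rewrite !wedge_normE [fnorm y * _]mulrC; congr (Num.sqrt (_ - _ ^+ 2)).
by apply: eq_bigr => i _; rewrite mulrC.
Qed.

Lemma wedge_norm_le x y : wedge_norm x y <= fnorm x * fnorm y.
Proof.
rewrite wedge_normE -[leRHS]ger0_norm ?mulr_ge0 ?fnorm_ge0// -sqrtr_sqr.
by rewrite ler_wsqrtr// gerBl sqr_ge0.
Qed.

Lemma wedge_norm_shift x y (t : R) : wedge_norm x (y - t *: x) = wedge_norm x y.
Proof.
rewrite /wedge_norm; congr Num.sqrt; apply: eq_bigr => i _; apply: eq_bigr=> j _.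
by rewrite !mxE; ring.
Qed.

Lemma wedge_norm_le_shift x y (t : R) :
  wedge_norm x y <= fnorm x * fnorm (y - t *: x).
Proof. by rewrite -(wedge_norm_shift x y t) wedge_norm_le. Qed.

Lemma wedge_normZr x y (k : R) : wedge_norm x (k *: y) = `|k| * wedge_norm x y.
Proof.
rewrite /wedge_norm -sqrtr_sqr -sqrtrM ?sqr_ge0//; congr Num.sqrt.
rewrite mulr_sumr; apply: eq_bigr => i _; rewrite mulr_sumr; apply: eq_bigr=> j _.
by rewrite !mxE; ring.
Qed.

(** [t *: x] is the orthogonal projection of [y] to the line of [x]. The first bound is
    Cauchy-Schwarz; the second clause reads the wedge norm as the distance from [y] to that line. *)
Lemma wedge_decomp x y : x != 0 -> exists2 t : R,
  `|t| * fnorm x <= fnorm y & fnorm x * fnorm (y - t *: x) = wedge_norm x y.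
Proof.
move=> x0; have nx : 0 < fnorm x by rewrite fnorm_gt0.
exists (dot x y / fnorm x ^+ 2).
  rewrite normrM normfV (ger0_norm (sqr_ge0 (fnorm x))) -mulrA expr2 invfM -mulrA.
  by rewrite mulVf ?gt_eqF// mulr1 ler_pdivrMr// mulrC dot_le.
rewrite wedge_normE -[LHS]ger0_norm ?mulr_ge0 ?fnorm_ge0// -sqrtr_sqr.
congr Num.sqrt; rewrite 2!exprMn.
set t := dot x y / _.
have -> : fnorm (y - t *: x) ^+ 2 = fnorm y ^+ 2 - dot x y *+ 2 * t + t ^+ 2 * fnorm x ^+ 2.
  rewrite !sqr_vnorm -dotE -sumrMnl mulr_suml -sumrB mulr_sumr.
  rewrite -big_split/=.
  by apply: eq_bigr => i _; rewrite !mxE; ring.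
by rewrite /t; field; rewrite gt_eqF.
Qed.

Lemma pdistE x y : pdist x y = wedge_norm x y / (fnorm x * fnorm y).
Proof. by rewrite /pdist -!fnorm_cV. Qed.

Lemma pdist_ge0 x y : 0 <= pdist x y.
Proof. by rewrite pdistE divr_ge0 ?wedge_norm_ge0 ?mulr_ge0 ?fnorm_ge0. Qed.

Lemma pdistC x y : pdist x y = pdist y x.
Proof. by rewrite !pdistE wedge_normC mulrC [fnorm y * _]mulrC mulrC. Qed.

Lemma pdist_le1 x y : pdist x y <= 1.
Proof.
rewrite pdistE; have := wedge_norm_le x y.
have : 0 <= fnorm x * fnorm y by rewrite mulr_ge0 ?fnorm_ge0.
rewrite le_eqVlt => /predU1P[<-|p0]; first by rewrite invr0 mulr0.
by rewrite ler_pdivrMr// mul1r.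
Qed.

Lemma wedge_pdist x y : x != 0 -> y != 0 ->
  wedge_norm x y = pdist x y * (fnorm x * fnorm y).
Proof. by move=> x0 y0; rewrite pdistE divfK// mulf_neq0 ?fnorm_eq0. Qed.

Lemma pdist0l y : pdist 0 y = 0.
Proof. by rewrite pdistE fnorm0 mul0r invr0 mulr0. Qed.

Lemma pdistZr x y (k : R) : k != 0 -> pdist x (k *: y) = pdist x y.
Proof.
move=> k0; rewrite !pdistE wedge_normZr fnormZ mulrCA -mulf_div divff ?mul1r//.
by rewrite normr_eq0.
Qed.

Lemma pdistZl x y (k : R) : k != 0 -> pdist (k *: x) y = pdist x y.
Proof. by move=> k0; rewrite pdistC pdistZr// pdistC. Qed.

(** Project [z] to the line of [y], then the result to the line of [x]. The middle line must be
    genuine, since [pdist] with the zero vector is 0. *)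
Lemma pdist_triangle y x z : x != 0 -> y != 0 -> z != 0 ->
  pdist x z <= pdist x y + pdist y z.
Proof.
move=> x0 y0 z0.
have [nx ny nz] : [/\ 0 < fnorm x, 0 < fnorm y & 0 < fnorm z].
  by rewrite !fnorm_gt0.
have [s sy sE] := wedge_decomp z y0.
have [t _ tE] := wedge_decomp y x0.
rewrite pdistE ler_pdivrMr ?mulr_gt0//.
apply: le_trans (wedge_norm_le_shift x z (s * t)) _.
have -> : z - (s * t) *: x = s *: (y - t *: x) + (z - s *: y).
  by apply/matrixP => i j; rewrite !mxE; ring.
apply: le_trans (ler_wpM2l (ltW nx) (ler_fnormD _ _)) _.
rewrite fnormZ mulrDr mulrCA tE mulrDl (wedge_pdist x0 y0).
apply: lerD.
  rewrite mulrCA ler_wpM2l ?pdist_ge0// mulrCA ler_wpM2l ?(ltW nx)//.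
rewrite mulrCA ler_wpM2l ?(ltW nx)// -(ler_pM2l ny) sE wedge_pdist//.
by rewrite mulrCA.
Qed.

(** Cleared of denominators: the ratio of [fnorm (Y *m x)] to [fnorm x] is Lipschitz in the line of
    [x], with constant [fnorm Y]. *)
Lemma pdist_lip m (Y : 'M[R]_(m, d)) x y : x != 0 -> y != 0 ->
  fnorm (Y *m x) * fnorm y <=
  fnorm (Y *m y) * fnorm x + fnorm Y * pdist x y * (fnorm x * fnorm y).
Proof.
move=> x0 y0; have ny : 0 < fnorm y by rewrite fnorm_gt0.
have [s sy sE] := wedge_decomp x y0.
have -> : Y *m x = s *: (Y *m y) + Y *m (x - s *: y).
  by rewrite mulmxBr -scalemxAr addrC subrK.
apply: le_trans (ler_wpM2r (ltW ny) (ler_fnormD _ _)) _.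
rewrite fnormZ mulrDl; apply: lerD.
  by rewrite mulrAC mulrC ler_wpM2l ?fnorm_ge0.
rewrite -mulrA -wedge_pdist// wedge_normC -sE mulrCA [_ * fnorm y]mulrC.
by rewrite ler_wpM2l ?(ltW ny)// fnormM.
Qed.

(** The expansion factor of [A] at the line of [y] is [fnorm A * fnorm y / fnorm (A *m y)], hence
    bounded as soon as [A] does not contract [y] much. *)
Lemma pdist_mulmx (A : 'M[R]_d) x y : x != 0 -> y != 0 ->
  A *m x != 0 -> A *m y != 0 ->
  pdist (A *m x) (A *m y) * fnorm (A *m y) <= fnorm A * (fnorm y * pdist x y).
Proof.
move=> x0 y0 Ax0 Ay0.
have [nx ny nAx nAy] : [/\ 0 < fnorm x, 0 < fnorm y, 0 < fnorm (A *m x)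
   & 0 < fnorm (A *m y)] by rewrite !fnorm_gt0.
have [t _ tE] := wedge_decomp y x0.
have := wedge_norm_le_shift (A *m x) (A *m y) t.
rewrite wedge_pdist// mulrCA ler_pM2l// => /le_trans; apply.
rewrite scalemxAr -mulmxBr (le_trans (fnormM _ _))// ler_wpM2l ?fnorm_ge0//.
by rewrite -(ler_pM2l nx) tE wedge_pdist// le_eqVlt; apply/orP; left; apply/eqP; ring.
Qed.

End Projective.

(** * Products aligned on their columns *)
Lemma mulmx_col11 (F : comNzRingType) m (z : 'cV[F]_m) (s : 'M[F]_1) :
  z *m s = s 0 0 *: z.
Proof. by apply/matrixP=> i j; rewrite !mxE big_ord1 (ord1 j) mulrC. Qed.

Lemma mulmx_row11 (F : comNzRingType) m (y : 'rV[F]_m) (s : 'M[F]_1) :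
  s *m y = s 0 0 *: y.
Proof. by apply/matrixP=> i j; rewrite !mxE big_ord1 (ord1 i). Qed.

Section Columns.
Context {R : realType} {d : nat}.
Implicit Types (A G X Y Z S : 'M[R]_d) (delta kappa : R).

(** Columns are images of basis vectors, to which the convergence hypothesis applies. The inequality
    keeps the columns of [S] away from the directions that [Y] contracts; zero columns satisfy it
    for free. *)
Definition colgood delta Y S : Prop :=
  forall j, delta * fnorm Y * fnorm (col j S) <= fnorm (Y *m col j S).

Definition colclose kappa S S' : Prop :=
  forall i j, col i S != 0 -> col j S' != 0 ->
    pdist (col i S) (col j S') < kappa.

Lemma colclose_le kappa kappa' S S' : kappa <= kappa' ->
  colclose kappa S S' -> colclose kappa' S S'.
Proof. by move=> kk SS i j si sj; exact: lt_le_trans (SS i j si sj) kk. Qed.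

Lemma colclose_gt0 kappa S S' : S != 0 -> S' != 0 -> colclose kappa S S' ->
  0 < kappa.
Proof.
move=> /nz_col[i si] /nz_col[j sj] /(_ i j si sj); exact/le_lt_trans/pdist_ge0.
Qed.

Lemma colgood_le delta delta' Y S : delta' <= delta -> colgood delta Y S ->
  colgood delta' Y S.
Proof.
move=> dd YS j; apply: le_trans (YS j).
by rewrite !ler_wpM2r ?fnorm_ge0.
Qed.

(** [pdist_lip] is applied from one nonzero column of [S] to each column of [S']: the drift of the
    direction is subtracted from the constant. *)
Lemma colgood_stable delta kappa Y S S' : S != 0 ->
  colgood delta Y S -> colclose kappa S S' -> colgood (delta - kappa) Y S'.
Proof.
move=> /nz_col[i si] YS SS j.
have [->|sj] := eqVneq (col j S') 0; first by rewrite mulmx0 !fnorm0 mulr0.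
have ni : 0 < fnorm (col i S) by rewrite fnorm_gt0.
have nj : 0 < fnorm (col j S') by rewrite fnorm_gt0.
have lip := pdist_lip Y si sj.
have lt := SS i j si sj.
rewrite -(ler_pM2r ni).
have h1 := ler_wpM2r (fnorm_ge0 (col j S')) (YS i).
have h2 : pdist (col i S) (col j S') * (fnorm Y * (fnorm (col i S) * fnorm (col j S')))
    <= kappa * (fnorm Y * (fnorm (col i S) * fnorm (col j S'))).
  by rewrite ler_wpM2r ?mulr_ge0 ?fnorm_ge0// ltW.
lra.
Qed.

Lemma colgood_fnorm delta Y S : 0 <= delta -> colgood delta Y S ->
  delta * fnorm Y * fnorm S <= fnorm (Y *m S).
Proof.
move=> d0 YS; have n0 : 0 <= delta * fnorm Y by rewrite mulr_ge0 ?fnorm_ge0.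
rewrite -{1}(ger0_norm n0) -fnormZ -[leRHS]mul1r.
apply: ler_fnorm_cols => // j.
have -> : col j (delta * fnorm Y *: S) = delta * fnorm Y *: col j S.
  by apply/matrixP => k l; rewrite !mxE.
by rewrite mul1r fnormZ ger0_norm// col_mulmx.
Qed.

(** Every column is replaced by its orthogonal projection to the line of column [i0], and [y]
    collects the coefficients. *)
Lemma rank_one_approx kappa G i0 : colclose kappa G G -> col i0 G != 0 ->
  exists y : 'rV[R]_d,
    fnorm (G - ((fnorm (col i0 G))^-1 *: col i0 G) *m y) <= kappa * fnorm G
    /\ fnorm y <= fnorm G.
Proof.
move=> cG g0; have n0 : 0 < fnorm (col i0 G) by rewrite fnorm_gt0.
have k0 : 0 < kappa by apply: le_lt_trans (cG _ _ g0 g0); exact: pdist_ge0.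
set z := _ *: _; have nz : fnorm z = 1.
  by rewrite fnormZ normfV ger0_norm ?fnorm_ge0// mulVf// gt_eqF.
have z0 : z != 0 by rewrite -fnorm_gt0 nz.
have /choice[t tP] : forall c, exists t : R, `|t| <= fnorm (col c G) /\
    fnorm (col c G - t *: z) <= kappa * fnorm (col c G).
  move=> c; have [s s1 s2] := wedge_decomp (col c G) z0.
  exists s; move: s1 s2; rewrite nz mulr1 mul1r => s1 s2; split => //.
  rewrite s2; have [->|gc0] := eqVneq (col c G) 0.
    by rewrite fnorm0 mulr0 wedge_normE fnorm0 mulr0 expr0n/= sub0r ler0_sqrtr// oppr_le0 sqr_ge0.
  rewrite wedge_pdist// nz mul1r ler_wpM2r ?fnorm_ge0// pdistZl ?invr_eq0 ?gt_eqF//.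
  by rewrite ltW// cG.
exists (\row_c t c); split.
  apply: ler_fnorm_cols (ltW k0) _ => c.
  rewrite (_ : col c _ = col c G - t c *: z); first by case: (tP c).
  by apply/matrixP => i j; rewrite !mxE big_ord1 !mxE mulrC.
rewrite -[leRHS]mul1r; apply: ler_fnorm_cols => // c.
rewrite mul1r; apply: le_trans (proj1 (tP c)).
rewrite -ler_sqr ?nnegrE ?fnorm_ge0// sqr_fnorm !big_ord1 !mxE.
by rewrite real_normK ?num_real.
Qed.

(** As [X] is nearly of rank one, [X *m q] points along the columns of [X] unless it is small, which
    [delta'] excludes. The bound on [kappa] makes the error at most [delta / 4] of [X *m q]; it is
    paid twice, which leaves [delta / 2]. *)
Lemma colgood_image delta delta' kappa Y X (q : 'cV[R]_d) :
  0 < delta <= 1 -> 0 < delta' -> kappa <= delta * delta' / 4 ->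
  colgood delta Y X -> colclose kappa X X ->
  delta' * fnorm X * fnorm q <= fnorm (X *m q) ->
  delta / 2 * fnorm Y * fnorm (X *m q) <= fnorm (Y *m (X *m q)).
Proof.
move=> /andP[d0 d1] d'0 kd YX cX Xq.
have [->|/nz_col[i0 x0]] := eqVneq X 0; first by rewrite mul0mx mulmx0 !fnorm0 mulr0.
have [y [Ey _]] := rank_one_approx cX x0.
have n0 : 0 < fnorm (col i0 X) by rewrite fnorm_gt0.
set z := _ *: _ in Ey; have nz : fnorm z = 1.
  by rewrite fnormZ normfV ger0_norm ?fnorm_ge0// mulVf// gt_eqF.
have Yz : delta * fnorm Y <= fnorm (Y *m z).
  rewrite -scalemxAr fnormZ normfV ger0_norm ?fnorm_ge0// [leRHS]mulrC.
  by rewrite ler_pdivlMr//; exact: YX.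
set E := X - _ in Ey.
pose s := (y *m q) 0 0.
have XqE : X *m q = s *: z + E *m q.
  by rewrite -mulmx_col11 mulmxA -mulmxDl /E addrC subrK.
have Eq : fnorm (E *m q) <= delta / 4 * fnorm (X *m q).
  apply: le_trans (fnormM _ _) _.
  apply: le_trans (ler_wpM2r (fnorm_ge0 _) Ey) _.
  have h1 := ler_wpM2r (mulr_ge0 (fnorm_ge0 X) (fnorm_ge0 q)) kd.
  have h2 := ler_wpM2l (ltW d0) Xq.
  lra.
have s1 : fnorm (X *m q) - fnorm (E *m q) <= `|s|.
  rewrite -[leRHS]mulr1 -nz -fnormZ lerBlDr {1}XqE; exact: ler_fnormD.
have YXq : `|s| * fnorm (Y *m z) - fnorm Y * fnorm (E *m q) <= fnorm (Y *m (X *m q)).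
  have e : s *: (Y *m z) = Y *m (X *m q) - Y *m (E *m q).
    by rewrite XqE mulmxDr addrK scalemxAr.
  rewrite lerBlDr -fnormZ e.
  by apply: le_trans (ler_fnormB _ _) _; rewrite lerD2l fnormM.
apply: le_trans YXq.
have h1 : (fnorm (X *m q) - fnorm (E *m q)) * (delta * fnorm Y) <= `|s| * fnorm (Y *m z).
  apply: (@le_trans _ _ (`|s| * (delta * fnorm Y))); last by rewrite ler_wpM2l.
  by rewrite ler_wpM2r// mulr_ge0 ?fnorm_ge0// ltW.
rewrite lerBrDr (le_trans _ h1)//.
have := fnorm_ge0 Y; move: (fnorm_ge0 (E *m q)) (fnorm_ge0 (X *m q)) Eq.
move: (fnorm Y) (fnorm (X *m q)) (fnorm (E *m q)) => a b e e0 b0 eb a0.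
have -> : delta / 2 * a * b + a * e = a * (delta / 2 * b + e) by ring.
have -> : (b - e) * (delta * a) = a * (delta * b - delta * e) by ring.
rewrite ler_wpM2l//.
have : delta * e <= e by rewrite ler_piMl.
lra.
Qed.

(* The row direction of [X = Yj Z] is that of [Z], since the junction before [Z]
   is good both for the prefix [Y0] and for [Yj]; this transfers the good
   alignment of [Y0 Z] with [H] to [X]. *)
Lemma junction delta kappa A X Y0 Yj Z H P :
  0 < delta <= 1 -> kappa <= delta ^+ 4 / 32 ->
  Y0 != 0 -> H != 0 -> X = Yj *m Z ->
  colgood delta (Y0 *m Z) H -> colclose kappa H P ->
  colgood delta Y0 Z -> colgood delta Yj Z ->
  colgood delta P X -> colgood delta A X ->
  colclose kappa Z Z -> colclose kappa X X -> colclose kappa P P ->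
  colgood (delta ^+ 4 / 16) (X *m P) (X *m P) /\ colgood (delta / 2) A (X *m H).
Proof.
move=> /andP[d0 d1] kd Y00 H0 XE gH cHP gY0 gYj gP gA cZ cX cP.
have d2 : delta ^+ 2 <= delta by rewrite expr2 ler_piMl// ltW.
have d3 : delta ^+ 3 <= delta ^+ 2 by rewrite exprS ler_piMl// sqr_ge0.
have d4 : delta ^+ 4 <= delta ^+ 3 by rewrite exprS ler_piMl// exprn_ge0// ltW.
have p2 : 0 < delta ^+ 2 by rewrite exprn_gt0.
have p3 : 0 < delta ^+ 3 by rewrite exprn_gt0.
have p4 : 0 < delta ^+ 4 by rewrite exprn_gt0.
have nY0 : 0 < fnorm Y0 by rewrite fnorm_gt0.
(* Cancelling [fnorm Y0] leaves the factor [delta ^+ 2 / 2] for [Z] alone; passing through [Yj]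
   costs a further [delta / 2], whence [delta ^+ 3 / 4]. *)
have image (p : 'cV[R]_d) : delta / 2 * fnorm (Y0 *m Z) * fnorm p <= fnorm (Y0 *m Z *m p) ->
    delta ^+ 3 / 4 * fnorm X * fnorm p <= fnorm (X *m p).
  move=> hp; have hZ : delta ^+ 2 / 2 * fnorm Z * fnorm p <= fnorm (Z *m p).
    rewrite -(ler_pM2l nY0).
    have h1 := fnormM Y0 (Z *m p).
    have h2 := ler_wpM2r (fnorm_ge0 p) (colgood_fnorm (ltW d0) gY0).
    rewrite -mulmxA in hp.
    have h3 := ler_wpM2l (ltW d0) h2.
    rewrite expr2; lra.
  have k2 : kappa <= delta * (delta ^+ 2 / 2) / 4.
    by move: kd d4; rewrite !exprS; lra.
  have := colgood_image (introT andP (conj d0 d1)) (divr_gt0 p2 _) k2 gYj cZ hZ.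
  rewrite XE -mulmxA => /(_ (ltr0Sn _ _)) h.
  apply: le_trans h.
  have h1 := ler_wpM2r (fnorm_ge0 p) (fnormM Yj Z).
  have h2 := ler_wpM2l (ltW p3) h1.
  have h3 := ler_wpM2l (fnorm_ge0 Yj) hZ.
  have h4 := ler_wpM2l (ltW d0) h3.
  move: h2 h4; rewrite !exprS expr0 !mulr1 ; lra.
have imageH j : delta ^+ 3 / 4 * fnorm X * fnorm (col j H) <= fnorm (X *m col j H).
  apply: image; apply: le_trans (gH j).
  rewrite -!mulrA ler_pM2l// ler_piMl ?mulr_ge0 ?fnorm_ge0//; lra.
have imageP j : delta ^+ 3 / 4 * fnorm X * fnorm (col j P) <= fnorm (X *m col j P).
  apply: image; apply: le_trans (colgood_stable H0 gH cHP j).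
  by rewrite -[leLHS]mulrA -[leRHS]mulrA ler_wpM2r ?mulr_ge0 ?fnorm_ge0//; lra.
have p34 : 0 < delta ^+ 3 / 4 by rewrite divr_gt0.
have k3 : kappa <= delta * (delta ^+ 3 / 4) / 4.
  by rewrite [delta ^+ 4]exprS in kd; move: kd p4; rewrite exprS; lra.
have d01 : 0 < delta <= 1 by rewrite d0.
split=> j; last first.
  rewrite !col_mulmx; exact: (colgood_image d01 p34 k3 gA cX (imageH j)).
(* [q] goes through [P] with the factor [delta / 2], then through [X] with half of [delta ^+ 3 / 4];
   the product is [delta ^+ 4 / 16]. *)
rewrite !col_mulmx; set q := X *m col j P.
have h1 : delta / 2 * fnorm P * fnorm q <= fnorm (P *m q).
  exact: (colgood_image d01 p34 k3 gP cX (imageP j)).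
have d34 : 0 < delta ^+ 3 / 4 <= 1 by rewrite p34/=; lra.
have k4 : kappa <= delta ^+ 3 / 4 * (delta / 2) / 4.
  by move: kd; rewrite [delta ^+ 4]exprSr; lra.
have h2 := colgood_image d34 (divr_gt0 d0 (ltr0Sn _ 1)) k4 imageP cP h1.
rewrite -mulmxA; apply: le_trans h2.
have h3 := ler_wpM2r (fnorm_ge0 q) (fnormM X P).
have h4 := ler_wpM2l (ltW p4) h3.
have h5 := ler_wpM2l (fnorm_ge0 X) h1.
have h6 := ler_wpM2l (ltW p3) h5.
move: h4 h6; rewrite [delta ^+ 4]exprSr; lra.
Qed.

End Columns.

(** * Deflation of the characteristic polynomial *)
Section CharPoly.
Context {F : fieldType}.

Lemma char_poly_similar n (Q A B : 'M[F]_n) : Q \in unitmx ->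
  Q *m A = B *m Q -> char_poly A = char_poly B.
Proof.
move=> Qu QA; rewrite /char_poly.
pose Qp := map_mx (@polyC F) Q.
have Qp0 : \det Qp != 0.
  by rewrite det_map_mx/= polyC_eq0 -unitfE -unitmxE.
apply: (mulfI Qp0); rewrite -det_mulmx mulrC -det_mulmx; congr (\det _).
rewrite /char_poly_mx mulmxBr mulmxBl mul_mx_scalar mul_scalar_mx.
by rewrite -!map_mxM QA.
Qed.

(** Two eliminations in the block matrix [M] compute its determinant from either product. No inverse
    of [A] or [B] is taken, so singular letters are allowed. *)
Lemma char_poly_mulC n (A B : 'M[F]_n) :
  char_poly (A *m B) = char_poly (B *m A).
Proof.
pose Ap := map_mx (@polyC F) A; pose Bp := map_mx (@polyC F) B.
pose M := block_mx 'X%:M Ap Bp 1%:M.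
have h1 : \det M = char_poly (A *m B).
  have := congr1 determinant (mulmx_block 1%:M (- Ap) 0 1%:M 'X%:M Ap Bp 1%:M).
  rewrite !mul1mx !mul0mx !mulmx1 !add0r subrr det_lblock det_mulmx det_ublock.
  by rewrite !det1 !mul1r mulr1 mulNmx -map_mxM.
have h2 : 'X ^+ n * \det M = 'X ^+ n * char_poly (B *m A).
  have := congr1 determinant (mulmx_block 1%:M 0 (- Bp) 'X%:M 'X%:M Ap Bp 1%:M).
  rewrite !mul1mx !mul0mx !mulmx1 !addr0 mul_mx_scalar mul_scalar_mx.
  rewrite scalerN addNr det_ublock det_mulmx det_lblock.
  rewrite det1 mul1r !det_scalar mulNmx -map_mxM addrC => ->.
  by rewrite /char_poly /char_poly_mx.
apply: (mulfI (x := 'X ^+ n)); first by rewrite expf_neq0// polyX_eq0.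
by rewrite -h2 h1.
Qed.

Lemma char_poly_trmx n (A : 'M[F]_n) : char_poly A^T = char_poly A.
Proof.
rewrite /char_poly -[in RHS]det_tr; congr (\det _).
by rewrite /char_poly_mx linearB/= tr_scalar_mx map_trmx.
Qed.

Lemma complete_col n (x : 'cV[F]_n.+1) : x != 0 ->
  exists2 Q : 'M[F]_n.+1, Q \in unitmx & Q *m x = delta_mx 0 0.
Proof.
move=> x0; have [i xi] : exists i, x i 0 != 0.
  apply/existsP; apply: contraNT x0; rewrite negb_exists => /forallP x0.
  by apply/eqP/matrixP => i j; rewrite (ord1 j) mxE; exact/eqP/negPn/x0.
pose f : 'M[F]_n.+1 := delta_mx i 0.
have rx : \rank x^T = 1%N.
  by apply/eqP; rewrite eqn_leq rank_leq_row lt0n mxrank_eq0 trmx_eq0.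
have xf : x^T *m f = x i 0 *: delta_mx 0 0.
  apply/matrixP => k l; rewrite !mxE (bigD1 i)//= !mxE (ord1 k) eqxx/=.
  rewrite big1 ?addr0 ?eqxx// => j ji; by rewrite !mxE (negPf ji) mulr0.
have [|g gu xg] := @complete_unitmx _ _ _ x^T f.
  rewrite rx xf; apply/eqP.
  by rewrite mxrank_scale_nz// mxrank_delta.
exists ((x i 0)^-1 *: g^T).
  by rewrite unitmxZ ?unitmx_tr// unitfE invr_eq0.
apply: trmx_inj; rewrite trmx_mul linearZ/= trmxK -scalemxAr -xg xf scalerA.
by rewrite mulVf// scale1r trmx_delta.
Qed.

(** [L] is the projection to the quotient by the eigenline and [G'] the endomorphism induced there.
    The last two clauses say that [L] is onto and that its kernel is the line of [x]. *)
Lemma deflation n (G : 'M[F]_n.+1) (x : 'cV[F]_n.+1) (lam : F) :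
  x != 0 -> G *m x = lam *: x ->
  exists (G' : 'M[F]_n) (L : 'M[F]_(n, n.+1)),
  [/\ char_poly G = ('X - lam%:P) * char_poly G',
      L *m G = G' *m L, L *m x = 0,
      (forall f : 'rV[F]_n, f *m L = 0 -> f = 0) &
      (forall v : 'cV[F]_n.+1, L *m v = 0 -> exists c, v = c *: x)].
Proof.
move=> x0 Gx; have [Q Qu Qx] := complete_col x0.
have QV : Q *m invmx Q = 1%:M by rewrite mulmxV.
pose M : 'M[F]_(1 + n) := Q *m G *m invmx Q.
have MQ : Q *m G = M *m Q by rewrite -mulmxA mulVmx// mulmx1.
have Me : M *m delta_mx 0 (0 : 'I_1) = lam *: delta_mx 0 0.
  by rewrite -Qx mulmxA -MQ -mulmxA Gx scalemxAr.
clearbody M.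
have lM : lsubmx M = lam *: delta_mx 0 0.
  rewrite -Me; apply/matrixP => i j; rewrite (ord1 j) mxE -colE mxE.
  by congr (M _ _); exact/val_inj.
have ME : M = block_mx lam%:M (ursubmx M) 0 (drsubmx M).
  rewrite -[LHS]submxK; congr block_mx.
    apply/matrixP => i j; have /matrixP/(_ (lshift n i) j) := lM.
    by rewrite !mxE !ord1 /= mulr1.
  apply/matrixP => i j; have /matrixP/(_ (rshift 1 i) j) := lM.
  by rewrite !mxE !ord1 /= mulr0.
pose Q' : 'M[F]_(1 + n, 1 + n) := Q.
exists (drsubmx M), (dsubmx Q'); split.
- have cM : char_poly_mx M = block_mx ('X%:M - lam%:P%:M)
      (- map_mx polyC (ursubmx M)) 0 (char_poly_mx (drsubmx M)).
    rewrite {1}ME /char_poly_mx map_block_mx/= scalar_mx_block opp_block_mx.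
    by rewrite add_block_mx map_scalar_mx map_mx0 oppr0 !add0r.
  rewrite (char_poly_similar Qu MQ) /char_poly (congr1 determinant cM).
  by rewrite det_ublock -raddfB/= det_scalar1.
- have : dsubmx (Q' *m (G : 'M[F]_(1 + n))) = dsubmx (M *m Q') by rewrite /Q' MQ.
  rewrite -!mul_dsub_mx => ->.
  have -> : dsubmx M = row_mx 0 (drsubmx M) by rewrite {1}ME /block_mx col_mxKd.
  by rewrite -[Q']vsubmxK mul_row_col mul0mx add0r col_mxKd.
- by rewrite mul_dsub_mx Qx; apply/matrixP => i j; rewrite !mxE.
- move=> f fL; have : row_mx 0 f *m Q' = 0.
    by rewrite -[Q']vsubmxK mul_row_col mul0mx add0r fL.
  move=> /(congr1 (mulmx^~ (invmx Q))); rewrite -mulmxA QV mulmx1 mul0mx.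
  move=> /(congr1 (@rsubmx F 1 1 n)); rewrite row_mxKr => ->.
  by apply/matrixP => i j; rewrite !mxE.
- move=> v Lv; exists ((Q *m v) 0 0).
  have key (w : 'cV[F]_(1 + n)) : dsubmx w = 0 -> w = w 0 0 *: delta_mx 0 0.
    move=> w0; apply/matrixP => i j; rewrite (ord1 j) [RHS]mxE mxE.
    have [->|i0] := eqVneq i 0; first by rewrite mulr1.
    rewrite mulr0; have [k ->] : exists k : 'I_n, i = rshift 1 k.
      case: (unliftP 0 i) i0 => [k ->|->]; rewrite ?eqxx// => _; exists k.
      exact/val_inj.
    by have /matrixP/(_ k 0) := w0; rewrite !mxE.
  have := key (Q' *m v); rewrite -mul_dsub_mx => /(_ Lv).
  rewrite -[X in _ = _ *: X]Qx scalemxAr => /(congr1 (mulmx (invmx Q))).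
  by rewrite !mulmxA mulVmx// !mul1mx.
Qed.

End CharPoly.

Section Deflated.
Context {F : fieldType} {n : nat}.
Implicit Types (G : 'M[F]_n.+1) (x v : 'cV[F]_n.+1) (lam mu : F) (s : seq F).

(** A left eigenvector of the quotient matrix, pulled back by [L], vanishes at [x]. As [s] is a
    list, [mu] may equal [lam] when [lam] is a repeated root. *)
Lemma left_eigenvector_killing G x lam mu s : x != 0 -> G *m x = lam *: x ->
  char_poly G = \prod_(z <- lam :: s) ('X - z%:P) -> mu \in s ->
  exists f : 'rV[F]_n.+1, [/\ f != 0, f *m x = 0 & f *m G = mu *: f].
Proof.
move=> x0 Gx cG mus; have [G' [L [cG' LG Lx Lf _]]] := deflation x0 Gx.
have {}cG' : char_poly G' = \prod_(z <- s) ('X - z%:P).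
  apply: (@mulfI _ ('X - lam%:P)); first by rewrite polyXsubC_eq0.
  by rewrite -cG' cG big_cons.
have : eigenvalue G' mu by rewrite eigenvalue_root_char cG' root_prod_XsubC.
move=> /eigenvalueP[f fG f0]; exists (f *m L); split.
- by apply: contraNneq f0 => /Lf ->.
- by rewrite -mulmxA Lx mulmx0.
- by rewrite -mulmxA LG mulmxA fG scalemxAl.
Qed.

(** [L *m v] is a nonzero eigenvector of the quotient matrix. For [mu = lam] this says that two
    independent eigenvectors force a repeated root. *)
Lemma second_eigenvalue G x v lam mu s : x != 0 -> G *m x = lam *: x ->
  G *m v = mu *: v -> (forall c, v != c *: x) ->
  char_poly G = \prod_(z <- lam :: s) ('X - z%:P) -> mu \in s.
Proof.
move=> x0 Gx Gv vx cG; have [G' [L [cG' LG Lx _ Lv]]] := deflation x0 Gx.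
have {}cG' : char_poly G' = \prod_(z <- s) ('X - z%:P).
  apply: (@mulfI _ ('X - lam%:P)); first by rewrite polyXsubC_eq0.
  by rewrite -cG' cG big_cons.
have Lv0 : L *m v != 0.
  by apply/eqP => /Lv[c vc]; have := vx c; rewrite vc eqxx.
rewrite -root_prod_XsubC -cG' -char_poly_trmx -eigenvalue_root_char.
apply/eigenvalueP; exists (L *m v)^T; last by rewrite trmx_eq0.
by rewrite -trmx_mul mulmxA -LG -mulmxA Gv -scalemxAr linearZ.
Qed.

Lemma right_eigenvector G lam : root (char_poly G) lam ->
  exists2 x : 'cV[F]_n.+1, x != 0 & G *m x = lam *: x.
Proof.
rewrite -char_poly_trmx -eigenvalue_root_char => /eigenvalueP[f fG f0].
exists f^T; first by rewrite trmx_eq0.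
by rewrite -[G in LHS]trmxK -trmx_mul fG linearZ.
Qed.

End Deflated.

(** * Spectrum of a nearly rank-one matrix *)
Import ComplexField.Normc.

Section ComplexNorm.
Context {R : realType}.
Local Notation C := (complex.complex R).

Definition toC m n (g : 'M[R]_(m, n)) : 'M[C]_(m, n) :=
  map_mx (fun x : R => Complex x 0) g.

Lemma toCM m n p (A : 'M[R]_(m, n)) (B : 'M[R]_(n, p)) :
  toC (A *m B) = toC A *m toC B.
Proof. exact: (map_mxM (real_complex R)). Qed.

Lemma toCD m n (A B : 'M[R]_(m, n)) : toC (A + B) = toC A + toC B.
Proof. exact: (map_mxD (real_complex R)). Qed.

Lemma toCZ m n (k : R) (A : 'M[R]_(m, n)) : toC (k *: A) = Complex k 0 *: toC A.
Proof. exact: (map_mxZ (real_complex R)). Qed.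

Lemma toC_eq0 m n (A : 'M[R]_(m, n)) : (toC A == 0) = (A == 0).
Proof. exact: (map_mx_eq0 (real_complex R)). Qed.

Lemma normc_real (x : R) : normc (Complex x 0) = `|x|.
Proof. by rewrite /normc expr0n/= addr0 sqrtr_sqr. Qed.

Lemma normc_ge0 (z : C) : 0 <= normc z.
Proof. by case: z => a b; exact: sqrtr_ge0. Qed.

Lemma normcD (z w : C) : normc (z + w) <= normc z + normc w.
Proof. exact: le_normcD. Qed.

Lemma normc_sum (I : Type) (r : seq I) (F : I -> C) :
  normc (\sum_(i <- r) F i) <= \sum_(i <- r) normc (F i).
Proof.
elim/big_ind2: _ => [||//]; first by rewrite normc0.
by move=> x a y b xa yb; apply: le_trans (normcD _ _) _; exact: lerD.
Qed.

(** The entrywise sum is submultiplicative too, and the spectral estimates are only wanted up to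
    powers of the dimension. *)
Definition cnorm m n (A : 'M[C]_(m, n)) : R := \sum_i \sum_j normc (A i j).

Lemma cnorm_ge0 m n (A : 'M[C]_(m, n)) : 0 <= cnorm A.
Proof. by apply: sumr_ge0 => i _; apply: sumr_ge0 => j _; exact: normc_ge0. Qed.

Lemma le_coord_cnorm m n (A : 'M[C]_(m, n)) i j : normc (A i j) <= cnorm A.
Proof.
rewrite /cnorm (bigD1 i)//= (bigD1 j)//= -addrA lerDl addr_ge0 ?sumr_ge0//.
  by move=> k _; exact: normc_ge0.
by move=> k _; apply: sumr_ge0 => l _; exact: normc_ge0.
Qed.

Lemma cnorm_gt0 m n (A : 'M[C]_(m, n)) : A != 0 -> 0 < cnorm A.
Proof.
move=> A0; rewrite lt_def cnorm_ge0 andbT; apply: contraNneq A0 => cA.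
apply/eqP/matrixP => i j; rewrite mxE; apply: eq0_normc.
by apply/eqP; rewrite eq_le normc_ge0 andbT -cA le_coord_cnorm.
Qed.

Lemma cnormD m n (A B : 'M[C]_(m, n)) : cnorm (A + B) <= cnorm A + cnorm B.
Proof.
rewrite /cnorm -big_split; apply: ler_sum => i _; rewrite -big_split.
by apply: ler_sum => j _; rewrite mxE normcD.
Qed.

Lemma cnormZ m n (k : C) (A : 'M[C]_(m, n)) : cnorm (k *: A) = normc k * cnorm A.
Proof.
rewrite /cnorm mulr_sumr; apply: eq_bigr => i _; rewrite mulr_sumr.
by apply: eq_bigr => j _; rewrite mxE normcM.
Qed.

Lemma cnormM m n p (A : 'M[C]_(m, n)) (B : 'M[C]_(n, p)) :
  cnorm (A *m B) <= cnorm A * cnorm B.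
Proof.
rewrite /cnorm mulr_suml; apply: ler_sum => i _.
apply: (@le_trans _ _ (\sum_k \sum_j normc (A i j) * normc (B j k))).
  apply: ler_sum => k _; rewrite mxE; apply: le_trans (normc_sum _ _) _.
  by apply: ler_sum => j _; rewrite normcM.
rewrite exchange_big mulr_suml; apply: ler_sum => j _ /=.
rewrite -mulr_sumr ler_wpM2l ?normc_ge0// (bigD1 j)//= lerDl.
by apply: sumr_ge0 => k _; apply: sumr_ge0 => l _; exact: normc_ge0.
Qed.

Lemma cnorm_toC m n (A : 'M[R]_(m, n)) : cnorm (toC A) <= (m * n)%:R * fnorm A.
Proof.
apply: (@le_trans _ _ (\sum_(i < m) \sum_(j < n) fnorm A)).
  apply: ler_sum => i _; apply: ler_sum => j _.
  by rewrite mxE normc_real le_coord_fnorm.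
by rewrite !sumr_const !card_ord natrM -mulrA !mulr_natl.
Qed.

End ComplexNorm.

Section Spectrum.
Context {R : realType} {n : nat}.
Local Notation C := (complex.complex R).
Implicit Types (g G : 'M[R]_n.+2) (s : seq C) (z : C).

Lemma eigvalsP g : char_poly (toC g) = \prod_(z <- eigvals g) ('X - z%:P).
Proof.
rewrite /eigvals; case: closed_field_poly_normal => s /= e.
by rewrite [LHS]e (monicP (char_poly_monic _)) scale1r.
Qed.

Lemma size_spectrum g s : char_poly (toC g) = \prod_(z <- s) ('X - z%:P) ->
  size s = n.+2.
Proof.
by move=> /(congr1 (fun p : {poly C} => size p));
  rewrite size_char_poly size_prod_XsubC => -[].
Qed.

Lemma spectrum_sorted g : exists z1 z2 s,
  [/\ char_poly (toC g) = \prod_(z <- [:: z1, z2 & s]) ('X - z%:P),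
      rho 1 g = normc z1, rho 2 g = normc z2, normc z2 <= normc z1 &
      forall z, z \in s -> normc z <= normc z2].
Proof.
pose leT := relpre (@normc R) (fun x y : R => y <= x).
have eE : eigmoduli g = map (@normc R) (sort leT (eigvals g)).
  by rewrite /eigmoduli sort_map.
have tot : total leT by move=> x y; exact: le_total.
have tr : transitive leT by move=> y x z xy yz; exact: le_trans yz xy.
have cE : char_poly (toC g) = \prod_(z <- sort leT (eigvals g)) ('X - z%:P).
  by rewrite eigvalsP; apply: perm_big; rewrite perm_sym perm_sort.
have := sort_sorted tot (eigvals g); have := size_spectrum cE.
rewrite /rho eE; case: sort cE => [//|z1 [//|z2 s]] cE _ /=.
rewrite (path_sortedE tr) => /andP[z12 /andP[z2s _]].
exists z1, z2, s; split => // z zs; exact: (allP z2s).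
Qed.

(** By unique factorization any such list is a permutation of [eigvals g], and only its two heads
    have to be in place. The measurability argument finds the roots as solutions of equations and
    needs [rho] from them. *)
Lemma rho_spectrum g z1 z2 s :
  char_poly (toC g) = \prod_(z <- [:: z1, z2 & s]) ('X - z%:P) ->
  normc z2 <= normc z1 -> (forall z, z \in s -> normc z <= normc z2) ->
  rho 1 g = normc z1 /\ rho 2 g = normc z2.
Proof.
move=> cE z21 sz2; rewrite eigvalsP in cE.
have pE := prod_XsubC_eq cE.
have sE : eigmoduli g = [:: normc z1, normc z2 & sort (fun x y : R => y <= x) (map (@normc R) s)].
  apply: (@sorted_eq _ (fun x y : R => y <= x)).
  - by move=> y x z xy yz; exact: le_trans yz xy.
  - by move=> x y /andP[xy yx]; apply/le_anti; rewrite xy yx.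
  - by apply: sort_sorted => x y; exact: le_total.
  - rewrite /= z21 /= path_min_sorted.
      by apply: sort_sorted => x y; exact: le_total.
    by apply/allP => x; rewrite mem_sort => /mapP[z zs ->]; exact: sz2.
  rewrite /eigmoduli perm_sort (perm_trans (perm_map _ pE))//= !perm_cons.
  by rewrite perm_sym perm_sort.
by rewrite /rho sE.
Qed.

Lemma rho_ge0 k g : 0 <= rho k g.
Proof.
rewrite /rho; have [lt|ge] := ltnP k.-1 (size (eigmoduli g)).
  have := mem_nth 0 lt; move: (nth _ _ _) => x.
  by rewrite mem_sort => /mapP[z _ ->]; exact: normc_ge0.
by rewrite nth_default.
Qed.

Lemma rho2_le_rho1 g : rho 2 g <= rho 1 g.
Proof. by have [z1 [z2 [s [_ -> ->]]]] := spectrum_sorted g. Qed.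

Lemma rho_mulC k (A B : 'M[R]_n.+2) : rho k (A *m B) = rho k (B *m A).
Proof.
suff E : eigmoduli (A *m B) = eigmoduli (B *m A) by rewrite /rho E.
have cE : char_poly (toC (A *m B)) = char_poly (toC (B *m A)).
  by rewrite !toCM char_poly_mulC.
rewrite !eigvalsP in cE.
apply/perm_sortP; last exact/perm_map/prod_XsubC_eq.
- by move=> x y; exact: le_total.
- by move=> y x z xy yz; exact: le_trans yz xy.
- by move=> x y /andP[xy yx]; apply/le_anti; rewrite xy yx.
Qed.

(** The trace is the sum of the eigenvalues. This is the source of every quantitative lower bound
    for [rho 1]. *)
Lemma tr_le_rho G : `|\tr G| <= n.+2%:R * rho 1 G.
Proof.
have [z1 [z2 [s [cE -> _ z21 sz2]]]] := spectrum_sorted G.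
have ss : size [:: z1, z2 & s] = n.+2 := size_spectrum cE.
have trE : Complex (\tr G) 0 = \sum_(z <- [:: z1, z2 & s]) z.
  have := coefPn_prod_XsubC (ps := [:: z1, z2 & s]) isT.
  rewrite -cE ss char_poly_trace// => /oppr_inj <-.
  exact/esym/(trace_map_mx (real_complex R)).
rewrite -normc_real trE; apply: le_trans (normc_sum _ _) _.
rewrite -[in leRHS]ss -sum1_size natr_sum mulr_suml !big_seq.
apply: ler_sum => z; rewrite mul1r !inE => /predU1P[->//|/predU1P[->//|zs]].
exact: le_trans (sz2 _ zs) z21.
Qed.

End Spectrum.

Section Gap.
Context {R : realType} {n : nat}.
Local Notation d := n.+2.
Implicit Types (G E : 'M[R]_n.+2) (eta eps : R).

(* If [f] is a left eigenvector for the second eigenvalue killing the top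
   eigenvector [x], then [f G x = 0] bounds [f z] by the size of [E]. *)
Lemma rank_one_rho2 G E (z : 'cV[R]_n.+2) (y : 'rV[R]_n.+2) :
  G = z *m y + E -> cnorm (toC E) < rho 1 G ->
  rho 2 G <= cnorm (toC E) *
    (cnorm (toC y) * cnorm (toC z) / (rho 1 G - cnorm (toC E)) + 1).
Proof.
move=> GE; have [z1 [z2 [s [cE -> -> _ _]]]] := spectrum_sorted G.
move=> lt.
have rt : root (char_poly (toC G)) z1 by rewrite cE root_prod_XsubC mem_head.
have [x x0 Gx] := right_eigenvector rt.
have [f [f0 fx fG]] := left_eigenvector_killing x0 Gx cE (mem_head _ _).
have GCE : toC G = toC z *m toC y + toC E by rewrite GE toCD toCM.
set e := cnorm (toC E) in lt *; set cy := cnorm (toC y); set cz := cnorm (toC z).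
have [e0 cy0 cz0] : [/\ 0 <= e, 0 <= cy & 0 <= cz] by rewrite !cnorm_ge0.
have nx := cnorm_gt0 x0; have nf := cnorm_gt0 f0.
pose u := (toC y *m x) 0 0; pose w := (f *m toC z) 0 0.
have uE : toC z *m (toC y *m x) = u *: toC z.
  exact: mulmx_col11.
have wE : (f *m toC z) *m toC y = w *: toC y.
  exact: mulmx_row11.
have h1 : normc z1 * cnorm x <= normc u * cz + e * cnorm x.
  rewrite -cnormZ -Gx GCE mulmxDl -mulmxA uE.
  apply: le_trans (cnormD _ _) _; rewrite cnormZ lerD2l; exact: cnormM.
have h2 : normc w * normc u <= cnorm f * e * cnorm x.
  have : f *m (toC G *m x) = 0 by rewrite Gx -scalemxAr fx scaler0.
  rewrite GCE mulmxDl -mulmxA uE mulmxDr -scalemxAr => /eqP.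
  rewrite addr_eq0 => /eqP /(congr1 (fun M : 'M[R[i]]_1 => normc (M 0 0))).
  rewrite mxE [in RHS]mxE normcM normcN -/w mulrC => ->.
  apply: le_trans (le_coord_cnorm _ _ _) _; rewrite mulmxA.
  apply: le_trans (cnormM _ _) _; rewrite ler_wpM2r ?cnorm_ge0//.
  exact: cnormM.
have h3 : normc z2 * cnorm f <= normc w * cy + cnorm f * e.
  rewrite -cnormZ -fG GCE mulmxDr mulmxA wE.
  apply: le_trans (cnormD _ _) _; rewrite cnormZ lerD2l; exact: cnormM.
have a0 : 0 < normc z1 - e by rewrite subr_gt0.
have u0 : 0 < normc u * cz.
  have : 0 < (normc z1 - e) * cnorm x by rewrite mulr_gt0.
  by move/lt_le_trans; apply; rewrite mulrBl lerBlDr.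
have w0 : 0 <= normc w := normc_ge0 w.
have h4 : normc w * (normc z1 - e) <= cnorm f * e * cz.
  rewrite -(ler_pM2r nx).
  have h5 : normc w * ((normc z1 - e) * cnorm x) <= normc w * (normc u * cz).
    by rewrite ler_wpM2l// mulrBl lerBlDr.
  have h6 := ler_wpM2r cz0 h2.
  lra.
rewrite -(ler_pM2r nf); apply: le_trans h3 _.
have h7 : normc w <= cnorm f * e * cz / (normc z1 - e) by rewrite ler_pdivlMr.
have h8 := ler_wpM2r cy0 h7.
move: h8; set i := (_ - _)^-1; lra.
Qed.

(** The scalar [u] is at once the trace of the rank-one part [z *m y] and the factor by which that
    part stretches [z]. Goodness of [G] against its own columns makes it of size [eta * fnorm G], so
    the trace is large and with it [rho 1 G]; [rank_one_rho2] then bounds [rho 2 G]. *)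
Lemma spectral_gap eta eps G : 0 < eta <= 1 -> eps <= eta / (4 * d%:R ^+ 3) ->
  G != 0 -> colgood eta G G -> colclose eps G G ->
  eta / (2 * d%:R) * fnorm G <= rho 1 G /\
  rho 2 G <= 10 * d%:R ^+ 6 / eta ^+ 2 * eps * rho 1 G.
Proof.
move=> /andP[eta0 eta1] epsle G0 gG cG.
have eps0 := colclose_gt0 G0 G0 cG.
have [i0 g0] := nz_col G0.
have [y [Ey ny]] := rank_one_approx cG g0.
have n0 : 0 < fnorm (col i0 G) by rewrite fnorm_gt0.
set z := _ *: _ in Ey; have nz : fnorm z = 1.
  by rewrite fnormZ normfV ger0_norm ?fnorm_ge0// mulVf// gt_eqF.
have Gz : eta * fnorm G <= fnorm (G *m z).
  rewrite -scalemxAr fnormZ normfV ger0_norm ?fnorm_ge0// [leRHS]mulrC.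
  by rewrite ler_pdivlMr//; exact: gG.
set E := G - _ in Ey.
have GE : G = z *m y + E by rewrite /E addrC subrK.
have nG : 0 < fnorm G by rewrite fnorm_gt0.
pose u := (y *m z) 0 0.
have hu : eta * fnorm G - eps * fnorm G <= `|u|.
  rewrite -[leRHS]mulr1 -nz -fnormZ lerBlDr.
  apply: le_trans Gz _; rewrite {1}GE mulmxDl -mulmxA mulmx_col11.
  apply: le_trans (ler_fnormD _ _) _; rewrite lerD2l.
  by apply: le_trans (fnormM _ _) _; rewrite nz mulr1.
have d0 : 2 <= d%:R :> R by rewrite ler_nat.
have d3 : 8 <= d%:R ^+ 3 :> R.
  have -> : 8 = 2 ^+ 3 :> R by rewrite -natrX.
  by rewrite lerXn2r ?nnegrE//; lra.
have d23 : 4 * d%:R <= d%:R ^+ 3 :> R.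
  rewrite exprSr; apply: ler_wpM2r; first lra.
  have -> : 4 = 2 ^+ 2 :> R by rewrite -natrX.
  by rewrite lerXn2r ?nnegrE//; lra.
have p3 : 0 < 4 * d%:R ^+ 3 :> R by lra.
have epsle' : eps * (4 * d%:R ^+ 3) <= eta by rewrite -ler_pdivlMr.
have htr : eta * fnorm G - eps * fnorm G - d%:R * (eps * fnorm G) <= `|\tr G|.
  have -> : \tr G = u + \tr E.
    rewrite {1}GE mxtraceD mxtrace_mulC; congr (_ + _).
    by rewrite /mxtrace big_ord1.
  have h1 := fnorm_tr_le E.
  have h2 : d%:R * fnorm E <= d%:R * (eps * fnorm G) by rewrite ler_wpM2l.
  have h3 : `|u| - `|\tr E| <= `|u + \tr E|.
    exact: lerB_normD.
  lra.
have h1 := le_trans htr (tr_le_rho G).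
have r1 : eta / (2 * d%:R) * fnorm G <= rho 1 G.
  rewrite -[leLHS]mulrAC ler_pdivrMr ?mulr_gt0//.
  have h2 : (1 + d%:R) * (eps * fnorm G) <= eta / 2 * fnorm G.
    rewrite mulrA ler_wpM2r ?(ltW nG)//.
    have : eps * (4 * d%:R) <= eps * d%:R ^+ 3 by rewrite ler_wpM2l// ltW.
    have : eps * 2 <= eps * d%:R by rewrite ler_wpM2l// ltW.
    lra.
  lra.
split => //.
have cEle : cnorm (toC E) <= d%:R ^+ 2 * (eps * fnorm G).
  apply: le_trans (cnorm_toC _) _; rewrite natrM -expr2.
  by rewrite ler_wpM2l// exprn_ge0.
have czle : cnorm (toC z) <= d%:R.
  by apply: le_trans (cnorm_toC _) _; rewrite nz mulr1 muln1.
have cyle : cnorm (toC y) <= d%:R * fnorm G.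
  by apply: le_trans (cnorm_toC _) _; rewrite mul1n ler_wpM2l.
have q0 : 0 < eta / (4 * d%:R) * fnorm G by rewrite mulr_gt0// divr_gt0//; lra.
(* The bound on [eps] is made for this: the error takes at most half of the lower bound for
   [rho 1 G]. *)
have gap : eta / (4 * d%:R) * fnorm G <= rho 1 G - cnorm (toC E).
  have h2 : d%:R ^+ 2 * (eps * fnorm G) <= eta / (4 * d%:R) * fnorm G.
    rewrite mulrA ler_wpM2r ?(ltW nG)// ler_pdivlMr; last by lra.
    by move: epsle'; rewrite exprSr; lra.
  have e2 : eta / (2 * d%:R) * fnorm G = 2 * (eta / (4 * d%:R) * fnorm G).
    by field; rewrite gt_eqF//; lra.
  move: h2 r1 cEle; rewrite e2; set t := eta / _ * _; lra.
have lt : cnorm (toC E) < rho 1 G by rewrite -subr_gt0; exact: lt_le_trans gap.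
apply: le_trans (rank_one_rho2 GE lt) _.
(* The bracket is at most [4 * d%:R ^+ 3 / eta + 1], hence at most [5 * d%:R ^+ 3 / eta]. Replacing
   [fnorm G] by [2 * d%:R / eta * rho 1 G] produces the constant 10 and the sixth power. *)
apply: (@le_trans _ _ (d%:R ^+ 2 * (eps * fnorm G) * (5 * d%:R ^+ 3 / eta))).
  apply: ler_pM => //; first exact: cnorm_ge0.
    rewrite addr_ge0// divr_ge0 ?mulr_ge0 ?cnorm_ge0// ltW// subr_gt0//.
  apply: (@le_trans _ _ (4 * d%:R ^+ 3 / eta + 1)).
    rewrite lerD2r ler_pdivrMr ?subr_gt0//.
    apply: (@le_trans _ _ (d%:R * fnorm G * d%:R)).
      by apply: ler_pM => //; exact: cnorm_ge0.
    apply: (@le_trans _ _ (4 * d%:R ^+ 3 / eta * (eta / (4 * d%:R) * fnorm G))).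
      rewrite le_eqVlt; apply/orP; left; apply/eqP; field.
      by rewrite !gt_eqF//; lra.
    by rewrite ler_wpM2l// divr_ge0//; lra.
  have : 1 <= d%:R ^+ 3 / eta by rewrite ler_pdivlMr//; lra.
  lra.
have -> : d%:R ^+ 2 * (eps * fnorm G) * (5 * d%:R ^+ 3 / eta) =
    10 * d%:R ^+ 6 / eta ^+ 2 * eps * (eta / (2 * d%:R) * fnorm G).
  by field; rewrite !gt_eqF//; lra.
by rewrite ler_wpM2l// mulr_ge0 ?(ltW eps0)// divr_ge0 ?exprn_ge0 ?mulr_ge0 ?exprn_ge0// ltW.
Qed.

(** [lam *: x = G *m x] differs from a multiple of [z] by the image of [x] under the small error
    [E]; dividing by [lam], which is comparable to [fnorm G], bounds the angle. *)
Lemma top_eigvec_close eta eps G (x : 'cV[R]_n.+2) (lam : R) i0 :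
  0 < eta -> colclose eps G G -> col i0 G != 0 -> x != 0 -> G *m x = lam *: x ->
  eta * fnorm G <= `|lam| -> pdist x (col i0 G) <= eps / eta.
Proof.
move=> eta0 cG g0 x0 Gx lamle.
have [y [Ey ny]] := rank_one_approx cG g0.
have n0 : 0 < fnorm (col i0 G) by rewrite fnorm_gt0.
have nG : 0 < fnorm G by exact: lt_le_trans n0 (fnorm_col_le _ _).
have nx : 0 < fnorm x by rewrite fnorm_gt0.
set z := _ *: _ in Ey; have nz : fnorm z = 1.
  by rewrite fnormZ normfV ger0_norm ?fnorm_ge0// mulVf// gt_eqF.
have z0 : z != 0 by rewrite -fnorm_gt0 nz.
have lam0 : 0 < `|lam| by apply: lt_le_trans lamle; rewrite mulr_gt0.
set E := G - _ in Ey.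
have GE : G = z *m y + E by rewrite /E addrC subrK.
rewrite -(@pdistZr _ _ x (col i0 G) (fnorm (col i0 G))^-1) ?invr_eq0 ?gt_eqF//.
rewrite -/z pdistC pdistE nz mul1r ler_pdivrMr//.
have h1 : `|lam| * wedge_norm z x <= eps * fnorm G * fnorm x.
  rewrite -wedge_normZr -Gx.
  apply: le_trans (wedge_norm_le_shift z (G *m x) ((y *m x) 0 0)) _.
  rewrite -mulmx_col11 mulmxA -mulmxBl nz mul1r.
  by apply: le_trans (fnormM _ _) _; rewrite ler_wpM2r ?fnorm_ge0.
have h2 := ler_wpM2r (wedge_norm_ge0 z x) lamle.
rewrite mulrAC ler_pdivlMr// -(ler_pM2r nG); lra.
Qed.

End Gap.

(** * Spectrum of an aligned product of three blocks *)

Section Conclusion.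
Context {R : realType} {n : nat}.
Local Notation d := n.+2.

(** The factor of [spectral_gap] at [eta = delta ^+ 4 / 16], the goodness that [junction]
    delivers. *)
Definition gap_const (delta : R) : R :=
  10 * d%:R ^+ 6 / (delta ^+ 4 / 16) ^+ 2.

(** Inside the bracket: from the eigenline of [X H A] to its columns, then to those of [X H]. The
    factor [2 / delta] is the expansion of [A] there, and the final 1 leads from the columns of the
    product to the limit line. *)
Definition eig_const (delta : R) : R :=
  2 / delta * (2 * d%:R / (delta ^+ 4 / 16) + 1) + 1.

Lemma aligned_spectrum (delta kappa eps : R) (A X Y0 Yj Z H : 'M[R]_d)
    (l : 'cV[R]_d) :
  0 < delta <= 1 -> kappa <= delta ^+ 4 / 32 ->
  eps <= delta ^+ 4 / 16 / (4 * d%:R ^+ 3) ->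
  Y0 != 0 -> H != 0 -> A != 0 -> X *m H != 0 -> X *m (H *m A) != 0 ->
  l != 0 -> X = Yj *m Z ->
  colgood delta (Y0 *m Z) H -> colclose kappa H (H *m A) ->
  colgood delta Y0 Z -> colgood delta Yj Z ->
  colgood delta (H *m A) X -> colgood delta A X ->
  colclose kappa Z Z -> colclose kappa X X ->
  colclose kappa (H *m A) (H *m A) ->
  colclose eps (X *m H) (X *m (H *m A)) ->
  colclose eps (X *m (H *m A)) (X *m (H *m A)) ->
  (forall j, col j (A *m (X *m H)) != 0 ->
     pdist (col j (A *m (X *m H))) l < eps) ->
  [/\ 0 < rho 1 (A *m (X *m H)),
      rho 2 (A *m (X *m H)) <= gap_const delta * eps * rho 1 (A *m (X *m H)) &
      forall v, top_eigvec (A *m (X *m H)) v -> pdist v l <= eig_const delta * eps].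
Proof.
move=> d01 kd epsle Y00 H0 A0 XH0 G0 l0 XE gH cHP gY0 gYj gP gA cZ cX cP cXG cG cl.
have [gG gAXH] := junction d01 kd Y00 H0 XE gH cHP gY0 gYj gP gA cZ cX cP.
have /andP[d0 d1] := d01.
set G := X *m (H *m A) in G0 cXG cG gG *.
set eta := delta ^+ 4 / 16 in epsle gG.
have p4 : 0 < delta ^+ 4 by rewrite exprn_gt0.
have eta0 : 0 < eta by rewrite divr_gt0.
have eta01 : 0 < eta <= 1.
  have : delta ^+ 4 <= 1 by rewrite exprn_ile1// ltW.
  by rewrite eta0/= /eta; lra.
have [r1 r2] := spectral_gap eta01 epsle G0 gG cG.
have rE k : rho k (A *m (X *m H)) = rho k G by rewrite rho_mulC -mulmxA.
rewrite !rE.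
have nG : 0 < fnorm G by rewrite fnorm_gt0.
have eta2 : 0 < eta / (2 * d%:R) by rewrite divr_gt0// mulr_gt0.
have rho0 : 0 < rho 1 G by apply: lt_le_trans r1; rewrite mulr_gt0.
split => // v [v0 [lam [gv lamE]]].
have nlam : 0 < `|lam| by rewrite lamE rE.
have lam0 : lam != 0 by rewrite -normr_gt0.
(* [X H] carries eigenvectors of [A X H] to eigenvectors of [X H A] with the same eigenvalue, and
   [A] carries [x] back to [lam *: v]. *)
pose x := X *m H *m v.
have Ax : A *m x = lam *: v by rewrite /x mulmxA gv.
have Ax0 : A *m x != 0 by rewrite Ax scaler_eq0 negb_or lam0.
have x0 : x != 0 by apply: contraNneq Ax0 => ->; rewrite mulmx0.
have Gx : G *m x = lam *: x.
  by rewrite /G mulmxA -mulmxA Ax -scalemxAr.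
have [i0 g0] := nz_col G0.
have [j s0] := nz_col XH0.
have h1 : pdist x (col i0 G) <= eps / (eta / (2 * d%:R)).
  by apply: (top_eigvec_close eta2 cG g0 x0 Gx); rewrite lamE rE.
have h2 := cXG j i0 s0 g0.
set s := col j (X *m H) in s0 h2 *.
have h3 : pdist x s <= eps * (2 * d%:R / eta + 1).
  apply: le_trans (pdist_triangle x0 g0 s0) _.
  rewrite mulrDr mulr1 [pdist _ s]pdistC; apply: lerD (ltW h2).
  by apply: le_trans h1 _; rewrite invf_div.
have As : delta / 2 * fnorm A * fnorm s <= fnorm (A *m s) := gAXH j.
have nA : 0 < fnorm A by rewrite fnorm_gt0.
have ns : 0 < fnorm s by rewrite fnorm_gt0.
have As0 : A *m s != 0.
  by rewrite -fnorm_gt0; apply: lt_le_trans As; rewrite !mulr_gt0// divr_gt0.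
have h4 : pdist (A *m x) (A *m s) <= 2 / delta * pdist x s.
  have := pdist_mulmx x0 s0 Ax0 As0.
  have h5 := ler_wpM2l (pdist_ge0 (A *m x) (A *m s)) As.
  move=> /(le_trans h5) h6.
  have ns' : 0 < delta / 2 * (fnorm A * fnorm s) by rewrite !mulr_gt0// divr_gt0.
  rewrite -(ler_pM2r ns').
  have -> : 2 / delta * pdist x s * (delta / 2 * (fnorm A * fnorm s)) =
      fnorm A * (fnorm s * pdist x s) by field; rewrite gt_eqF.
  by rewrite (mulrA (delta / 2)).
have gs : col j (A *m (X *m H)) = A *m s by rewrite col_mulmx.
have h7 : pdist (A *m s) l < eps by rewrite -gs; apply: cl; rewrite gs.
rewrite -(pdistZl v l lam0) -Ax.
apply: le_trans (pdist_triangle Ax0 As0 l0) _.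
rewrite /eig_const mulrDl mul1r; apply: lerD; last exact: ltW.
apply: le_trans h4 _; rewrite -[leRHS]mulrA; apply: ler_wpM2l.
  by rewrite divr_ge0// ltW.
by rewrite mulrC.
Qed.

End Conclusion.

(** * Measurability of matrix-valued maps *)
Section MeasurablePredicates.
Context {dT : measure_display} {T : measurableType dT} {R : realType}.
Implicit Types (A B : T -> Prop) (f g : T -> R).

Lemma mset_const (Q : Prop) : measurable [set _ : T | Q].
Proof.
have [q|q] := pselect Q.
  by rewrite (_ : mkset _ = setT)//; apply/seteqP; split.
by rewrite (_ : mkset _ = set0)//; apply/seteqP; split.
Qed.

Lemma mset_and A B : measurable [set x | A x] -> measurable [set x | B x] ->
  measurable [set x | A x /\ B x].
Proof. exact: measurableI. Qed.

Lemma mset_or A B : measurable [set x | A x] -> measurable [set x | B x] ->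
  measurable [set x | A x \/ B x].
Proof. exact: measurableU. Qed.

Lemma mset_not A : measurable [set x | A x] -> measurable [set x | ~ A x].
Proof. exact: measurableC. Qed.

Lemma mset_imply A B : measurable [set x | A x] -> measurable [set x | B x] ->
  measurable [set x | A x -> B x].
Proof.
move=> mA mB; rewrite (_ : mkset _ = [set x | ~ A x \/ B x]).
  by apply: mset_or => //; exact: mset_not.
apply/seteqP; split=> x /=; last by case.
by move=> AB; have [/AB|] := pselect (A x); [right|left].
Qed.

Lemma mset_imply_const (Q : Prop) A : (Q -> measurable [set x | A x]) ->
  measurable [set x | Q -> A x].
Proof.
move=> mA; have [q|q] := pselect Q; last first.
  by rewrite (_ : mkset _ = setT)//; apply/seteqP; split => // x _ /q.
rewrite (_ : mkset _ = [set x | A x]); first exact: mA.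
by apply/seteqP; split=> x /=; [exact|].
Qed.

Lemma mset_forall_countable (I : countType) (A : I -> T -> Prop) :
  (forall i, measurable [set x | A i x]) -> measurable [set x | forall i, A i x].
Proof.
move=> mA; rewrite (_ : mkset _ = \bigcap_(n in setT)
    [set x | forall i, unpickle n = Some i -> A i x]).
  apply: bigcapT_measurable => n; case: (unpickle n) => [i|].
    rewrite (_ : mkset _ = [set x | A i x])//.
    by apply/seteqP; split=> x /= ; [apply|move=> Ax j [<-]].
  by rewrite (_ : mkset _ = setT)//; apply/seteqP; split.
apply/seteqP; split=> x /= h.
  by move=> n _ i _; exact: h.
by move=> i; apply: (h (pickle i) Logic.I); rewrite pickleK.
Qed.

Lemma mset_exists_countable (I : countType) (A : I -> T -> Prop) :
  (forall i, measurable [set x | A i x]) -> measurable [set x | exists i, A i x].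
Proof.
move=> mA; rewrite (_ : mkset _ = [set x | ~ forall i, ~ A i x]).
  by apply: mset_not; apply: mset_forall_countable => i; exact: mset_not.
apply/seteqP; split=> x /=; first by move=> [i Ai] /(_ i).
by move=> h; apply: contrapT => k; apply: h => i Ai; apply: k; exists i.
Qed.

Lemma mset_le f g : measurable_fun setT f -> measurable_fun setT g ->
  measurable [set x | f x <= g x].
Proof.
move=> mf mg; have := measurable_fun_ler mf mg => /(_ measurableT [set true]).
by rewrite setTI; apply.
Qed.

Lemma mset_lt f g : measurable_fun setT f -> measurable_fun setT g ->
  measurable [set x | f x < g x].
Proof.
move=> mf mg; have := measurable_fun_ltr mf mg => /(_ measurableT [set true]).
by rewrite setTI; apply.
Qed.

Lemma mset_eq f g : measurable_fun setT f -> measurable_fun setT g ->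
  measurable [set x | f x = g x].
Proof.
move=> mf mg; rewrite (_ : mkset _ = [set x | f x <= g x /\ g x <= f x]).
  by apply: mset_and; exact: mset_le.
apply/seteqP; split=> x /=; first by move=> ->.
by move=> [fg gf]; apply/le_anti; rewrite fg gf.
Qed.

Lemma measurable_sqrt f : measurable_fun setT f ->
  measurable_fun setT (fun x => Num.sqrt (f x)).
Proof.
move=> mf; apply: measurableT_comp mf.
apply: continuous_measurable_fun; exact: sqrt_continuous.
Qed.

Lemma measurable_sum_fin (I : finType) (F : I -> T -> R) (D : pred I) :
  (forall i, measurable_fun setT (F i)) ->
  measurable_fun setT (fun x => \sum_(i | D i) F i x).
Proof.
move=> mF; have := @measurable_sum _ _ R setT _ (enum D) F.
by under eq_fun do rewrite big_enum/=; apply => i; exact: mF.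
Qed.

Lemma measurable_prod_fin (I : finType) (F : I -> T -> R) :
  (forall i, measurable_fun setT (F i)) ->
  measurable_fun setT (fun x => \prod_i F i x).
Proof.
move=> mF; have := @measurable_prod _ _ R setT _ (enum I) F.
by under eq_fun do rewrite big_enum/=; apply => i _; exact: mF.
Qed.

End MeasurablePredicates.

Section MeasurableMatrices.
Context {dT : measure_display} {T : measurableType dT} {R : realType}.

Definition mmx m n (X : T -> 'M[R]_(m, n)) : Prop :=
  forall i j, measurable_fun setT (fun w => X w i j).

Lemma mmx_cst m n (A : 'M[R]_(m, n)) : mmx (fun _ => A).
Proof. by move=> i j; exact: measurable_cst. Qed.

Lemma mmx_mul m n p (X : T -> 'M[R]_(m, n)) (Y : T -> 'M[R]_(n, p)) :
  mmx X -> mmx Y -> mmx (fun w => X w *m Y w).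
Proof.
move=> mX mY i j; under eq_fun do rewrite mxE.
by apply: measurable_sum_fin => k; exact: measurable_funM.
Qed.

Lemma mmx_sub m n (X Y : T -> 'M[R]_(m, n)) :
  mmx X -> mmx Y -> mmx (fun w => X w - Y w).
Proof.
move=> mX mY i j; under eq_fun do rewrite !mxE.
exact: measurable_funB.
Qed.

Lemma mmx_col m n (X : T -> 'M[R]_(m, n)) j : mmx X -> mmx (fun w => col j (X w)).
Proof. by move=> mX i k; under eq_fun do rewrite mxE; exact: mX. Qed.

Lemma mmx_mxsub m n p q (f : 'I_p -> 'I_m) (h : 'I_q -> 'I_n)
  (X : T -> 'M[R]_(m, n)) : mmx X -> mmx (fun w => mxsub f h (X w)).
Proof. by move=> mX i k; under eq_fun do rewrite mxE; exact: mX. Qed.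

Lemma mmx_prod n r (X : nat -> T -> 'M[R]_n) : (forall k, mmx (X k)) ->
  mmx (fun w => \prod_(k < r) X k w).
Proof.
move=> mX; elim: r => [|r IH].
  by under eq_fun do rewrite big_ord0; exact: mmx_cst.
by under eq_fun do rewrite big_ord_recr; exact: mmx_mul.
Qed.

Lemma mmx_fnorm m n (X : T -> 'M[R]_(m, n)) : mmx X ->
  measurable_fun setT (fun w => fnorm (X w)).
Proof.
move=> mX; apply: measurable_sqrt; apply: measurable_sum_fin => p.
by apply: measurable_funX; exact: mX.
Qed.

Lemma mmx_det n (X : T -> 'M[R]_n) : mmx X ->
  measurable_fun setT (fun w => \det (X w)).
Proof.
move=> mX; apply: measurable_sum_fin => s; apply: measurable_funM => //.
by apply: measurable_prod_fin => i; exact: mX.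
Qed.

Lemma mset_mx_eq0 m n (X : T -> 'M[R]_(m, n)) : mmx X ->
  measurable [set w | X w = 0].
Proof.
move=> mX; rewrite (_ : mkset _ = [set w | fnorm (X w) = 0]).
  by apply: mset_eq => //; exact: mmx_fnorm.
by apply/seteqP; split=> w /= => [->|/eqP]; rewrite ?fnorm0// fnorm_eq0 => /eqP.
Qed.

Lemma mset_mx_neq0 m n (X : T -> 'M[R]_(m, n)) : mmx X ->
  measurable [set w | X w != 0].
Proof.
move=> mX; rewrite (_ : mkset _ = [set w | ~ X w = 0]).
  exact/mset_not/mset_mx_eq0.
by apply/seteqP; split=> w /= /eqP.
Qed.

Lemma mmx_wedge n (x y : T -> 'cV[R]_n) : mmx x -> mmx y ->
  measurable_fun setT (fun w => wedge_norm (x w) (y w)).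
Proof.
move=> mx my; apply: measurable_sqrt; apply: measurable_sum_fin => i.
apply: measurable_sum_fin => j; apply: measurable_funX.
by apply: measurable_funB; apply: measurable_funM; first [exact: mx|exact: my].
Qed.

(** Clearing the denominator leaves the degenerate case [ab w = 0], where [pdist] is 0 by the
    convention on division. *)
Lemma mset_pdist_ge n (x y : T -> 'cV[R]_n) (e : R) : mmx x -> mmx y ->
  measurable [set w | e <= pdist (x w) (y w)].
Proof.
move=> mx my; pose ab w := fnorm (x w) * fnorm (y w).
have mab : measurable_fun setT ab by apply: measurable_funM; exact: mmx_fnorm.
rewrite (_ : mkset _ = [set w | (0 < ab w /\ e * ab w <= wedge_norm (x w) (y w))
    \/ (ab w = 0 /\ e <= 0)]).
  apply: mset_or; apply: mset_and; rewrite ?mset_const//.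
  - exact: mset_lt.
  - by apply: mset_le; [exact: measurable_funM|exact: mmx_wedge].
  - exact: mset_eq.
  - exact: mset_const.
have ab0 w : 0 <= ab w by rewrite mulr_ge0 ?fnorm_ge0.
apply/seteqP; split=> w /=; rewrite pdistE -/(ab w).
  have := ab0 w; rewrite le_eqVlt => /predU1P[<-|abp].
    by rewrite invr0 mulr0; right.
  by rewrite ler_pdivlMr//; left.
move=> [[abp]|[-> e0]]; first by rewrite ler_pdivlMr.
by rewrite invr0 mulr0.
Qed.

Lemma mset_pdist_lt n (x y : T -> 'cV[R]_n) (e : R) : mmx x -> mmx y ->
  measurable [set w | pdist (x w) (y w) < e].
Proof.
move=> mx my; rewrite (_ : mkset _ = [set w | ~ e <= pdist (x w) (y w)]).
  exact/mset_not/mset_pdist_ge.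
by apply/seteqP; split=> w /=; rewrite ltNge => /negP.
Qed.

Lemma mset_colclose n (k : R) (X Y : T -> 'M[R]_n) : mmx X -> mmx Y ->
  measurable [set w | colclose k (X w) (Y w)].
Proof.
move=> mX mY; apply: mset_forall_countable => i.
apply: mset_forall_countable => j.
apply: mset_imply; first exact/mset_mx_neq0/mmx_col.
apply: mset_imply; first exact/mset_mx_neq0/mmx_col.
by apply: mset_pdist_lt; exact: mmx_col.
Qed.

Lemma mset_colgood n (k : R) (X Y : T -> 'M[R]_n) : mmx X -> mmx Y ->
  measurable [set w | colgood k (X w) (Y w)].
Proof.
move=> mX mY; apply: mset_forall_countable => j; apply: mset_le.
  apply: measurable_funM; last exact/mmx_fnorm/mmx_col.
  by apply: measurable_funM => //; exact: mmx_fnorm.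
by apply: mmx_fnorm; apply: mmx_mul => //; exact: mmx_col.
Qed.

End MeasurableMatrices.

(** * Real-valued probabilities and union bounds *)

Section RealProbability.
Context {dT : measure_display} {T : measurableType dT} {R : realType}.
Variable P : probability T R.
Implicit Types A B C : set T.

Definition pr A : R := fine (P A).

Lemma prE A : measurable A -> P A = (pr A)%:E.
Proof. by move=> mA; rewrite fineK// fin_num_measure. Qed.

Lemma pr_ge0 A : 0 <= pr A.
Proof. exact/fine_ge0/measure_ge0. Qed.

Lemma pr_le1 A : measurable A -> pr A <= 1.
Proof. by move=> mA; rewrite -lee_fin -prE// probability_le1. Qed.

Lemma prT : pr setT = 1.
Proof. by rewrite /pr probability_setT. Qed.

Lemma pr_le A B : measurable A -> measurable B -> A `<=` B -> pr A <= pr B.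
Proof. by move=> mA mB AB; rewrite -lee_fin -!prE// le_measure ?inE. Qed.

Lemma prU A B C : measurable A -> measurable B -> measurable C ->
  A `<=` B `|` C -> pr A <= pr B + pr C.
Proof.
move=> mA mB mC ABC; apply: (@le_trans _ _ (pr (B `|` C))).
  by apply: pr_le => //; exact: measurableU.
rewrite -lee_fin EFinD -!prE//; last exact: measurableU.
exact: measureU2.
Qed.

Lemma pr_bigU (I : finType) (F : I -> set T) A (q : I -> R) : measurable A ->
  (forall i, measurable (F i)) -> (forall i, pr (F i) <= q i) ->
  (forall x, A x -> exists i, F i x) -> pr A <= \sum_i q i.
Proof.
move=> mA mF Fq AF; apply: (@le_trans _ _ (\sum_i pr (F i))); last exact: ler_sum.
have mU s : measurable (\big[setU/set0]_(i <- s) F i) by exact: bigsetU_measurable.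
apply: (@le_trans _ _ (pr (\big[setU/set0]_i F i))).
  by apply: pr_le => // x /AF[i Fi]; rewrite (bigD1 i)//=; left.
elim: (index_enum I) => [|i s IH]; first by rewrite !big_nil /pr measure0.
rewrite !big_cons; apply: (@le_trans _ _ (pr (F i) + pr (\big[setU/set0]_(j <- s) F j))).
  by apply: prU => //; exact: measurableU.
by rewrite lerD2l.
Qed.

Lemma prC A : measurable A -> pr (~` A) = 1 - pr A.
Proof.
move=> mA; have := probability_setC P mA.
by rewrite !prE//; [rewrite -EFinB => -[]|exact: measurableC].
Qed.

End RealProbability.

(** * Laws of i.i.d. sequences of matrices *)
Section SequenceSpace.
Context {R : realType} {d : nat}.
Local Notation mat := ('M[R]_d).

(** Rectangles that constrain finitely many coordinates: the sets whose probability the i.i.d.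
    hypothesis prescribes. *)
Definition cylinder : set (set (nat -> mat)) :=
  [set S | exists (N : nat) (A : nat -> set mat),
     [/\ forall k, mxBorel (A k), forall k, (N <= k)%N -> A k = setT &
         S = [set x | forall k, A k (x k)]]].

Definition mseq := g_sigma_algebraType cylinder.

Lemma mxBorelT : mxBorel (@setT mat).
Proof. exact: (@measurableT _ (g_sigma_algebraType _)). Qed.

Lemma mxBorelI (A B : set mat) : mxBorel A -> mxBorel B -> mxBorel (A `&` B).
Proof. exact: (@measurableI _ (g_sigma_algebraType _)). Qed.

Lemma mxBorel_coord (i j : 'I_d) (B : set R) : measurable B ->
  mxBorel [set M : mat | B (M i j)].
Proof. by move=> mB; apply: sub_sigma_algebra; exists i, j, B. Qed.

Lemma cylinder_setI : setI_closed cylinder.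
Proof.
move=> _ _ [N [A [mA NA ->]]] [M [B [mB MB ->]]].
exists (maxn N M), (fun k => A k `&` B k); split.
- by move=> k; exact: mxBorelI.
- by move=> k; rewrite geq_max => /andP[Nk Mk]; rewrite NA// MB// setIT.
- rewrite predeqE => x; split=> [[h1 h2] k|h]; first by split.
  by split=> k; case: (h k).
Qed.

Lemma cylinderT : cylinder setT.
Proof.
exists 0, (fun=> setT); split=> // => [k|]; first exact: mxBorelT.
by apply/seteqP; split.
Qed.

Lemma mmx_preimage (dT : measure_display) (T : measurableType dT)
  (X : T -> mat) (A : set mat) : mmx X -> mxBorel A -> measurable [set w | A (X w)].
Proof.
move=> mX; pose D := [set B : set mat | measurable [set w | B (X w)]].
suff : mxBorel `<=` D by apply.
apply: smallest_sub.
  split.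
  - by rewrite /D /= (_ : mkset _ = set0)//; apply/seteqP; split.
  - move=> B mB; rewrite /D/= (_ : mkset _ = ~` [set w | B (X w)]).
      exact: measurableC.
    by apply/seteqP; split=> w /=; [case|split].
  - move=> F mF; rewrite /D/= (_ : mkset _ = \bigcup_i [set w | F i (X w)])//.
    exact: bigcupT_measurable.
move=> _ [i [j [B [mB ->]]]]; rewrite /D/=.
by have := mX i j measurableT B mB; rewrite setTI.
Qed.

Lemma measurable_to_mseq (dT : measure_display) (T : measurableType dT)
  (f : T -> mseq) : (forall k, mmx (fun w => f w k)) -> measurable_fun setT f.
Proof.
move=> mf; apply: (@measurability _ _ T mseq setT f cylinder) => //.
move=> _ [_ [N [A [mA NA ->]]] <-]; rewrite setTI.
apply: mset_forall_countable => k; exact: mmx_preimage.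
Qed.

Lemma mmx_coord k : mmx (fun x : mseq => x k).
Proof.
move=> i j _ B mB; rewrite setTI; apply: sub_sigma_algebra.
exists k.+1, (fun l => if l == k then [set M : mat | B (M i j)] else setT); split.
- by move=> l; case: ifP => _; [exact: mxBorel_coord|exact: mxBorelT].
- by move=> l kl; rewrite gtn_eqF.
- apply/seteqP; split=> x /= => [h l|/(_ k)]; last by rewrite eqxx.
  by case: eqP => [->|].
Qed.

Definition relabel (s : nat -> nat) (x : mseq) : mseq := fun k => x (s k).

Definition concat (t : nat) (x y : mseq) : mseq :=
  fun k => if (k < t)%N then x k else y (k - t)%N.

Lemma measurable_relabel s : measurable_fun setT (relabel s).
Proof. by apply: measurable_to_mseq => k; exact: mmx_coord. Qed.

Lemma measurable_concat t :
  measurable_fun setT (fun p : mseq * mseq => concat t p.1 p.2).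
Proof.
apply: measurable_to_mseq => k i j; rewrite /concat.
case: (k < t)%N.
  by apply: (measurableT_comp (mmx_coord k i j)); exact: measurable_fst.
by apply: (measurableT_comp (mmx_coord (k - t) i j)); exact: measurable_snd.
Qed.

(** The two forms of independence used below. Injective relabellings include rotations of a finite
    stretch of letters; the second clause lets the letters from time [t] on be redrawn independently
    of the first [t]. *)
Definition iid_law (mu : probability mseq R) : Prop :=
  (forall s, injective s -> forall A, measurable A ->
     mu (relabel s @^-1` A) = mu A) /\
  (forall t A, measurable A ->
     (mu \x mu)%E ((fun p => concat t p.1 p.2) @^-1` A) = mu A).

Section Law.
Context {dT : measure_display} {T : measurableType dT}.
Variables (P : probability T R) (gam : nat -> T -> mat).
Hypothesis Hmeas : forall n, mmx (gam n).
Hypothesis Hiid : iid_seq P gam.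

Definition trajectory (w : T) : mseq := fun n => gam n w.

Lemma measurable_trajectory : measurable_fun setT trajectory.
Proof. exact: measurable_to_mseq. Qed.

Definition seq_law : probability mseq R :=
  distribution P (mfun_Sub (mem_set measurable_trajectory)).

Lemma seq_lawE A : seq_law A = P (trajectory @^-1` A).
Proof. by []. Qed.

Let nu (A : set mat) := pr P [set w | A (gam 0%N w)].

Lemma nuT : nu setT = 1.
Proof. by rewrite /nu (_ : mkset _ = setT) ?prT//; apply/seteqP; split. Qed.

Lemma seq_law_cylinder N (A : nat -> set mat) :
  (forall k, mxBorel (A k)) -> (forall k, (N <= k)%N -> A k = setT) ->
  seq_law [set x | forall k, A k (x k)] = (\prod_(k < N) nu (A k))%:E.
Proof.
move=> mA NA; rewrite seq_lawE.
rewrite (_ : _ @^-1` _ = [set w | forall k : 'I_N, A k (gam k w)]).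
  rewrite (Hiid (fun k : 'I_N => mA k)) -prodEFin; apply: eq_bigr => k _.
  by rewrite /nu -prE//; exact: mmx_preimage.
apply/seteqP; split=> w /= h k; first exact: h.
have [kN|Nk] := ltnP k N; first exact: (h (Ordinal kN)).
by rewrite NA.
Qed.

(** Cylinders are stable under intersection and contain the whole space, so finite measures that
    agree on them coincide. *)
Lemma probability_mseq_unique (m1 m2 : {measure set mseq -> \bar R}) :
  (forall A, cylinder A -> m1 A = m2 A) -> m1 setT = 1%E ->
  forall A, measurable A -> m1 A = m2 A.
Proof.
move=> m12 m1T A mA; apply: (@measure_unique _ R mseq cylinder (fun=> setT)) => //.
- exact: cylinder_setI.
- by move=> _; exact: cylinderT.
- by apply/seteqP; split=> // x _; exists 0%N.
- by move=> _; rewrite /= m1T ltry.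
Qed.

Lemma iid_seq_law : iid_law seq_law.
Proof.
split=> [s sI|t] A mA.
  have ms := measurable_relabel s.
  pose m1 : probability mseq R := distribution seq_law (mfun_Sub (mem_set ms)).
  apply/esym; apply: (@probability_mseq_unique seq_law m1) => //; last exact: probability_setT.
  move=> _ [N [B [mB NB ->]]]; apply: etrans (seq_law_cylinder mB NB) _.
  pose N' := (\max_(k < N) s k).+1.
  have sN k : (k < N)%N -> (s k < N')%N.
    by move=> kN; rewrite ltnS (leq_bigmax (Ordinal kN)).
  clearbody N'.
  (* The pulled-back cylinder constrains coordinate [s k] by [B k]. By injectivity each [m] receives
     at most one constraint, so [B' m] is some [B k] or the whole space. *)
  pose B' m := [set M | forall k, (k < N)%N -> s k = m -> B k M].
  have B'T m : m \notin map s (iota 0 N) -> B' m = setT.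
    move=> ms'; apply/seteqP; split=> // M _ k kN skm.
    by case/negP: ms'; rewrite -skm map_f// mem_iota.
  have B's k : (k < N)%N -> B' (s k) = B k.
    move=> kN; apply/seteqP; split=> M /=; first exact.
    by move=> BM l _ /sI ->.
  have mB' m : mxBorel (B' m).
    have [/mapP[k]|/B'T ->] := boolP (m \in map s (iota 0 N)); last exact: mxBorelT.
    by rewrite mem_iota add0n => /= kN ->; rewrite B's.
  have e1 : m1 [set x : mseq | forall k, B k (x k)] =
      seq_law [set x : mseq | forall k, B' k (x k)].
    rewrite /m1 /distribution /= /pushforward; congr (seq_law _).
    apply/seteqP; split=> x /= h.
      by move=> m k kN <-; exact: h.
    move=> k; have [kN|Nk] := ltnP k N; first by apply: (h (s k) k).
    by rewrite NB.
  apply: (etrans _ (esym e1)); apply: (etrans _ (esym (@seq_law_cylinder N' B' mB' _))); last first.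
    move=> m N'm; apply: B'T; apply/mapP => -[k]; rewrite mem_iota => /= kN mE.
    by move: N'm; rewrite mE leqNgt sN.
  congr (_%:E); rewrite -(big_mkord xpredT (fun k => nu (B k))).
  rewrite -(big_mkord xpredT (fun k => nu (B' k))).
  rewrite [RHS](bigID (fun m => m \in map s (iota 0 N)))/= [X in _ * X]big1; last first.
    by move=> m /B'T ->; exact: nuT.
  rewrite mulr1 -[RHS]big_filter.
  have pE : perm_eq [seq m <- index_iota 0 N' | m \in map s (iota 0 N)] (map s (index_iota 0 N)).
    rewrite uniq_perm ?filter_uniq ?iota_uniq ?(map_inj_uniq sI) ?iota_uniq//.
    move=> m; rewrite mem_filter /index_iota !subn0 andb_idr//.
    case/mapP => k; rewrite mem_iota add0n => /= kN ->.
    by rewrite mem_iota add0n; exact: sN.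
  rewrite (perm_big _ pE) big_map big_seq [RHS]big_seq; apply: eq_bigr => k.
  by rewrite mem_index_iota => /= kN; rewrite B's.
have mc := measurable_concat t.
pose m1 : {measure set mseq -> \bar R} :=
  measure_function_pushforward__canonical__measure_function_Measure
    (seq_law \x seq_law)%E mc.
have e1 (N : nat) (B : nat -> set mat) : (forall k, mxBorel (B k)) ->
    (forall k, (N <= k)%N -> B k = setT) ->
    m1 [set x : mseq | forall k, B k (x k)] = seq_law [set x : mseq | forall k, B k (x k)].
  move=> mB NB.
  (* Under [concat] a cylinder becomes a rectangle: the constraints before [t] bear on the first
     factor, the later ones, shifted by [t], on the second. *)
  pose B1 k := if (k < t)%N then B k else setT.
  pose B2 k := B (t + k)%N.
  have mB1 k : mxBorel (B1 k) by rewrite /B1; case: ifP => // _; exact: mxBorelT.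
  have tB1 k : (t <= k)%N -> B1 k = setT by rewrite /B1 ltnNge => ->.
  have mB2 k : mxBorel (B2 k) by exact: mB.
  have NB2 k : (N <= k)%N -> B2 k = setT.
    by move=> Nk; apply: NB; rewrite (leq_trans Nk)// leq_addl.
  have NB' k : (t + N <= k)%N -> B k = setT.
    by move=> tNk; apply: NB; rewrite (leq_trans _ tNk)// leq_addl.
  rewrite /m1/= /pushforward.
  rewrite (_ : _ @^-1` _ = [set x : mseq | forall k, B1 k (x k)] `*`
     [set y : mseq | forall k, B2 k (y k)]); last first.
    rewrite predeqE => -[x y]; split=> [/= h|/= [h1 h2] k].
      split=> k; first by rewrite /B1; have := h k; rewrite /concat; case: ifP.
      by have := h (t + k)%N; rewrite /concat ltnNge leq_addr/= addKn.
    rewrite /concat; case: ifP => kt; first by have := h1 k; rewrite /B1 kt.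
    have := h2 (k - t)%N; rewrite /B2 subnKC//.
    by rewrite leqNgt kt.
  have mcyl M (C : nat -> set mat) : (forall k, mxBorel (C k)) ->
     (forall k, (M <= k)%N -> C k = setT) ->
     measurable [set x : mseq | forall k, C k (x k)].
    by move=> mC MC; apply: sub_sigma_algebra; exists M, C.
  rewrite product_measure1E; [|exact: (mcyl t)|exact: (mcyl N)].
  have h1 := seq_law_cylinder mB1 tB1.
  have h2 := seq_law_cylinder mB2 NB2.
  have h3 := seq_law_cylinder mB NB'.
  apply: (etrans _ (esym h3)); apply: (etrans (f_equal2 _ h1 h2)).
  rewrite -EFinM big_split_ord/=; congr ((_ * _)%:E).
  by apply: eq_bigr => k _; rewrite /B1 ltn_ord.
have m1A : m1 A = seq_law A.
  apply: (@probability_mseq_unique m1 seq_law) => //.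
    by move=> _ [N [B [mB NB ->]]]; exact: (e1 N).
  have := e1 0%N (fun=> setT) (fun=> mxBorelT) (fun _ _ => erefl).
  rewrite (_ : mkset _ = setT); last by rewrite predeqE.
  by move=> ->; exact: probability_setT.
by rewrite -m1A.
Qed.

End Law.

End SequenceSpace.

(** * Words and restarts at a fixed time *)

Section Words.
Context {R : realType} {d : nat}.
Local Notation mseq := (@mseq R d).
Implicit Types x y : nat -> 'M[R]_d.

Definition word x a r : 'M[R]_d := \prod_(k < r) x (a + k)%N.

Lemma word0 x a : word x a 0 = 1%:M.
Proof. by rewrite /word big_ord0. Qed.

Lemma word_cat x a r s : word x a (r + s) = word x a r *m word x (a + r) s.
Proof.
rewrite /word big_split_ord/=; congr (_ *m _).
by apply: eq_bigr => k _; rewrite addnA.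
Qed.

Lemma eq_word x y a b r : (forall k, (k < r)%N -> x (a + k)%N = y (b + k)%N) ->
  word x a r = word y b r.
Proof. by move=> xy; apply: eq_bigr => k _; exact: xy. Qed.

Lemma mmx_word a r : mmx (fun x : mseq => word x a r).
Proof.
apply: (@mmx_prod _ mseq _ _ _ (fun k (x : mseq) => x (a + k)%N)) => k.
exact: mmx_coord.
Qed.

Lemma word_concat_prefix t x y a r : (a + r <= t)%N ->
  word (concat t x y) a r = word x a r.
Proof.
move=> art; apply: eq_word => k kr; rewrite /concat ifT//.
by rewrite (leq_trans _ art)// ltn_add2l.
Qed.

Lemma word_concat_suffix t x y a r :
  word (concat t x y) (t + a) r = word y a r.
Proof.
apply: eq_word => k kr; rewrite /concat ifF; last first.
  by apply/negbTE; rewrite -leqNgt -addnA leq_addr.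
by rewrite -addnA addKn.
Qed.

End Words.

Section IidLaw.
Context {R : realType} {d : nat}.
Local Notation mseq := (@mseq R d).
Variable mu : probability mseq R.
Hypothesis Hmu : iid_law mu.

Lemma pr_relabel s (A : set mseq) : injective s -> measurable A ->
  pr mu [set x | A (relabel s x)] = pr mu A.
Proof. by move=> sI mA; rewrite /pr -(Hmu.1 s sI A mA). Qed.

Lemma measurable_concat_set t (E : set mseq) : measurable E ->
  measurable [set p : mseq * mseq | E (concat t p.1 p.2)].
Proof.
by move=> mE; have := measurable_concat t measurableT mE; rewrite setTI.
Qed.

Lemma xsection_concat t (E : set mseq) x :
  xsection [set p : mseq * mseq | E (concat t p.1 p.2)] x =
  [set y | E (concat t x y)].
Proof. by rewrite predeqE => y; split; rewrite /xsection/= inE. Qed.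

Lemma measurable_concat_section t (E : set mseq) x : measurable E ->
  measurable [set y | E (concat t x y)].
Proof.
move=> mE; rewrite -xsection_concat; apply: measurable_xsection.
exact: measurable_concat_set.
Qed.

Lemma law_concat t (E : set mseq) : measurable E ->
  mu E = (\int[mu]_x mu [set y | E (concat t x y)])%E.
Proof.
move=> mE; rewrite -(Hmu.2 t E mE) /product_measure1.
by apply: eq_integral => x _ /=; rewrite -xsection_concat.
Qed.

Lemma measurable_fun_section t (E : set mseq) : measurable E ->
  measurable_fun setT (fun x => mu [set y | E (concat t x y)]).
Proof.
move=> mE; have := measurable_fun_xsection mu (measurable_concat_set t mE).
by apply: eq_measurable_fun => x _ /=; rewrite -xsection_concat.
Qed.

(** The Markov property as an inequality: given the first [t] letters, the conditional probability
    of [E] is at most [q], and it vanishes outside [A]. *)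
Lemma pr_concat_le t (A E : set mseq) (q : R) : measurable A -> measurable E ->
  (forall x y, E (concat t x y) -> A x) ->
  (forall x, A x -> pr mu [set y | E (concat t x y)] <= q) -> 0 <= q ->
  pr mu E <= q * pr mu A.
Proof.
move=> mA mE EA Eq q0; rewrite -lee_fin EFinM -!prE// (law_concat t mE).
rewrite -[in leRHS](setIT A) -integral_indic// -ge0_integralZl//.
- apply: ge0_le_integral => //.
  + exact: measurable_fun_section.
  + apply: emeasurable_funM => //.
    by apply: measurableT_comp => //; exact: measurable_indic.
  move=> x _; rewrite indicE; have [xA|xA] := boolP (x \in A).
    rewrite mule1 prE ?lee_fin; last exact: measurable_concat_section.
    by apply: Eq; rewrite inE in xA.
  rewrite (_ : mkset _ = set0) ?measure0 ?mule0//.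
  rewrite predeqE => y; split=> // /EA Ax.
  by move: xA; rewrite notin_setE.
- by apply: measurableT_comp => //; exact: measurable_indic.
Qed.

(** A finite family is allowed because the event that is likely after [t] depends on the letters
    read before. *)
Lemma pr_concat_ge t (I : finType) (A : set mseq) (E : I -> set mseq) (q : R) :
  measurable A -> (forall i, measurable (E i)) -> 0 <= q ->
  (forall x, A x -> q <= \sum_i pr mu [set y | E i (concat t x y)]) ->
  q * pr mu A <= \sum_i pr mu (E i).
Proof.
move=> mA mE q0 Eq; rewrite -lee_fin EFinM -sumEFin -prE//.
under [leRHS]eq_bigr do rewrite -prE// (law_concat t (mE _)).
rewrite -ge0_integral_sum//; last by move=> i; exact: measurable_fun_section.
rewrite -[in leLHS](setIT A) -integral_indic// -ge0_integralZl//.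
- apply: ge0_le_integral => //.
  + by move=> x _; rewrite mule_ge0// lee_fin.
  + apply: emeasurable_funM => //.
    by apply: measurableT_comp => //; exact: measurable_indic.
  + by apply: emeasurable_sum => i; exact: measurable_fun_section.
  move=> x _; rewrite indicE; have [xA|xA] := boolP (x \in A).
    rewrite mule1 (eq_bigr (fun i => (pr mu [set y | E i (concat t x y)])%:E)).
      by rewrite sumEFin lee_fin; apply: Eq; rewrite inE in xA.
    by move=> i _; rewrite prE//; exact: measurable_concat_section.
  by rewrite mule0; apply: sume_ge0.
- by apply: measurableT_comp => //; exact: measurable_indic.
Qed.

End IidLaw.

(** * Good junctions *)
Section Geometric.
Context {R : realType}.

Lemma expR_small (a eps : R) : 0 < a -> 0 < eps ->
  exists N : nat, forall n, (N <= n)%N -> expR (- (a * n%:R)) <= eps.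
Proof.
move=> a0 e0; pose N := (Num.truncn (a^-1 * eps^-1)).+1.
exists N => n Nn.
have aN : eps^-1 < a * n%:R.
  rewrite mulrC -ltr_pdivrMr// mulrC; apply: lt_le_trans (truncnS_gt _) _.
  by rewrite ler_nat.
rewrite expRN -[leRHS]invrK lef_pV2 ?posrE ?expR_gt0 ?invr_gt0//.
by apply: le_trans (ltW aN) _; apply: le_trans (expR_ge1Dx _); rewrite lerDr.
Qed.

Lemma geometric_tail (a eps : R) : 0 < a -> 0 < eps ->
  exists N : nat, forall l n, (N <= l)%N ->
    \sum_(r < n | (l <= r)%N) expR (- (a * r%:R)) <= eps.
Proof.
move=> a0 e0; pose x := expR (- a).
have x1 : 0 < 1 - x by rewrite subr_gt0 -expR0 ltr_expR oppr_lt0.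
have xr r : expR (- (a * r%:R)) = x ^+ r by rewrite -mulNr mulrC expRM_natl.
have [N hN] := expR_small a0 (mulr_gt0 e0 x1).
exists N => l n Nl; have := hN l Nl; rewrite xr => xl.
rewrite -(ler_pM2r x1); apply: le_trans xl.
have x0 : 0 <= x := expR_ge0 _.
(* A telescoping invariant: [1 - x] times the partial sum, plus the next power, does not exceed
   [x ^+ l]. The conditional covers the empty sums with [n < l]. *)
suff : (\sum_(r < n | (l <= r)%N) expR (- (a * r%:R))) * (1 - x) +
    (if (l <= n)%N then x ^+ n else x ^+ l) <= x ^+ l.
  apply: le_trans; rewrite lerDl; by case: ifP; rewrite exprn_ge0.
elim: n => [|n IH].
  by rewrite big_ord0 mul0r add0r; case: ifP => //; rewrite leqn0 => /eqP ->.
rewrite big_mkcond big_ord_recr -big_mkcond/=.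
case: (ltngtP l n) IH => [ln|nl|ln].
- rewrite (leq_trans (ltnW ln))// xr exprS => IH; apply: le_trans IH.
  rewrite le_eqVlt; apply/orP; left; apply/eqP; ring.
- rewrite addr0; case: ifP => // ln1 IH; move: IH.
  by have -> : l = n.+1 by apply/eqP; rewrite eqn_leq ln1 nl.
- rewrite ln leqnSn xr exprS => IH; apply: le_trans IH.
  rewrite le_eqVlt; apply/orP; left; apply/eqP; ring.
Qed.

End Geometric.

Section GoodJunction.
Context {R : realType} {d : nat}.
Local Notation mseq := (@mseq R d).
Variable mu : probability mseq R.
Hypothesis Hmu : iid_law mu.
Variables (alpha beta C1 delta c tau : R) (l : nat).

(** Only one-step changes of direction are recorded. Their sizes are summable, so avoiding them from
    [l] on freezes the direction up to [delta / 2]. *)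
Definition unstable a r (x : mseq) : Prop := word x a r = 0 \/
  ~ colclose (2 * expR (- (alpha * r%:R))) (word x a r) (word x a r.+1).

(** Two left factors share the cut because a cut must suit both the word read from 0 and the word
    read from an earlier cut. Continuations shorter than [l] are not tested: the probability bound
    [nonconcP] is at length [l], and the drift is controlled from there on. *)
Definition good_junction (Y1 Y2 : 'M[R]_d) i M (x : mseq) : Prop :=
  forall r, (l <= r)%N -> (i + r <= M)%N ->
    colgood (delta / 2) (Y1 *m word x 0 i) (word x i r) /\
    colgood (delta / 2) (Y2 *m word x 0 i) (word x i r).

Hypothesis l_gt0 : (0 < l)%N.
Hypothesis stableP : forall r, (l <= r)%N ->
  pr mu [set x | unstable 0 r x] <= C1 * expR (- (beta * r%:R)).
Hypothesis nonconcP : forall Y1 Y2 : 'M[R]_d,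
  c <= pr mu [set x | colgood delta Y1 (word x 0 l) /\ colgood delta Y2 (word x 0 l)].
Hypothesis delta_tail : forall n,
  \sum_(r < n | (l <= r)%N) (2 * expR (- (alpha * r%:R))) <= delta / 2.
Hypothesis tauP : forall n, (1 - c) * expR (tau * l%:R) +
  \sum_(r < n | (l <= r)%N) (C1 * expR (- (beta * r%:R)) * expR (tau * r.+1%:R)) <= 1.
Hypothesis tau_ge0 : 0 <= tau.

Lemma measurable_unstable a r : measurable [set x : mseq | unstable a r x].
Proof.
apply: mset_or; first by apply: mset_mx_eq0; exact: mmx_word.
by apply: mset_not; apply: mset_colclose; exact: mmx_word.
Qed.

Lemma measurable_good_junction (Y1 Y2 : mseq -> 'M[R]_d) i M : mmx Y1 -> mmx Y2 ->
  measurable [set x : mseq | good_junction (Y1 x) (Y2 x) i M x].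
Proof.
move=> mY1 mY2.
apply: mset_forall_countable => r; do 2 (apply: mset_imply_const => _).
by apply: mset_and; apply: mset_colgood; rewrite ?[mmx _]mmx_mul//;
  do ?apply: mmx_mul => //; exact: mmx_word.
Qed.

Lemma stable_good_junction (Y : 'M[R]_d) M (x : mseq) :
  colgood delta Y (word x 0 l) ->
  (forall r, (l <= r)%N -> (r < M)%N -> ~ unstable 0 r x) ->
  forall r, (l <= r)%N -> (r <= M)%N -> colgood (delta / 2) Y (word x 0 r).
Proof.
move=> gY st r lr rM.
suff : colgood (delta - \sum_(s < r | (l <= s)%N) (2 * expR (- (alpha * s%:R)))) Y
    (word x 0 r).
  by apply: colgood_le; have := delta_tail r; lra.
elim: r lr rM => [|r IH] lr rM.
  by move: gY; rewrite big_ord0 subr0; move: lr; rewrite leqn0 => /eqP ->.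
rewrite big_mkcond big_ord_recr -big_mkcond/=.
have [lr'|rl] := leqP l r; last first.
  have lE : l = r.+1 by apply/eqP; rewrite eqn_leq lr rl.
  rewrite big1 ?add0r ?subr0 -?lE// => s; rewrite leqNgt (leq_trans (ltn_ord s))//.
  by rewrite -ltnS -lE.
have := st r lr' rM => /not_orP[w0 /contrapT cl].
rewrite opprD addrA; apply: colgood_stable cl; first exact/eqP.
by apply: IH => //; exact: ltnW.
Qed.

Definition no_good_junction m M Y1 Y2 (x : mseq) : Prop :=
  forall i, (i < m)%N -> ~ good_junction Y1 Y2 i M x.

Lemma measurable_no_good_junction m M (Y1 Y2 : mseq -> 'M[R]_d) :
  mmx Y1 -> mmx Y2 ->
  measurable [set x : mseq | no_good_junction m M (Y1 x) (Y2 x) x].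
Proof.
move=> mY1 mY2; apply: mset_forall_countable => i; apply: mset_imply_const => _.
by apply: mset_not; exact: measurable_good_junction.
Qed.

(** The letters already read are absorbed into the left factors, so the same problem reappears with
    fewer candidates. This is why the estimates are uniform in [Y1] and [Y2]. *)
Lemma no_good_junction_tail s m M Y1 Y2 (x y : mseq) : (s <= M)%N ->
  (forall i, (i < m - s)%N -> ~ good_junction Y1 Y2 (s + i) M (concat s x y)) ->
  no_good_junction (m - s) (M - s) (Y1 *m word x 0 s) (Y2 *m word x 0 s) y.
Proof.
move=> sM ng i im g; apply: (ng i im) => r lr irM.
have -> : word (concat s x y) 0 (s + i) = word x 0 s *m word y 0 i.
  rewrite word_cat word_concat_prefix//; congr (_ *m _).
  by rewrite add0n -[s in word _ s _]addn0 word_concat_suffix.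
rewrite word_concat_suffix !mulmxA; apply: g => //.
by rewrite leq_subRL// addnA.
Qed.

(* Restart after the first failure: either the test at [l] fails, or the future
   direction turns out to be unstable at some [r]; both only involve the letters
   read so far. *)
Lemma pr_no_good_junction m M Y1 Y2 :
  pr mu [set x | no_good_junction m M Y1 Y2 x] <= expR (- (tau * m%:R)).
Proof.
elim/ltn_ind: m M Y1 Y2 => m IH M Y1 Y2.
have mNG := measurable_no_good_junction m M (mmx_cst Y1) (mmx_cst Y2).
case: m IH mNG => [|m'] IH mNG.
  by rewrite mulr0 oppr0 expR0 pr_le1.
set m := m'.+1 in IH mNG *.
have [Ml|lM] := ltnP M l.
  rewrite (_ : mkset _ = set0) ?/pr ?measure0 ?expR_ge0//.
  rewrite predeqE => x; split=> // /(_ 0%N isT); apply=> r lr.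
  by rewrite add0n => rM; move: Ml; rewrite ltnNge (leq_trans lr rM).
pose tail s (x : mseq) := forall i, (i < m - s)%N -> ~ good_junction Y1 Y2 (s + i) M x.
have mtail s : measurable [set x | tail s x].
  apply: mset_forall_countable => i; apply: mset_imply_const => _.
  by apply: mset_not; apply: measurable_good_junction; exact: mmx_cst.
pose G1 := [set x : mseq | colgood delta Y1 (word x 0 l) /\ colgood delta Y2 (word x 0 l)].
have mG1 : measurable G1.
  by apply: mset_and; apply: mset_colgood; (exact: mmx_cst || exact: mmx_word).
have bound s A : (0 < s)%N -> (s <= M)%N -> measurable A ->
    (forall x y, A (concat s x y) -> A x) ->
    pr mu (A `&` [set x | tail s x]) <= expR (- (tau * m%:R)) * expR (tau * s%:R) * pr mu A.
  move=> s0 sM mA Ax; apply: (pr_concat_le Hmu (t := s)) => //.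
  - exact: measurableI.
  - by move=> x y [/Ax].
  - move=> x Axx; apply: (@le_trans _ _ (pr mu [set y | no_good_junction (m - s) (M - s)
        (Y1 *m word x 0 s) (Y2 *m word x 0 s) y])).
      apply: pr_le.
      + by apply: measurable_concat_section; exact: measurableI.
      + by apply: measurable_no_good_junction; exact: mmx_cst.
      + by move=> y [_]; exact: no_good_junction_tail.
    have [sm|ms] := leqP s m.
      apply: le_trans (IH _ _ _ _ _) _; first by rewrite ltn_subrL s0.
      by rewrite -expRD ler_expR natrB//; lra.
    (* When [s] exceeds [m] no candidate is left after the restart; the trivial bound 1 suffices, as
       the exponent is then nonnegative. *)
    apply: le_trans (pr_le1 _ _) _.
      by apply: measurable_no_good_junction; exact: mmx_cst.
    rewrite -expRD -[leLHS]expR0 ler_expR addrC subr_ge0 ler_wpM2l//.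
    by rewrite ler_nat ltnW.
have h0 : pr mu (~` G1 `&` [set x | tail l x]) <=
    expR (- (tau * m%:R)) * ((1 - c) * expR (tau * l%:R)).
  apply: le_trans (bound l (~` G1) l_gt0 lM _ _) _.
  - exact: measurableC.
  - by move=> x y; rewrite /G1 /setC/= word_concat_prefix.
  rewrite -mulrA [X in _ * X]mulrC !ler_wpM2l ?expR_ge0// ?ler_wpM2r ?expR_ge0//.
  by rewrite prC// lerD2l lerN2; exact: nonconcP.
pose F (r : 'I_M) := [set x : mseq | (l <= r)%N /\ unstable 0 r x /\ tail r.+1 x].
have mF r : measurable (F r).
  apply: mset_and; first exact: mset_const.
  by apply: mset_and => //; exact: measurable_unstable.
have hr (r : 'I_M) : pr mu (F r) <= if (l <= r)%N then
    expR (- (tau * m%:R)) * (C1 * expR (- (beta * r%:R)) * expR (tau * r.+1%:R)) else 0.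
  case: ifP => lr; last first.
    by rewrite (_ : F r = set0) ?/pr ?measure0//; rewrite predeqE => x; split=> // -[]; rewrite lr.
  rewrite (_ : F r = [set x | unstable 0 r x] `&` [set x | tail r.+1 x]); last first.
    by rewrite predeqE => x; split=> [[_ []]|[]].
  apply: le_trans (bound r.+1 _ _ _ _ _) _ => //.
  - exact: measurable_unstable.
  - by move=> x y; rewrite /unstable/= !word_concat_prefix//= add0n// ltnW.
  rewrite -mulrA [X in _ * X]mulrC !ler_wpM2l ?expR_ge0// ?ler_wpM2r ?expR_ge0//.
  exact: stableP.
have cover x : no_good_junction m M Y1 Y2 x ->
    (~` G1 `&` [set x | tail l x]) x \/ exists r, F r x.
  move=> ng; have tl s : tail s x by move=> i im; apply: ng; rewrite -ltn_subRL.
  have [[g1 g2]|ng1] := pselect (G1 x); last first.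
    by left; split => //; exact: tl.
  right; apply: contrapT => nF; apply: (ng 0%N isT).
  have st r : (l <= r)%N -> (r < M)%N -> ~ unstable 0 r x.
    by move=> lr rM ur; apply: nF; exists (Ordinal rM).
  move=> r lr; rewrite add0n word0 !mulmx1 => rM.
  by split; exact: (stable_good_junction _ st).
have mEF : measurable [set x | exists r, F r x] by exact: mset_exists_countable.
apply: (@le_trans _ _ (pr mu (~` G1 `&` [set x | tail l x]) + pr mu [set x | exists r, F r x])).
  apply: prU => //; apply: measurableI => //; exact: measurableC.
have h2 := pr_bigU mEF mF hr (fun x h => h).
apply: le_trans (lerD h0 h2) _.
(* What remains beside [expR (- (tau * m%:R))] bounds the exponential moment of the restart time;
   [tauP] says that it is at most 1, which closes the induction. *)
rewrite -big_mkcond/= -mulr_sumr -mulrDr -[leRHS]mulr1 ler_wpM2l ?expR_ge0//.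
exact: tauP.
Qed.

End GoodJunction.

(** * Cyclic conjugates as relabelled words *)

Section Cyclic.
Context {R : realType} {d : nat}.
Implicit Types x : nat -> 'M[R]_d.

Lemma word_split x a b c : (a <= b <= c)%N ->
  word x a (b - a) *m word x b (c - b) = word x a (c - a).
Proof.
move=> /andP[ab bc]; rewrite -[in word x b _](subnKC ab) -word_cat.
by congr word; lia.
Qed.

(** A rotation of the first [n] letters. The identity beyond [n] makes it injective on all indices,
    so that [pr_relabel] applies and every cyclic conjugate has the law of the word itself. *)
Definition cyc n k m : nat := if (m < n)%N then ((k + m) %% n)%N else m.

Lemma cyc_inj n k : (0 < n)%N -> injective (cyc n k).
Proof.
move=> n0 a b; rewrite /cyc; case: ifP => an; case: ifP => bn //.
- by move/eqP; rewrite eqn_modDl !modn_small// => /eqP.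
- by move=> h; move: bn; rewrite -h ltn_pmod.
- by move=> h; move: an; rewrite h ltn_pmod.
Qed.

Lemma word_cyc_low n k x b r : (k + b + r <= n)%N ->
  word (relabel (cyc n k) x) b r = word x (k + b) r.
Proof.
move=> le; apply: eq_word => i ir; rewrite /relabel /cyc.
have lt : (k + (b + i) < n)%N by rewrite addnA (leq_trans _ le)// ltn_add2l.
have lt' : (b + i < n)%N by lia.
by rewrite lt' modn_small// addnA.
Qed.

Lemma word_cyc_high n k x b r : (k <= n)%N -> (n <= k + b)%N -> (b + r <= n)%N ->
  word (relabel (cyc n k) x) b r = word x (k + b - n) r.
Proof.
move=> kn nkb bn; apply: eq_word => i ir; rewrite /relabel /cyc.
have lt : (b + i < n)%N by rewrite (leq_trans _ bn)// ltn_add2l.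
rewrite lt addnA -{1}(subnK nkb) addnAC modnDr modn_small//.
by lia.
Qed.

End Cyclic.

(** * Good cuts in a window of candidates *)

Section GoodEvent.
Context {R : realType} {d : nat}.
Local Notation mseq := (@mseq R d).
Variable mu : probability mseq R.
Hypothesis Hmu : iid_law mu.
Variables (a C beta : R).
Hypotheses (a_gt0 : 0 < a) (beta_gt0 : 0 < beta) (C_ge0 : 0 <= C).
Hypothesis word_neq0 : forall r, pr mu [set x : mseq | word x 0 r = 0] = 0.
Hypothesis stable_pairs : forall r r', (r <= r')%N ->
  pr mu [set x : mseq | ~ colclose (2 * expR (- (a * r%:R))) (word x 0 r) (word x 0 r')]
    <= C * expR (- (beta * r%:R)).

Lemma pr_unstable r : pr mu [set x | unstable a 0 r x] <= C * expR (- (beta * r%:R)).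
Proof.
rewrite -[leRHS]add0r -(word_neq0 r).
apply: (@le_trans _ _ (pr mu [set x : mseq | word x 0 r = 0] +
  pr mu [set x : mseq | ~ colclose (2 * expR (- (a * r%:R))) (word x 0 r) (word x 0 r.+1)])).
  apply: prU => //; first exact: measurable_unstable.
    by apply: mset_mx_eq0; exact: mmx_word.
  by apply: mset_not; apply: mset_colclose; exact: mmx_word.
by rewrite lerD2l; apply: stable_pairs.
Qed.

Definition good_from delta l s i M (x : mseq) : Prop :=
  forall r, (l <= r)%N -> (i + r <= M)%N ->
    colgood delta (word x 0 i) (word x i r) /\
    colgood delta (word x s (i - s)) (word x i r).

Lemma measurable_good_from delta l s i M : measurable [set x | good_from delta l s i M x].
Proof.
apply: mset_forall_countable => r; do 2 (apply: mset_imply_const => _).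
by apply: mset_and; apply: mset_colgood; exact: mmx_word.
Qed.

Variables (delta0 c : R) (l0 : nat).
Hypotheses (delta0_gt0 : 0 < delta0) (c_gt0 : 0 < c).
Hypothesis nonconc : forall l, (l0 <= l)%N -> forall Y1 Y2 : 'M[R]_d,
  c <= pr mu [set x | colgood delta0 Y1 (word x 0 l) /\ colgood delta0 Y2 (word x 0 l)].

Lemma good_from_exponential : exists (l : nat) (tau : R), 0 < tau /\
  forall s t m M, (s <= t)%N -> (t <= M)%N ->
    pr mu [set x | forall i, (i < m)%N -> ~ good_from (delta0 / 2) l s (t + i) M x]
      <= expR (- (tau * m%:R)).
Proof.
(* With tails at most [delta0 / 4] here and [c / (4 * (C + 1))] below, the drift uses half of
   [delta0] and the unstable times use half of [c]. *)
have [l1 hl1] := geometric_tail a_gt0 (divr_gt0 delta0_gt0 (ltr0Sn R 3)).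
have b2 : 0 < beta / 2 by rewrite divr_gt0.
have cC : 0 < c / (4 * (C + 1)) by rewrite divr_gt0// mulr_gt0// ltr_wpDl.
have [l2 hl2] := geometric_tail b2 cC.
pose l := maxn 1 (maxn l0 (maxn l1 l2)).
have l_gt0 : (0 < l)%N by rewrite leq_max.
have l0l : (l0 <= l)%N by rewrite !leq_max leqnn orbT.
have l1l : (l1 <= l)%N by rewrite !leq_max leqnn !orbT.
have l2l : (l2 <= l)%N by rewrite !leq_max leqnn !orbT.
have lR : 0 < l%:R :> R by rewrite ltr0n.
have c2 : 0 < ln (1 + c / 2) by rewrite ln_gt0// ltrDl divr_gt0.
have l20 : 0 < ln (2 : R) by rewrite ln_gt0// ltr1n.
(* The first bound gives [expR (tau * l%:R) <= 1 + c / 2], so a failed test at [l] weighs at most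
   [1 - c / 2]. The second keeps half of the decay rate [beta], and the third bounds by 2 the extra
   letter read at an unstable time. *)
pose tau := Num.min (ln (1 + c / 2) / l%:R) (Num.min (beta / 2) (ln 2)).
have tau0 : 0 < tau by rewrite !lt_min b2 l20 divr_gt0.
have t1 : expR (tau * l%:R) <= 1 + c / 2.
  rewrite -[leRHS]lnK ?posrE; last by rewrite addr_gt0// divr_gt0.
  by rewrite ler_expR -ler_pdivlMr// ge_min lexx.
have t2 : tau <= beta / 2 by rewrite /tau !ge_min lexx orbT.
have t3 : expR tau <= 2.
  by rewrite -[leRHS](@lnK R) ?posrE// ler_expR /tau !ge_min lexx !orbT.
have c1 : c <= 1.
  apply: le_trans (nonconc l0l 0 0) (pr_le1 _ _).
  by apply: mset_and; apply: mset_colgood; (exact: mmx_cst || exact: mmx_word).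
have tauP n : (1 - c) * expR (tau * l%:R) +
    \sum_(r < n | (l <= r)%N) (C * expR (- (beta * r%:R)) * expR (tau * r.+1%:R)) <= 1.
  have h1 : \sum_(r < n | (l <= r)%N) (C * expR (- (beta * r%:R)) * expR (tau * r.+1%:R))
      <= c / 2.
    apply: (@le_trans _ _ (\sum_(r < n | (l <= r)%N) (2 * (C + 1)) * expR (- (beta / 2 * r%:R)))).
      apply: ler_sum => r _.
      have -> : tau * r.+1%:R = tau + tau * r%:R by rewrite -natr1; ring.
      rewrite expRD.
      have h2 : expR (tau * r%:R) * expR (- (beta * r%:R)) <= expR (- (beta / 2 * r%:R)).
        rewrite -expRD ler_expR.
        have := ler_wpM2r (ler0n R r) t2; lra.
      have h3 : C * (expR (tau * r%:R) * expR (- (beta * r%:R))) <= (C + 1) * expR (- (beta / 2 * r%:R)).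
        by apply: ler_pM => //; rewrite ?mulr_ge0 ?expR_ge0// lerDl.
      have h4 : 0 <= C * (expR (tau * r%:R) * expR (- (beta * r%:R))).
        by rewrite !mulr_ge0 ?expR_ge0.
      have h5 := ler_wpM2r h4 t3.
      lra.
    rewrite -mulr_sumr; apply: le_trans (ler_wpM2l _ (hl2 l n l2l)) _.
      by rewrite mulr_ge0// addr_ge0.
    rewrite le_eqVlt; apply/orP; left; apply/eqP; field.
    by rewrite gt_eqF// ltr_wpDl.
  have h2 : (1 - c) * expR (tau * l%:R) <= (1 - c) * (1 + c / 2).
    by rewrite ler_wpM2l// subr_ge0.
  have := sqr_ge0 c; rewrite expr2; lra.
have delta_tail n : \sum_(r < n | (l <= r)%N) (2 * expR (- (a * r%:R))) <= delta0 / 2.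
  by rewrite -mulr_sumr; have := hl1 l n l1l; lra.
have main := pr_no_good_junction Hmu l_gt0 (fun r _ => pr_unstable r)
  (nonconc l0l) delta_tail tauP (ltW tau0).
exists l, tau; split=> // s t m M st tM.
have -> : expR (- (tau * m%:R)) = expR (- (tau * m%:R)) * pr mu setT.
  by rewrite prT mulr1.
have mE : measurable [set x : mseq | forall i, (i < m)%N -> ~ good_from (delta0 / 2) l s (t + i) M x].
  apply: mset_forall_countable => i; apply: mset_imply_const => _.
  by apply: mset_not; exact: measurable_good_from.
apply: (pr_concat_le Hmu (t := t)) => //.
move=> x _; apply: le_trans (main m (M - t)%N (word x 0 t) (word x s (t - s))).
apply: pr_le.
- exact: measurable_concat_section.
- by apply: measurable_no_good_junction; exact: mmx_cst.
move=> y /= ng i im g; apply: (ng i im) => r lr irM.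
have [|g1 g2] := g r lr.
  by rewrite leq_subRL// addnA.
have wy : word (concat t x y) t i = word y 0 i.
  by have := word_concat_suffix t x y 0 i; rewrite addn0.
rewrite word_concat_suffix; split.
  by rewrite word_cat word_concat_prefix// add0n wy.
have -> : (t + i - s = (t - s) + i)%N by rewrite addnBAC.
by rewrite word_cat word_concat_prefix ?subnKC// wy.
Qed.

End GoodEvent.

(** * Three good cuts and the spectrum of a word *)

Section Spectrum.
Context {R : realType} {e : nat}.
Local Notation d := e.+2.
Local Notation mseq := (@mseq R d).
Variables (a delta : R) (l : nat).

(* The cuts are [k] in [3m, 4m) for the start [0], then [m + i] for the starts
   [0] and [j]; the last clause places [j] itself, in the next period of the word
   read cyclically from [k] (where [0] is the position [n - k]). *)
Definition good_event m n (x : mseq) : Prop :=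
  [/\ forall k r, (k < n)%N -> (r <= n)%N -> word (relabel (cyc n k) x) 0 r <> 0,
      forall k r r', (k < n)%N -> (m <= r)%N -> (r <= r')%N -> (r' <= n)%N ->
        colclose (2 * expR (- (a * r%:R))) (word (relabel (cyc n k) x) 0 r)
          (word (relabel (cyc n k) x) 0 r'),
      exists k, (k < m)%N /\ good_from delta l 0 (3 * m + k) n x,
      forall j, (j < m)%N -> exists i, (i < m)%N /\ good_from delta l j (m + i) n x &
      forall k, (k < m)%N -> exists j, (j < m)%N /\
        good_from delta l (n - (3 * m + k)) (n - (3 * m + k) + j) n
          (relabel (cyc n (3 * m + k)) x)].

Local Ltac cut_lia :=
  repeat match goal with
  | H : ?T |- _ =>
    lazymatch T with nat => fail | is_true (_ <= _)%N => fail | _ => clear H end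
  end; lia.

(** The windows [j < m], [m <= i < 2m], [3m <= k < 4m] and the bound [5m <= n] make [Z], [X] and [H]
    at least [m] long, so every test applies with accuracy [kap]; [A] may be short. The final
    accuracy involves only the words [X H] and [X H A], of lengths [n - j] and [n], whence the
    exponent [n - m]. *)
Lemma good_event_spectrum m n x (v : 'cV[R]_d) :
  0 < delta <= 1 -> 0 < a -> (5 * m <= n)%N -> (l <= m)%N -> (0 < m)%N ->
  2 * expR (- (a * m%:R)) <= delta ^+ 4 / 32 ->
  2 * expR (- (a * (n - m)%:R)) <= delta ^+ 4 / 16 / (4 * d%:R ^+ 3) ->
  good_event m n x -> v != 0 ->
  (forall j, col j (word x 0 n) != 0 ->
     pdist (col j (word x 0 n)) v < 2 * expR (- (a * (n - m)%:R))) ->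
  [/\ 0 < rho 1 (word x 0 n),
      rho 2 (word x 0 n) <=
        gap_const (n := e) delta * (2 * expR (- (a * (n - m)%:R))) * rho 1 (word x 0 n) &
      forall w, top_eigvec (word x 0 n) w ->
        pdist w v <= eig_const (n := e) delta * (2 * expR (- (a * (n - m)%:R)))].
Proof.
move=> d01 a0 mn lm m0 ksmall esmall [nz st [k' [k'm E1]] E2 E3] v0 cv.
have [j [jm {}E3]] := E3 k' k'm.
have [i' [i'm {}E2]] := E2 j jm.
set k := (3 * m + k')%N in E1 E3; set i := (m + i')%N in E2.
set kap := 2 * expR (- (a * m%:R)) in ksmall.
set eps := 2 * expR (- (a * (n - m)%:R)) in esmall cv *.
have kap_le r : (m <= r)%N -> 2 * expR (- (a * r%:R)) <= kap.
  by move=> mr; rewrite ler_wpM2l// ler_expR lerN2 ler_wpM2l ?ler_nat// ltW.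
have low b r s : (b < n)%N -> (b + s + r <= n)%N -> word (relabel (cyc n b) x) s r = word x (b + s) r.
  by move=> _; exact: word_cyc_low.
pose A := word x 0 j; pose X := word x j (k - j); pose H := word x k (n - k).
pose Y0 := word x 0 i; pose Yj := word x j (i - j); pose Z := word x i (k - i).
have XE : X = Yj *m Z.
  by rewrite /X /Yj /Z word_split//; cut_lia.
have gE : word x 0 n = A *m (X *m H).
  rewrite /X /H word_split; last cut_lia.
  by rewrite /A -[X in word x 0 X *m _]subn0 word_split ?subn0//; cut_lia.
have YZ : Y0 *m Z = word x 0 k.
  by rewrite /Y0 /Z -[X in word x 0 X *m _]subn0 word_split ?subn0//; cut_lia.
have HE : H = word (relabel (cyc n k) x) 0 (n - k).
  by rewrite low ?addn0//; cut_lia.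
have AE : A = word (relabel (cyc n k) x) (n - k) j.
  by rewrite word_cyc_high; [congr word; cut_lia|cut_lia|cut_lia|cut_lia].
have HAE : H *m A = word (relabel (cyc n k) x) 0 (n - k + j).
  by rewrite word_cat -HE add0n -AE.
have XHE : X *m H = word (relabel (cyc n j) x) 0 (n - j).
  rewrite low ?addn0; try cut_lia.
  by rewrite /X /H word_split//; cut_lia.
have XcE : X = word (relabel (cyc n k) x) (n - k + j) (k - j).
  by rewrite word_cyc_high; [congr word; cut_lia|cut_lia|cut_lia|cut_lia].
have XjE : X = word (relabel (cyc n j) x) 0 (k - j).
  by rewrite low ?addn0//; cut_lia.
have GE : X *m (H *m A) = word (relabel (cyc n j) x) 0 n.
  have -> : n = (n - j + j)%N by cut_lia.
  rewrite word_cat subnK; last cut_lia.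
  rewrite -XHE mulmxA; congr (_ *m _).
  by rewrite add0n word_cyc_high; [congr word; cut_lia|cut_lia|cut_lia|cut_lia].
have Y0E : Y0 = word (relabel (cyc n 0) x) 0 i by rewrite low//; cut_lia.
have A0E : A = word (relabel (cyc n 0) x) 0 j by rewrite low//; cut_lia.
have ZE : Z = word (relabel (cyc n i) x) 0 (k - i) by rewrite low ?addn0//; cut_lia.
rewrite gE in cv *.
apply: (@aligned_spectrum _ _ delta kap eps A X Y0 Yj Z H v) => //.
- by apply/eqP; rewrite Y0E; apply: nz; cut_lia.
- by apply/eqP; rewrite HE; apply: nz; cut_lia.
- by apply/eqP; rewrite A0E; apply: nz; cut_lia.
- by apply/eqP; rewrite XHE; apply: nz; cut_lia.
- by apply/eqP; rewrite GE; apply: nz; cut_lia.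
- by rewrite YZ; apply: (proj1 (E1 (n - k)%N _ _)); cut_lia.
- by rewrite HAE HE; apply: colclose_le (kap_le (n - k)%N _) (st _ _ _ _ _ _ _); cut_lia.
- by apply: (proj1 (E2 (k - i)%N _ _)); cut_lia.
- by apply: (proj2 (E2 (k - i)%N _ _)); cut_lia.
- by rewrite HAE [in X in colgood _ _ X]XcE; apply: (proj1 (E3 (k - j)%N _ _)); cut_lia.
- rewrite AE XcE; have := proj2 (E3 (k - j)%N _ _).
  have -> : (n - k + j - (n - k) = j)%N by cut_lia.
  by apply; cut_lia.
- by rewrite ZE; apply: colclose_le (kap_le (k - i)%N _) (st _ _ _ _ _ _ _); cut_lia.
- by rewrite XjE; apply: colclose_le (kap_le (k - j)%N _) (st _ _ _ _ _ _ _); cut_lia.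
- by rewrite HAE; apply: colclose_le (kap_le (n - k + j)%N _) (st _ _ _ _ _ _ _); cut_lia.
- rewrite GE XHE; apply: colclose_le (st _ (n - j)%N _ _ _ _ _); try cut_lia.
  by rewrite ler_wpM2l// ler_expR lerN2 ler_wpM2l ?ler_nat//; [exact: ltW|cut_lia].
- rewrite GE; apply: colclose_le (st _ n%N _ _ _ _ _); try cut_lia.
  by rewrite ler_wpM2l// ler_expR lerN2 ler_wpM2l ?ler_nat//; [exact: ltW|cut_lia].
Qed.

Lemma measurable_good_event m n : measurable [set x | good_event m n x].
Proof.
have mw k r : mmx (fun x : mseq => word (relabel (cyc n k) x) 0 r).
  move=> i j; apply: (measurableT_comp (mmx_word 0 r i j)).
  exact: measurable_relabel.
have mg s t k : measurable [set x : mseq | good_from delta l s t n (relabel (cyc n k) x)].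
  have := measurable_relabel (R := R) (d := d) (cyc n k) measurableT
    (measurable_good_from delta l s t n).
  by rewrite setTI.
rewrite (_ : mkset _ =
  [set x : mseq | (forall k r, (k < n)%N -> (r <= n)%N -> word (relabel (cyc n k) x) 0 r <> 0) /\
  ((forall k r r', (k < n)%N -> (m <= r)%N -> (r <= r')%N -> (r' <= n)%N ->
        colclose (2 * expR (- (a * r%:R))) (word (relabel (cyc n k) x) 0 r)
          (word (relabel (cyc n k) x) 0 r')) /\
  ((exists k, (k < m)%N /\ good_from delta l 0 (3 * m + k) n x) /\
  ((forall j, (j < m)%N -> exists i, (i < m)%N /\ good_from delta l j (m + i) n x) /\
  (forall k, (k < m)%N -> exists j, (j < m)%N /\
        good_from delta l (n - (3 * m + k)) (n - (3 * m + k) + j) n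
          (relabel (cyc n (3 * m + k)) x)))))]); last first.
  by rewrite predeqE => x; split=> [[]|[? [? [? []]]]].
apply: mset_and; [|apply: mset_and; [|apply: mset_and; [|apply: mset_and]]].
- apply: mset_forall_countable => k; apply: mset_forall_countable => r.
  do 2 (apply: mset_imply_const => _).
  by apply: mset_not; exact: mset_mx_eq0.
- do 3 (apply: mset_forall_countable => ?); do 4 (apply: mset_imply_const => _).
  exact: mset_colclose.
- apply: mset_exists_countable => k; apply: mset_and; first exact: mset_const.
  exact: measurable_good_from.
- apply: mset_forall_countable => j; apply: mset_imply_const => _.
  apply: mset_exists_countable => k; apply: mset_and; first exact: mset_const.
  exact: measurable_good_from.
- apply: mset_forall_countable => j; apply: mset_imply_const => _.
  by apply: mset_exists_countable => k; apply: mset_and; first exact: mset_const.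
Qed.

End Spectrum.

Lemma pr_or (dT : measure_display) (T : measurableType dT) (R : realType)
    (P : probability T R) (A B : T -> Prop) (p q : R) :
  measurable [set x | A x] -> measurable [set x | B x] ->
  pr P [set x | A x] <= p -> pr P [set x | B x] <= q ->
  pr P [set x | A x \/ B x] <= p + q.
Proof.
move=> mA mB pA pB; apply: le_trans (lerD pA pB).
by apply: prU => //; exact: mset_or.
Qed.

Lemma pr_exists (dT : measure_display) (T : measurableType dT) (R : realType)
    (P : probability T R) (I : finType) (F : I -> T -> Prop) (q : R) :
  (forall i, measurable [set x | F i x]) -> (forall i, pr P [set x | F i x] <= q) ->
  pr P [set x | exists i, F i x] <= #|I|%:R * q.
Proof.
move=> mF Fq; rewrite mulr_natl -sumr_const.
by apply: (pr_bigU (F := fun i => [set x | F i x])) => //; exact: mset_exists_countable.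
Qed.

(** * Probability of the good event *)

Section GoodEventProbability.
Context {R : realType} {e : nat}.
Local Notation d := e.+2.
Local Notation mseq := (@mseq R d).
Variable mu : probability mseq R.
Hypothesis Hmu : iid_law mu.
Variables (a C beta delta tau : R) (l : nat).
Hypothesis word_neq0 : forall r, pr mu [set x : mseq | word x 0 r = 0] = 0.
Hypothesis stable_pairs : forall r r', (r <= r')%N ->
  pr mu [set x : mseq | ~ colclose (2 * expR (- (a * r%:R))) (word x 0 r) (word x 0 r')]
    <= C * expR (- (beta * r%:R)).
Hypothesis good_fromP : forall s t m M, (s <= t)%N -> (t <= M)%N ->
    pr mu [set x | forall i, (i < m)%N -> ~ good_from delta l s (t + i) M x]
      <= expR (- (tau * m%:R)).
Hypotheses (beta_ge0 : 0 <= beta) (C_ge0 : 0 <= C).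

(** A union bound. By [pr_relabel] each rotated condition costs no more than the unrotated one; the
    cubic factor counts the rotation and the two lengths. *)
Lemma pr_not_good_event m n : (0 < m)%N -> (5 * m <= n)%N ->
  pr mu [set x | ~ good_event a delta l m n x] <=
    (n.+1 * n.+1 * n.+1)%:R * (C * expR (- (beta * m%:R))) +
    (1 + m%:R + m%:R) * expR (- (tau * m%:R)).
Proof.
move=> m0 mn; have n0 : (0 < n)%N by lia.
have mw k r : mmx (fun x : mseq => word (relabel (cyc n k) x) 0 r).
  move=> i j; apply: (measurableT_comp (mmx_word 0 r i j)).
  exact: measurable_relabel.
have mrel k (A : set mseq) : measurable A -> measurable [set x | A (relabel (cyc n k) x)].
  move=> mA; have := measurable_relabel (R := R) (d := d) (cyc n k) measurableT mA.
  by rewrite setTI.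
pose B0 (p : 'I_n * 'I_n.+1) (x : mseq) := word (relabel (cyc n p.1) x) 0 p.2 = 0.
pose B1 (p : 'I_n.+1 * 'I_n.+1 * 'I_n.+1) (x : mseq) := (m <= p.1.2)%N /\ ((p.1.2 <= p.2)%N /\
  ~ colclose (2 * expR (- (a * p.1.2%:R))) (word (relabel (cyc n p.1.1) x) 0 p.1.2)
    (word (relabel (cyc n p.1.1) x) 0 p.2)).
pose B2 (x : mseq) := forall k, (k < m)%N -> ~ good_from delta l 0 (3 * m + k) n x.
pose B3 (j : 'I_m) (x : mseq) := forall i, (i < m)%N -> ~ good_from delta l j (m + i) n x.
pose B4 (k : 'I_m) (x : mseq) := forall j, (j < m)%N ->
  ~ good_from delta l (n - (3 * m + k)) (n - (3 * m + k) + j) n (relabel (cyc n (3 * m + k)) x).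
have mB0 p : measurable [set x | B0 p x] by exact: mset_mx_eq0.
have mB1 p : measurable [set x | B1 p x].
  apply: mset_and; first exact: mset_const.
  apply: mset_and; first exact: mset_const.
  by apply: mset_not; exact: mset_colclose.
have mB2 : measurable [set x | B2 x].
  apply: mset_forall_countable => k; apply: mset_imply_const => _.
  by apply: mset_not; exact: measurable_good_from.
have mB3 p : measurable [set x | B3 p x].
  apply: mset_forall_countable => k; apply: mset_imply_const => _.
  by apply: mset_not; exact: measurable_good_from.
have mB4' (k : 'I_m) : measurable [set x : mseq | forall j, (j < m)%N ->
  ~ good_from delta l (n - (3 * m + k)) (n - (3 * m + k) + j) n x].
  apply: mset_forall_countable => j; apply: mset_imply_const => _.
  by apply: mset_not; exact: measurable_good_from.
have mB4 p : measurable [set x | B4 p x] := mrel _ _ (mB4' p).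
have p0 p : pr mu [set x | B0 p x] <= 0.
  have := pr_relabel Hmu (cyc_inj (k := p.1) n0) (A := [set x : mseq | word x 0 p.2 = 0]).
  rewrite word_neq0 => /= -> //; by apply: mset_mx_eq0; exact: mmx_word.
have p1 p : pr mu [set x | B1 p x] <= C * expR (- (beta * m%:R)).
  rewrite /B1; have [mp|pm] := leqP m p.1.2; last first.
    rewrite (_ : mkset _ = set0) ?/pr ?measure0 ?mulr_ge0 ?expR_ge0//.
    by rewrite predeqE => x; split=> // -[].
  have [pp|pp] := leqP p.1.2 p.2; last first.
    rewrite (_ : mkset _ = set0) ?/pr ?measure0 ?mulr_ge0 ?expR_ge0//.
    by rewrite predeqE => x; split=> // -[_ []].
  apply: (@le_trans _ _ (C * expR (- (beta * p.1.2%:R)))); last first.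
    by rewrite ler_wpM2l// ler_expR lerN2 ler_wpM2l ?ler_nat.
  apply: le_trans (stable_pairs pp).
  have := pr_relabel Hmu (cyc_inj (k := p.1.1) n0) (A := [set x : mseq |
    ~ colclose (2 * expR (- (a * p.1.2%:R))) (word x 0 p.1.2) (word x 0 p.2)]).
  move=> /= <-.
    by rewrite le_eqVlt; apply/orP; left; apply/eqP; congr (pr mu _);
      rewrite predeqE => x; split=> [[_ []]|].
  by apply: mset_not; apply: mset_colclose; exact: mmx_word.
have p2 : pr mu [set x | B2 x] <= expR (- (tau * m%:R)) by apply: good_fromP; lia.
have p3 p : pr mu [set x | B3 p x] <= expR (- (tau * m%:R)).
  by apply: good_fromP; have := ltn_ord p; lia.
have p4 p : pr mu [set x | B4 p x] <= expR (- (tau * m%:R)).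
  have := pr_relabel Hmu (cyc_inj (k := 3 * m + p) n0) (mB4' p).
  move=> /= ->; apply: good_fromP; have := ltn_ord p; lia.
have mE0 := mset_exists_countable mB0.
have mE1 := mset_exists_countable mB1.
have mE3 := mset_exists_countable mB3.
have mE4 := mset_exists_countable mB4.
have q0 := pr_exists mB0 p0; have q1 := pr_exists mB1 p1.
have q3 := pr_exists mB3 p3; have q4 := pr_exists mB4 p4.
have mO3 := mset_or mE3 mE4; have mO2 := mset_or mB2 mO3; have mO1 := mset_or mE1 mO2.
have tot := pr_or mE0 mO1 q0 (pr_or mE1 mO2 q1 (pr_or mB2 mO3 p2 (pr_or mE3 mE4 q3 q4))).
rewrite !card_prod !card_ord mulr0 add0r in tot.
apply: (le_trans _ (le_trans tot _)); last first.
  by rewrite lerD2l !mulrDl mul1r addrA.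
apply: pr_le.
- by apply: mset_not; exact: measurable_good_event.
- exact: mset_or.
move=> x ng; apply: contrapT => nB; apply: ng.
move: nB => /= /not_orP[nB0 /not_orP[nB1 /not_orP[nB2 /not_orP[nB3 nB4]]]].
split.
- move=> k r kn rn w0; apply: nB0.
  by exists (Ordinal kn, Ordinal (rn : (r < n.+1)%N)).
- move=> k r r' kn mr rr' r'n; apply: contrapT => nc; apply: nB1.
  have rn : (r < n.+1)%N by rewrite ltnS (leq_trans rr').
  have kn' : (k < n.+1)%N by rewrite ltnS ltnW.
  by exists (Ordinal kn', Ordinal rn, Ordinal (r'n : (r' < n.+1)%N)).
- apply: contrapT => h; apply: nB2 => k km g; apply: h; by exists k.
- move=> j jm; apply: contrapT => h; apply: nB3; exists (Ordinal jm) => i im g.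
  by apply: h; exists i.
- move=> j jm; apply: contrapT => h; apply: nB4; exists (Ordinal jm) => i im g.
  by apply: h; exists i.
Qed.

End GoodEventProbability.

(** * Non-concentration from strong irreducibility *)
Section MaxNorm.
Context {R : realType}.

Lemma le_coord_norm m n (A : 'M[R]_(m, n)) i j : `|A i j| <= `|A|.
Proof.
rewrite [leRHS]/Num.norm/= mx_normrE.
by apply: (le_bigmax _ (fun p => `|A p.1 p.2|) (i, j)).
Qed.

Lemma fnorm_le_norm m n (A : 'M[R]_(m, n)) : fnorm A <= (m * n)%:R * `|A|.
Proof.
rewrite -[m in (m * n)%:R]card_ord -[n in (_ * n)%:R]card_ord -card_prod.
by apply: le_l2norm => // -[i j]; exact: le_coord_norm.
Qed.

Lemma norm_sphere_compact n : compact [set v : 'rV[R]_n | `|v| = 1].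
Proof.
apply: bounded_closed_compact.
  exists 1; split => // M M1 v /= ->; exact: ltW.
apply: (@preimage_closed _ _ (Num.norm : 'rV[R]_n -> R) [set x | x = 1]).
  by move=> x _; exact: norm_continuous.
exact: closed_eq.
Qed.

End MaxNorm.

Section NonConcentration.
Context {R : realType} {d' : nat}.
Local Notation d := d'.+1.
Local Notation mseq := (@mseq R d).
Variable mu : probability mseq R.
Hypothesis Hmu : iid_law mu.
Hypothesis Hsi : forall (f1 f2 : 'rV[R]_d) (v : 'cV[R]_d), f1 != 0 -> f2 != 0 ->
  v != 0 -> exists n, 0 < pr mu [set x : mseq |
    f1 *m word x 0 n *m v <> 0 /\ f2 *m word x 0 n *m v <> 0].

Definition transversal (k : R) (f1 f2 : 'rV[R]_d) (v : 'cV[R]_d) (S : 'M[R]_d) : Prop :=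
  S <> 0 /\ k * fnorm S <= fnorm (f1 *m S *m v) /\ k * fnorm S <= fnorm (f2 *m S *m v).

Lemma mset_transversal (dT : measure_display) (T : measurableType dT) k f1 f2
  (v : T -> 'cV[R]_d) (S : T -> 'M[R]_d) : mmx v -> mmx S ->
  measurable [set x | transversal k f1 f2 (v x) (S x)].
Proof.
move=> mv mS; apply: mset_and; first exact/mset_not/mset_mx_eq0.
by apply: mset_and; apply: mset_le;
  do ?[apply: measurable_funM => //]; apply: mmx_fnorm => //; do 2 (apply: mmx_mul => //);
  exact: mmx_cst.
Qed.

(** If all these sets were null as [k] grows, so would be their union, which contains the event that
    neither scalar vanishes. *)
Lemma transversal_positive f1 f2 v : f1 != 0 -> f2 != 0 -> v != 0 ->
  exists n k : nat, 0 < pr mu [set x : mseq | transversal k.+1%:R^-1 f1 f2 v (word x 0 n)].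
Proof.
move=> f10 f20 v0; have [n hn] := Hsi f10 f20 v0; exists n.
have mG k : measurable [set x : mseq | transversal k.+1%:R^-1 f1 f2 v (word x 0 n)].
  by apply: mset_transversal; [exact: mmx_cst|exact: mmx_word].
have mE : measurable [set x : mseq | f1 *m word x 0 n *m v <> 0 /\ f2 *m word x 0 n *m v <> 0].
  apply: mset_and; apply: mset_not; apply: mset_mx_eq0; apply: mmx_mul;
    do ?[apply: mmx_mul]; by [exact: mmx_cst | exact: mmx_word].
apply: contrapT => nk; move: hn; rewrite lt_def pr_ge0 andbT => /eqP; apply.
have G0 k : mu.-negligible [set x : mseq | transversal k.+1%:R^-1 f1 f2 v (word x 0 n)].
  exists [set x : mseq | transversal k.+1%:R^-1 f1 f2 v (word x 0 n)]; split => //.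
  rewrite prE//; congr (_%:E); apply/eqP.
  rewrite eq_le pr_ge0 andbT leNgt; apply/negP => h; apply: nk; by exists k.
suff : mu.-negligible [set x : mseq | f1 *m word x 0 n *m v <> 0 /\ f2 *m word x 0 n *m v <> 0].
  by move/negligibleP => /(_ mE); rewrite /pr => ->.
apply: negligibleS (negligible_bigcup G0) => x /= [e1 e2].
have S0 : word x 0 n != 0.
  by apply/eqP => S0; apply: e1; rewrite S0 mulmx0 mul0mx.
have nS : 0 < fnorm (word x 0 n) by rewrite fnorm_gt0.
have q1 : 0 < fnorm (f1 *m word x 0 n *m v) by rewrite fnorm_gt0; exact/eqP.
have q2 : 0 < fnorm (f2 *m word x 0 n *m v) by rewrite fnorm_gt0; exact/eqP.
set b1 := fnorm _ in q1; set b2 := fnorm _ in q2.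
pose b := Num.min b1 b2; have b0 : 0 < b by rewrite lt_min q1.
exists (Num.truncn (fnorm (word x 0 n) / b)) => //=.
have h : (Num.truncn (fnorm (word x 0 n) / b)).+1%:R^-1 * fnorm (word x 0 n) <= b.
  rewrite mulrC ler_pdivrMr ?ltr0n// mulrC -ler_pdivrMr//.
  exact/ltW/truncnS_gt.
split; first exact/eqP.
by split; apply: le_trans h _; rewrite /b ge_min lexx ?orbT.
Qed.

Lemma bilinear_perturb (f f' : 'rV[R]_d) (v v' : 'cV[R]_d) (S : 'M[R]_d) :
  fnorm (f *m S *m v) - (fnorm (f - f') * fnorm v + fnorm f' * fnorm (v - v')) * fnorm S
    <= fnorm (f' *m S *m v').
Proof.
rewrite lerBlDr.
have -> : f *m S *m v = f' *m S *m v' + ((f - f') *m S *m v + f' *m S *m (v - v')).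
  rewrite mulmxBr !mulmxBl; move: (f *m S *m v) (f' *m S *m v') (f' *m S *m v) => A B D.
  by apply/matrixP => i j; rewrite !mxE; ring.
apply: le_trans (ler_fnormD _ _) _; rewrite lerD2l.
apply: le_trans (ler_fnormD _ _) _; rewrite mulrDl.
apply: lerD.
  apply: le_trans (fnormM _ _) _; rewrite mulrAC ler_wpM2r ?fnorm_ge0//.
  exact: fnormM.
apply: le_trans (fnormM _ _) _; rewrite mulrAC ler_wpM2r ?fnorm_ge0//.
exact: fnormM.
Qed.

(** Compactness of the product of three unit spheres: a perturbation of [f1], [f2], [v] changes the
    bilinear forms by a small multiple of [fnorm S], so transversality persists nearby. The length
    [n] varies with the point and is only bounded. *)
Lemma transversal_uniform : exists i : nat, forall (f1 f2 v : 'rV[R]_d),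
  `|f1| = 1 -> `|f2| = 1 -> `|v| = 1 -> exists n, (n <= i)%N /\
    i.+1%:R^-1 <= pr mu [set x : mseq | transversal i.+1%:R^-1 f1 f2 v^T (word x 0 n)].
Proof.
pose K := [set v : 'rV[R]_d | `|v| = 1].
have cK : compact (K `*` (K `*` K)).
  by do ?apply: compact_setX; exact: norm_sphere_compact.
pose P (i : nat) (p : 'rV[R]_d * ('rV[R]_d * 'rV[R]_d)) := exists n, (n <= i)%N /\
  i.+1%:R^-1 <= pr mu [set x : mseq | transversal i.+1%:R^-1 p.1 p.2.1 p.2.2^T (word x 0 n)].
have /compact_near_coveringP nc := cK.
have [|N _ hN] := nc nat \oo P _; last first.
  exists N => f1 f2 v h1 h2 hv; exact: (hN N (leqnn _) (f1, (f2, v))).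
move=> [f1 [f2 v]] [/= h1 [/= h2 hv]].
have nz (w : 'rV[R]_d) : `|w| = 1 -> w != 0.
  by move=> w1; rewrite -normr_eq0 w1 oner_eq0.
have vT0 : v^T != 0 by rewrite trmx_eq0 nz.
have [n [k hk]] := transversal_positive (nz _ h1) (nz _ h2) vT0.
set p := pr mu _ in hk.
have d0 : 0 < d%:R :> R by rewrite ltr0n.
(* The two perturbation terms are at most [d ^+ 2 * rad] and twice that; their sum
   [3 * d ^+ 2 * rad] is half of [k.+1%:R^-1]. *)
pose rad : R := (6 * d%:R ^+ 2 * k.+1%:R)^-1.
have rad0 : 0 < rad by rewrite invr_gt0 !mulr_gt0// exprn_gt0.
have rad1 : rad <= 1.
  rewrite invf_le1 ?mulr_gt0 ?exprn_gt0//.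
  have e1 : 1 <= d%:R ^+ 2 :> R by rewrite exprn_ege1// ler1n.
  have e2 : 1 <= k.+1%:R :> R by rewrite ler1n.
  have e3 : 1 * 1 <= d%:R ^+ 2 * k.+1%:R :> R by apply: ler_pM.
  lra.
pose i0 := maxn n (maxn (2 * k.+1) (Num.truncn p^-1)).
exists (ball ((f1, (f2, v)) : 'rV[R]_d * ('rV[R]_d * 'rV[R]_d)) rad, [set i | (i0 <= i)%N]).
  split; first exact: nbhsx_ballx.
  by exists i0.
move=> [[g1 [g2 w]] i] [/= [b1 [b2 bw]]]; rewrite /i0 !geq_max => /andP[ni /andP[ki pi]].
move: b1 b2 bw; rewrite !mx_norm_ball /ball_/= => b1 b2 bw.
exists n; split => //.
have p_le : i.+1%:R^-1 <= p.
  rewrite -[leRHS]invrK lef_pV2 ?posrE ?invr_gt0//.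
  apply: le_trans (ltW (truncnS_gt _)) _; by rewrite ler_nat ltnS.
apply: le_trans p_le _; apply: pr_le.
- by apply: mset_transversal; [exact: mmx_cst|exact: mmx_word].
- by apply: mset_transversal; [exact: mmx_cst|exact: mmx_word].
move=> x [/= S0 [t1 t2]]; split => //.
have pert (f g : 'rV[R]_d) : `|f| = 1 -> `|f - g| < rad ->
   k.+1%:R^-1 * fnorm (word x 0 n) <= fnorm (f *m word x 0 n *m v^T) ->
   i.+1%:R^-1 * fnorm (word x 0 n) <= fnorm (g *m word x 0 n *m w^T).
  move=> hf fg tf; apply: le_trans (bilinear_perturb f g v^T w^T _).
  have n1 : fnorm (f - g) <= d%:R * rad.
    by apply: le_trans (fnorm_le_norm _) _; rewrite mul1n ler_wpM2l// ltW.
  have n2 : fnorm v^T <= d%:R.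
    apply: le_trans (fnorm_le_norm _) _; rewrite muln1 -[leRHS]mulr1 ler_wpM2l//.
    rewrite -hv [leLHS]/Num.norm/= mx_normrE; apply/bigmax_leP; split=> // -[r s] _ /=.
    by rewrite mxE; exact: le_coord_norm.
  have n3 : fnorm g <= d%:R * 2.
    apply: le_trans (fnorm_le_norm _) _; rewrite mul1n ler_wpM2l//.
    have -> : g = f - (f - g) by rewrite subKr.
    apply: le_trans (ler_normB _ _) _; rewrite hf; lra.
  have n4 : fnorm (v^T - w^T) <= d%:R * rad.
    rewrite -linearB/=; apply: le_trans (fnorm_le_norm _) _; rewrite muln1 ler_wpM2l//.
    apply: le_trans (ltW bw).
    rewrite [leLHS]/Num.norm/= mx_normrE; apply/bigmax_leP; split=> // -[r s] _ /=.
    by rewrite mxE; exact: le_coord_norm.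
  have n5 : fnorm (f - g) * fnorm v^T <= (d%:R * rad) * d%:R.
    by apply: ler_pM; rewrite ?fnorm_ge0.
  have n6 : fnorm g * fnorm (v^T - w^T) <= (d%:R * 2) * (d%:R * rad).
    by apply: ler_pM; rewrite ?fnorm_ge0.
  have n7 : d%:R ^+ 2 * rad * 3 = k.+1%:R^-1 / 2.
    by rewrite /rad; field; rewrite !gt_eqF// ltr0n.
  have n8 : i.+1%:R^-1 <= k.+1%:R^-1 / 2 :> R.
    have -> : k.+1%:R^-1 / 2 = (2 * k.+1%:R)^-1 :> R by rewrite invfM mulrC.
    by rewrite lef_pV2 ?posrE ?mulr_gt0 ?ltr0n// -natrM ler_nat (leq_trans ki).
  rewrite lerBrDr; apply: le_trans tf; rewrite -mulrDl ler_wpM2r ?fnorm_ge0//.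
  move: n5 n6 n7 n8; rewrite expr2; clearbody rad.
  move: (fnorm _ * fnorm v^T) (fnorm g * fnorm _) (i.+1%:R^-1) (k.+1%:R^-1) => A B I K'.
  by move: (d%:R) => dd; clear; nra.
by split; [exact: (pert f1)|exact: (pert f2)].
Qed.

Definition transversal_vec (k : R) (f1 f2 : 'rV[R]_d) (u : 'cV[R]_d) : Prop :=
  u <> 0 /\ (k * fnorm f1 * fnorm u <= fnorm (f1 *m u) /\
  k * fnorm f2 * fnorm u <= fnorm (f2 *m u)).

Lemma mset_transversal_vec (dT : measure_display) (T : measurableType dT) k f1 f2
  (u : T -> 'cV[R]_d) : mmx u -> measurable [set x | transversal_vec k f1 f2 (u x)].
Proof.
move=> mu'; apply: mset_and; first exact/mset_not/mset_mx_eq0.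
by apply: mset_and; apply: mset_le;
  do ?[apply: measurable_funM => //]; apply: mmx_fnorm => //; apply: mmx_mul => //;
  exact: mmx_cst.
Qed.

(** Homogeneity reduces to vectors of sup norm 1, at the price of [d ^+ 2] for the change of norm.
    Since [fnorm (S *m v)] is at most [fnorm S * fnorm v], a bound relative to [S] becomes one
    relative to the vector [S *m v]. *)
Lemma transversal_vec_uniform : exists (i : nat) (k q : R), 0 < k /\ 0 < q /\
  forall (f1 f2 : 'rV[R]_d) (v : 'cV[R]_d), f1 != 0 -> f2 != 0 -> v != 0 ->
  exists n, (n <= i)%N /\
    q <= pr mu [set x : mseq | transversal_vec k f1 f2 (word x 0 n *m v)].
Proof.
have [i hi] := transversal_uniform; exists i.
have d0 : 0 < d%:R :> R by rewrite ltr0n.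
have i0 : 0 < i.+1%:R^-1 :> R by rewrite invr_gt0 ltr0n.
exists (i.+1%:R^-1 / d%:R ^+ 2), i.+1%:R^-1; split; first by rewrite divr_gt0 ?exprn_gt0.
split=> // f1 f2 v f10 f20 v0.
have vT0 : v^T != 0 by rewrite trmx_eq0.
have unit (w : 'rV[R]_d) : w != 0 -> `| `|w|^-1 *: w | = 1.
  by move=> w0; rewrite normrZ normfV normr_id mulVf// normr_eq0.
have [n [ni hn]] := hi _ _ _ (unit _ f10) (unit _ f20) (unit _ vT0).
exists n; split=> //; apply: le_trans hn _; apply: pr_le.
- by apply: mset_transversal; [exact: mmx_cst|exact: mmx_word].
- by apply: mset_transversal_vec; apply: mmx_mul; [exact: mmx_word|exact: mmx_cst].
move=> x /= [S0 [t1 t2]].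
set S := word x 0 n in S0 t1 t2 *.
have S_gt0 : 0 < fnorm S by rewrite fnorm_gt0; exact/eqP.
have scale (f : 'rV[R]_d) : f != 0 ->
    i.+1%:R^-1 * fnorm S <= fnorm (`|f|^-1 *: f *m S *m (`|v^T|^-1 *: v^T)^T) ->
    i.+1%:R^-1 / d%:R ^+ 2 * fnorm f * (fnorm S * fnorm v) <= fnorm (f *m (S *m v)).
  move=> f0; rewrite linearZ/= trmxK -scalemxAr -!scalemxAl !fnormZ !normfV !normr_id.
  have a0 : 0 < `|f| by rewrite normr_gt0.
  have b0 : 0 < `|v^T| by rewrite normr_gt0.
  rewrite !ler_pdivlMl// -mulmxA => h.
  have hf : fnorm f <= d%:R * `|f| by have := fnorm_le_norm f; rewrite mul1n.
  have hv : fnorm v <= d%:R * `|v^T|.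
    apply: le_trans (fnorm_le_norm _) _; rewrite muln1 ler_wpM2l//.
    rewrite [leLHS]/Num.norm/= mx_normrE; apply/bigmax_leP; split=> // -[r s] _ /=.
    by have := le_coord_norm v^T s r; rewrite mxE.
  apply: le_trans h.
  have h2 : fnorm f * fnorm v <= (d%:R * `|f|) * (d%:R * `|v^T|).
    by apply: ler_pM; rewrite ?fnorm_ge0.
  have -> : i.+1%:R^-1 / d%:R ^+ 2 * fnorm f * (fnorm S * fnorm v) =
    i.+1%:R^-1 * fnorm S * ((fnorm f * fnorm v) / d%:R ^+ 2) by ring.
  have -> : `|f| * (`|v^T| * (i.+1%:R^-1 * fnorm S)) =
    i.+1%:R^-1 * fnorm S * (`|f| * `|v^T|) by ring.
  rewrite ler_pM2l ?mulr_gt0// ler_pdivrMr ?exprn_gt0//; apply: le_trans h2 _.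
  rewrite le_eqVlt; apply/orP; left; apply/eqP; ring.
have le1 (f : 'rV[R]_d) : f != 0 ->
    i.+1%:R^-1 / d%:R ^+ 2 * fnorm f * (fnorm S * fnorm v) <= fnorm (f *m (S *m v)) ->
    i.+1%:R^-1 / d%:R ^+ 2 * fnorm f * fnorm (S *m v) <= fnorm (f *m (S *m v)).
  move=> f0; apply: le_trans; rewrite ler_wpM2l ?fnormM//.
  by rewrite !mulr_ge0 ?fnorm_ge0 ?invr_ge0 ?exprn_ge0// ltW.
split; last by split; apply: le1 => //; exact: scale.
move=> Sv0; have := scale f1 f10 t1; rewrite Sv0 mulmx0 fnorm0 leNgt => /negP; apply.
by rewrite !mulr_gt0 ?fnorm_gt0 ?invr_gt0 ?exprn_gt0 ?ltr0n//; exact/eqP.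
Qed.

Hypothesis word_neq0 : forall r, pr mu [set x : mseq | word x 0 r = 0] = 0.

(** The last [r] letters of the word are revealed first; a rotation presents them as the first
    letters of [z]. They have a nonzero column, which the preceding [n] letters then make
    transversal. The pair [(n, j)] depends on the revealed letters, and a pigeonhole over the [N]
    pairs fixes it. *)
Lemma transversal_column : exists (i : nat) (k q : R), 0 < k /\ 0 < q /\
  forall (r : nat) (f1 f2 : 'rV[R]_d), (0 < r)%N -> f1 != 0 -> f2 != 0 ->
  exists n j, (n <= i)%N /\
    q <= pr mu [set x : mseq | transversal_vec k f1 f2 (col j (word x 0 (n + r)))].
Proof.
have [i [k [q [k0 [q0 h]]]]] := transversal_vec_uniform.
pose N : R := (i.+1 * d)%:R; have N0 : 0 < N by rewrite ltr0n muln_gt0.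
exists i, k, (q / N); do 2 (split; first by rewrite ?divr_gt0).
move=> r f1 f2 r0 f10 f20.
pose E (p : 'I_i.+1 * 'I_d) := [set z : mseq |
  transversal_vec k f1 f2 (word z r p.1 *m col p.2 (word z 0 r))].
have mE p : measurable (E p).
  by apply: mset_transversal_vec; apply: mmx_mul; [exact: mmx_word|apply: mmx_col; exact: mmx_word].
pose A := [set x : mseq | ~ word x 0 r = 0].
have mA0 : measurable [set x : mseq | word x 0 r = 0] by apply: mset_mx_eq0; exact: mmx_word.
have mA : measurable A by exact: mset_not.
have prA : pr mu A = 1 by rewrite (prC _ mA0) word_neq0 subr0.
have sum_ge : q <= \sum_p pr mu (E p).
  rewrite -[q]mulr1 -prA; apply: (pr_concat_ge Hmu (t := r)) => //; first exact: ltW.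
  move=> x /eqP x0; have [j hj] := nz_col x0.
  have [n [ni hn]] := h _ _ _ f10 f20 hj.
  rewrite (bigD1 (Ordinal (ni : (n < i.+1)%N), j))//=.
  apply: le_trans hn _; apply: ler_wpDr; first by apply: sumr_ge0 => p _; exact: pr_ge0.
  rewrite le_eqVlt; apply/orP; left; apply/eqP; congr (pr mu _).
  rewrite predeqE => y; rewrite /E/= (@word_concat_prefix _ _ r x y 0 r)//.
  by have := word_concat_suffix r x y 0 n; rewrite addn0 => ->.
have [[n j] hp] : exists p, q / N <= pr mu (E p).
  apply: contrapT => hn; move: sum_ge; apply/negP; rewrite -ltNge.
  have lt p : pr mu (E p) < q / N.
    by rewrite ltNge; apply/negP => hp; apply: hn; exists p.
  apply: (@lt_le_trans _ _ (\sum_(p : 'I_i.+1 * 'I_d) q / N)).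
    apply: ltr_sum => //; apply/hasP; exists (ord0, ord0) => //.
  by rewrite sumr_const card_prod !card_ord -/N -mulr_natr -/N divfK// gt_eqF.
exists n, j; split; first by have := ltn_ord n.
have nr0 : (0 < n + r)%N by rewrite ltn_addl.
apply: le_trans hp _; rewrite -(pr_relabel Hmu (cyc_inj (k := n) nr0))//.
rewrite le_eqVlt; apply/orP; left; apply/eqP; congr (pr mu _).
rewrite predeqE => z; rewrite /E/=.
rewrite (@word_cyc_low _ _ (n + r) n z 0 r) ?addn0//.
rewrite (@word_cyc_high _ _ (n + r) n z r n) ?leq_addr//; last by rewrite addnC.
by rewrite subnn -col_mulmx word_cat add0n.
Qed.

(** The row through an entry of largest modulus carries a fixed proportion of [fnorm Y], so one
    functional stands for the whole matrix. For [Y = 0] any nonzero functional serves. *)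
Lemma colgood_of_row (Y : 'M[R]_d) : exists2 f : 'rV[R]_d, f != 0 &
  forall (k : R) (S : 'M[R]_d), 0 <= k ->
    (forall j, k * fnorm f * fnorm (col j S) <= fnorm (f *m col j S)) ->
    colgood (k / (d * d)%:R) Y S.
Proof.
have [->|Y0] := eqVneq Y 0.
  exists (const_mx 1); last first.
    by move=> k S k0 _ j; rewrite fnorm0 mulr0 mul0r fnorm_ge0.
  by apply/eqP => /matrixP/(_ 0 0); rewrite !mxE => /eqP; rewrite oner_eq0.
have [p hp] : exists p : 'I_d * 'I_d, `|Y| = `|Y p.1 p.2|.
  have -> : `|Y| = \big[Num.max/0]_p `|Y p.1 p.2| by rewrite [LHS]/Num.norm/= mx_normrE.
  have [//|//|p _ ->] := @eq_bigmax _ _ _ 0 (ord0, ord0) xpredT (fun p : 'I_d * 'I_d => `|Y p.1 p.2|).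
  by exists p.
have hY : fnorm Y <= (d * d)%:R * fnorm (row p.1 Y).
  apply: le_trans (fnorm_le_norm _) _; rewrite ler_wpM2l// hp.
  by have := le_coord_fnorm (row p.1 Y) 0 p.2; rewrite mxE.
exists (row p.1 Y).
  rewrite -fnorm_gt0 -(pmulr_rgt0 _ (_ : 0 < (d * d)%:R :> R)) ?ltr0n ?muln_gt0//.
  by apply: lt_le_trans hY; rewrite fnorm_gt0.
move=> k S k0 h j; have hj := h j.
have e1 : fnorm (row p.1 Y *m col j S) <= fnorm (Y *m col j S).
  by rewrite -row_mul fnorm_row_le.
apply: le_trans e1; apply: le_trans hj; rewrite ler_wpM2r ?fnorm_ge0//.
by rewrite -mulrA ler_wpM2l// ler_pdivrMl ?ltr0n ?muln_gt0.
Qed.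

Variables (a C beta : R).
Hypotheses (a_gt0 : 0 < a) (beta_gt0 : 0 < beta) (C_ge0 : 0 <= C).
Hypothesis stable_pairs : forall r r', (r <= r')%N ->
  pr mu [set x : mseq | ~ colclose (2 * expR (- (a * r%:R))) (word x 0 r) (word x 0 r')]
    <= C * expR (- (beta * r%:R)).

(** One transversal column at a bounded length is enough: stability of directions carries it to all
    columns of all longer words. *)
Lemma non_concentration : exists (delta c : R) (l0 : nat), 0 < delta <= 1 /\ 0 < c /\
  forall l, (l0 <= l)%N -> forall Y1 Y2 : 'M[R]_d,
  c <= pr mu [set x | colgood delta Y1 (word x 0 l) /\ colgood delta Y2 (word x 0 l)].
Proof.
have [i [k [q [k0 [q0 h]]]]] := transversal_column.
have [r1 hr1] := expR_small a_gt0 (divr_gt0 k0 (ltr0Sn R 3)).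
have Cq : 0 < q / (2 * (C + 1)) by rewrite divr_gt0// mulr_gt0// ltr_wpDl.
have [r2 hr2] := expR_small beta_gt0 Cq.
(* [r] is so large that directions at length at least [r] drift by at most [k / 2], outside an event
   of probability [q / 2]; half of each constant survives. *)
pose r := (maxn r1 r2).+1.
have r1r n : (r1 <= n + r)%N by rewrite (leq_trans (leq_maxl r1 r2))// /r addnS leqW// leq_addl.
have r2r n : (r2 <= n + r)%N by rewrite (leq_trans (leq_maxr r1 r2))// /r addnS leqW// leq_addl.
pose dd : R := (d * d)%:R.
have dd0 : 0 < dd by rewrite ltr0n muln_gt0.
exists (Num.min 1 (k / 2 / dd)), (q / 2), (i + r)%N.
split; first by rewrite lt_min ltr01 !divr_gt0// ge_min lexx.
split; first by rewrite divr_gt0.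
move=> l il Y1 Y2.
have [f1 f10 hf1] := colgood_of_row Y1; have [f2 f20 hf2] := colgood_of_row Y2.
have [n [j [ni hn]]] := h r f1 f2 isT f10 f20.
have nl : (n + r <= l)%N by rewrite (leq_trans _ il)// leq_add2r.
have mE : measurable [set x : mseq | transversal_vec k f1 f2 (col j (word x 0 (n + r)))].
  by apply: mset_transversal_vec; apply: mmx_col; exact: mmx_word.
have mF : measurable [set x : mseq |
    ~ colclose (2 * expR (- (a * (n + r)%:R))) (word x 0 (n + r)) (word x 0 l)].
  by apply: mset_not; apply: mset_colclose; exact: mmx_word.
have pF : pr mu [set x : mseq |
    ~ colclose (2 * expR (- (a * (n + r)%:R))) (word x 0 (n + r)) (word x 0 l)] <= q / 2.
  apply: le_trans (stable_pairs nl) _.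
  have e1 : expR (- (beta * (n + r)%:R)) <= q / (2 * (C + 1)).
    exact: hr2.
  have C1 : 0 < C + 1 by rewrite ltr_wpDl.
  apply: (@le_trans _ _ ((C + 1) * (q / (2 * (C + 1))))).
    by apply: ler_pM => //; rewrite ?expR_ge0// lerDl.
  by rewrite le_eqVlt; apply/orP; left; apply/eqP; field; rewrite gt_eqF.
suff : q <= pr mu [set x | colgood (Num.min 1 (k / 2 / dd)) Y1 (word x 0 l) /\
     colgood (Num.min 1 (k / 2 / dd)) Y2 (word x 0 l)] + q / 2 by lra.
apply: le_trans hn _; apply: le_trans (lerD (lexx _) pF); apply: prU => //.
  by apply: mset_and; apply: mset_colgood; (exact: mmx_cst || exact: mmx_word).
move=> x /= [/eqP u0 [t1 t2]].
have [cc|cc] := pselect (colclose (2 * expR (- (a * (n + r)%:R))) (word x 0 (n + r)) (word x 0 l));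
  last by right.
left; set u := col j _ in u0 t1 t2.
have ek : 2 * expR (- (a * (n + r)%:R)) <= k / 2.
  have : expR (- (a * (n + r)%:R)) <= k / 4 by exact: hr1.
  lra.
have key (f : 'rV[R]_d) : k * fnorm f * fnorm u <= fnorm (f *m u) ->
    forall b, k / 2 * fnorm f * fnorm (col b (word x 0 l)) <= fnorm (f *m col b (word x 0 l)).
  move=> hf b; set w := col b _.
  have [->|w0] := eqVneq w 0; first by rewrite fnorm0 mulr0 fnorm_ge0.
  have uw : pdist u w <= k / 2 by apply: le_trans ek; apply: ltW; exact: cc.
  have lip := pdist_lip f u0 w0.
  have nu : 0 < fnorm u by rewrite fnorm_gt0.
  have h1 := ler_wpM2r (fnorm_ge0 w) hf.
  have h2 := ler_wpM2l (fnorm_ge0 f) uw.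
  have h3 := ler_wpM2r (mulr_ge0 (ltW nu) (fnorm_ge0 w)) h2.
  rewrite -(ler_pM2r nu); move: lip h1 h3.
  move: (fnorm (f *m u)) (fnorm (f *m w)) (fnorm u) (fnorm w) (fnorm f) (pdist u w).
  by move=> A B U W F p l1 l2 l3; lra.
have k20 : 0 <= k / 2 by rewrite divr_ge0// ltW.
by split; apply: colgood_le (_ : _ <= k / 2 / dd) _; rewrite ?ge_min ?lexx ?orbT//;
  [apply: hf1|apply: hf2] => //; exact: key.
Qed.

End NonConcentration.

(** * Measurability of the spectral event *)

Section Projection.
Context {R : realType} {dT : measure_display} {T : measurableType dT} {N : nat}.
Local Notation V := 'rV[R]_N.

Definition caratheodory (F : T -> V -> R) : Prop :=
  (forall x, measurable_fun setT (fun w => F w x)) /\ (forall w, continuous (F w)).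

Lemma caratheodory_param (f : T -> R) : measurable_fun setT f ->
  caratheodory (fun w _ => f w).
Proof. by move=> mf; split=> [_//|w x]; exact: cst_continuous. Qed.

Lemma caratheodory_cst (c : R) : caratheodory (fun _ _ => c).
Proof. exact: caratheodory_param. Qed.

Lemma caratheodory_coord j : caratheodory (fun _ x => x 0 j).
Proof. by split=> [x|w]; [exact: measurable_cst|exact: coord_continuous]. Qed.

Lemma caratheodoryD F G : caratheodory F -> caratheodory G ->
  caratheodory (fun w x => F w x + G w x).
Proof.
move=> [mF cF] [mG cG]; split=> [x|w x]; first exact: measurable_funD.
by apply: continuousD; [exact: cF|exact: cG].
Qed.

Lemma caratheodoryM F G : caratheodory F -> caratheodory G ->
  caratheodory (fun w x => F w x * G w x).
Proof.
move=> [mF cF] [mG cG]; split=> [x|w x]; first exact: measurable_funM.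
by apply: continuousM; [exact: cF|exact: cG].
Qed.

Lemma caratheodoryB F G : caratheodory F -> caratheodory G ->
  caratheodory (fun w x => F w x - G w x).
Proof.
move=> [mF cF] [mG cG]; split=> [x|w x]; first exact: measurable_funB.
by apply: continuousB; [exact: cF|exact: cG].
Qed.

Lemma caratheodory_max F G : caratheodory F -> caratheodory G ->
  caratheodory (fun w x => Num.max (F w x) (G w x)).
Proof.
move=> [mF cF] [mG cG]; split=> [x|w x]; first exact: measurable_maxr.
by apply: continuous_max; [exact: cF|exact: cG].
Qed.

Lemma caratheodory_sqrt F : caratheodory F ->
  caratheodory (fun w x => Num.sqrt (F w x)).
Proof.
move=> [mF cF]; split=> [x|w x]; first exact: measurable_sqrt.
by apply: continuous_comp; [exact: cF|exact: sqrt_continuous].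
Qed.

Lemma caratheodory_sum (I : Type) (r : seq I) (D : pred I) (F : I -> T -> V -> R) :
  (forall i, caratheodory (F i)) ->
  caratheodory (fun w x => \sum_(i <- r | D i) F i w x).
Proof.
move=> cF; elim: r => [|i r IH].
  by under eq_fun do under eq_fun do rewrite big_nil; exact: caratheodory_cst.
under eq_fun do under eq_fun do rewrite big_cons.
by case: (D i) => //; exact: caratheodoryD.
Qed.

(** One inequality on a function measurable in the parameter and continuous in the point. The format
    is stable under conjunction, by taking maxima, and its projection to the parameter is
    measurable. *)
Definition closed_condition (A : T -> V -> Prop) : Prop :=
  exists2 F, caratheodory F & forall w x, A w x <-> F w x <= 0.

Lemma closed_condition_le F G : caratheodory F -> caratheodory G ->
  closed_condition (fun w x => F w x <= G w x).
Proof.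
move=> cF cG; exists (fun w x => F w x - G w x); first exact: caratheodoryB.
by move=> w x; rewrite subr_le0.
Qed.

Lemma closed_condition_and A B : closed_condition A -> closed_condition B ->
  closed_condition (fun w x => A w x /\ B w x).
Proof.
move=> [F cF AF] [G cG BG]; exists (fun w x => Num.max (F w x) (G w x)).
  exact: caratheodory_max.
by move=> w x; rewrite ge_max AF BG; split=> [[-> ->]|/andP[]].
Qed.

Lemma closed_condition_eq F G : caratheodory F -> caratheodory G ->
  closed_condition (fun w x => F w x = G w x).
Proof.
move=> cF cG.
have [H cH HE] := closed_condition_and (closed_condition_le cF cG) (closed_condition_le cG cF).
exists H => // w x; rewrite -HE; split; first by move=> ->.
by move=> [FG GF]; apply/le_anti; rewrite FG GF.
Qed.

Lemma closed_condition_forall_ord n (A : 'I_n -> T -> V -> Prop) :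
  (forall i, closed_condition (A i)) -> closed_condition (fun w x => forall i, A i w x).
Proof.
elim: n A => [|n IH] A cA.
  exists (fun _ _ => 0); first exact: caratheodory_cst.
  by move=> w x; split=> // _ [].
have [F cF FE] := closed_condition_and (cA ord0) (IH _ (fun i => cA (lift ord0 i))).
exists F => // w x; rewrite -FE; split; first by move=> h; split.
by move=> [h0 h] i; case: (unliftP ord0 i) => [j|] ->.
Qed.

Lemma norm_rat_dense (x : V) (e : R) : 0 < e ->
  exists Q : 'rV[rat]_N, `|x - map_mx ratr Q| < e.
Proof.
move=> e0; have h j : exists q : rat, `|x 0 j - ratr q| < e.
  have [|q] := @rat_in_itvoo R (x 0 j - e) (x 0 j + e); first lra.
  rewrite in_itv/= => /andP[q1 q2]; exists q; rewrite ltr_norml; apply/andP; split; lra.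
exists (\row_j projT1 (cid (h j))).
rewrite [ltLHS]/Num.norm/= mx_normrE; apply/bigmax_ltP; split=> // -[i j] _ /=.
by rewrite !mxE ord1; exact: (projT2 (cid (h j))).
Qed.

(* A compactness argument on each ball reduces the quantifier to rational points. *)
Lemma mset_exists_closed A : closed_condition A -> measurable [set w | exists x, A w x].
Proof.
move=> [F [mF cF] AF].
rewrite (_ : mkset _ = [set w | exists M : nat, forall n : nat,
    exists Q : 'rV[rat]_N, `|map_mx ratr Q : V| <= M%:R /\ F w (map_mx ratr Q) < n.+1%:R^-1]).
  apply: mset_exists_countable => M; apply: mset_forall_countable => n.
  apply: mset_exists_countable => Q; apply: mset_and; first exact: mset_const.
  by apply: mset_lt => //; exact: measurable_cst.
rewrite predeqE => w; split=> [[x /AF Fx]|[M h]].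
  (* One unit for rounding [|x|] up and one for the distance to the rational point. *)
  exists (Num.truncn `|x|).+2 => n.
  have n0 : 0 < n.+1%:R^-1 :> R by rewrite invr_gt0 ltr0n.
  have /nbhs_ballP[e /= e0 he] : \forall y \near x, F w y < n.+1%:R^-1.
    have := cF w x; move=> /cvgr_lt; apply; exact: le_lt_trans Fx n0.
  have e1 : 0 < Num.min e 1 by rewrite lt_min e0 ltr01.
  have [Q] := norm_rat_dense x e1; rewrite lt_min => /andP[Qe Q1].
  exists Q; split; last by apply: he; rewrite /= mx_norm_ball.
  have -> : (map_mx ratr Q : V) = x - (x - map_mx ratr Q) by rewrite subKr.
  apply: le_trans (ler_normB _ _) _; rewrite -natr1; apply: lerD; last exact: ltW.
  exact/ltW/truncnS_gt.
pose K := [set v : V | `|v| <= M%:R].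
have cK : compact K.
  apply: bounded_closed_compact.
    exists M%:R; split => // L ML v /= /le_trans; apply; exact: ltW.
  apply: (@preimage_closed _ _ (Num.norm : V -> R) [set x | x <= M%:R]).
    by move=> x _; exact: norm_continuous.
  exact: closed_le.
(* The minimum of [F w] over the ball is below every [n.+1%:R^-1], hence at most 0, and it is
   attained. *)
have [||x xK minx] := EVT_min_rV _ cK (f := F w).
- by have [Q [QM _]] := h 0%N; exists (map_mx ratr Q).
- by apply: continuous_subspaceT => x; exact: cF.
exists x; apply/AF; rewrite leNgt; apply/negP => F0.
have [Q [QM FQ]] := h (Num.truncn (F w x)^-1).
have : (F w x)^-1 < (Num.truncn (F w x)^-1).+1%:R := truncnS_gt _.
rewrite -ltf_pV2 ?posrE ?invr_gt0 ?ltr0n// invrK => lt.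
have /(_ (mem_set _)) := minx (map_mx ratr Q); rewrite leNgt => /(_ QM) /negP; apply.
exact: lt_trans FQ lt.
Qed.

End Projection.

Section ComplexCaratheodory.
Context {R : realType} {dT : measure_display} {T : measurableType dT} {N : nat}.
Local Notation V := 'rV[R]_N.
Local Notation C := (complex.complex R).
Implicit Types F G : T -> V -> C.

Definition ccaratheodory F : Prop :=
  caratheodory (fun w x => complex.Re (F w x)) /\ caratheodory (fun w x => complex.Im (F w x)).

Lemma ccaratheodoryM F G : ccaratheodory F -> ccaratheodory G ->
  ccaratheodory (fun w x => F w x * G w x).
Proof.
move=> [rF iF] [rG iG].
have ReM (a b : C) : complex.Re (a * b) =
  complex.Re a * complex.Re b - complex.Im a * complex.Im b by case: a; case: b.
have ImM (a b : C) : complex.Im (a * b) =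
  complex.Re a * complex.Im b + complex.Im a * complex.Re b by case: a; case: b.
split.
  under eq_fun do under eq_fun do rewrite ReM.
  by apply: caratheodoryB; exact: caratheodoryM.
under eq_fun do under eq_fun do rewrite ImM.
by apply: caratheodoryD; exact: caratheodoryM.
Qed.

Lemma ccaratheodory_prod (I : Type) (r : seq I) (F : I -> T -> V -> C) :
  (forall i, ccaratheodory (F i)) -> ccaratheodory (fun w x => \prod_(i <- r) F i w x).
Proof.
move=> cF; elim: r => [|i r IH].
  have -> : (fun w x => \prod_(i <- [::]) F i w x) = fun _ _ => 1.
    by apply/funext => w; apply/funext => x; rewrite big_nil.
  by split; exact: caratheodory_cst.
have -> : (fun w x => \prod_(j <- i :: r) F j w x) = fun w x => F i w x * \prod_(j <- r) F j w x.
  by apply/funext => w; apply/funext => x; rewrite big_cons.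
exact: ccaratheodoryM.
Qed.

Lemma caratheodory_normc F : ccaratheodory F ->
  caratheodory (fun w x => ComplexField.Normc.normc (F w x)).
Proof.
move=> [rF iF].
have nE (z : C) : ComplexField.Normc.normc z =
    Num.sqrt (complex.Re z * complex.Re z + complex.Im z * complex.Im z).
  by case: z => a b; rewrite /= !expr2.
under eq_fun do under eq_fun do rewrite nE.
by apply: caratheodory_sqrt; apply: caratheodoryD; exact: caratheodoryM.
Qed.

Lemma closed_condition_ceq F G : ccaratheodory F -> ccaratheodory G ->
  closed_condition (fun w x => F w x = G w x).
Proof.
move=> [rF iF] [rG iG].
have [H cH HE] := closed_condition_and (closed_condition_eq rF rG) (closed_condition_eq iF iG).
exists H => // w x; rewrite -HE; split=> [->//|].
by case: (F w x) (G w x) => [a b] [a' b'] /= [-> ->].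
Qed.

End ComplexCaratheodory.

Section SortedSpectrum.
Context {R : realType} {n : nat}.
Local Notation C := (complex.complex R).
Local Notation d := n.+2.
Local Notation normc := ComplexField.Normc.normc.

(* The interpolation points make the equality of the characteristic polynomial
   with the product a finite system of equations. *)
Definition sorted_spectrum (g : 'M[R]_d) (z : 'I_d -> C) : Prop :=
  [/\ forall t : 'I_d.+1, \prod_j (t%:R - z j) = Complex (\det (t%:R%:M - g)) 0,
      normc (z (lift ord0 ord0)) <= normc (z ord0) &
      forall j : 'I_n, normc (z (lift ord0 (lift ord0 j))) <= normc (z (lift ord0 ord0))].

Lemma horner_char_poly_toC (g : 'M[R]_d) (t : nat) :
  (char_poly (toC g)).[t%:R] = Complex (\det (t%:R%:M - g)) 0.
Proof.
have -> : Complex (\det (t%:R%:M - g)) 0 = real_complex R (\det (t%:R%:M - g)) by [].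
rewrite -det_map_mx -[LHS]/(horner_eval t%:R _) -det_map_mx; congr (\det _).
apply/matrixP => i j; rewrite !mxE/= /horner_eval hornerD hornerN hornerMn hornerX hornerC.
by rewrite rmorphB rmorphMn/= rmorph_nat.
Qed.

Lemma sorted_spectrumP g z : sorted_spectrum g z ->
  char_poly (toC g) = \prod_(u <- [:: z ord0, z (lift ord0 ord0) &
    [seq z (lift ord0 (lift ord0 j)) | j <- index_enum 'I_n]]) ('X - u%:P) /\
  rho 1 g = normc (z ord0) /\ rho 2 g = normc (z (lift ord0 ord0)).
Proof.
move=> [zE z10 zs].
have pE : char_poly (toC g) = \prod_(u <- [:: z ord0, z (lift ord0 ord0) &
    [seq z (lift ord0 (lift ord0 j)) | j <- index_enum 'I_n]]) ('X - u%:P).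
  have -> : \prod_(u <- [:: z ord0, z (lift ord0 ord0) &
      [seq z (lift ord0 (lift ord0 j)) | j <- index_enum 'I_n]]) ('X - u%:P) =
      \prod_j ('X - (z j)%:P).
    by rewrite !big_cons big_map [RHS]big_ord_recl [in RHS]big_ord_recl.
  set q := \prod_j _; apply/eqP; rewrite -subr_eq0; apply/eqP.
  have sq : size q = d.+1 by rewrite size_prod_XsubC -[index_enum _]enumT size_enum_ord.
  apply: (@roots_geq_poly_eq0 _ _ [seq (t : nat)%:R : C | t <- iota 0 d.+1]).
  - apply/allP => u /mapP[t]; rewrite mem_iota add0n => /= td -> {u}.
    rewrite /root hornerD hornerN horner_char_poly_toC -(zE (Ordinal td)) horner_prod.
    by under [X in _ - X]eq_bigr do rewrite hornerXsubC; rewrite subrr.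
  - by rewrite map_inj_uniq ?iota_uniq// => a b /eqP; rewrite eqr_nat => /eqP.
  - rewrite size_map size_iota.
    apply/leq_sizeP => i di; rewrite coefB !nth_default ?subrr ?sq//.
    by rewrite size_char_poly.
split=> //; apply: rho_spectrum pE _ _ => // u /mapP[j _ ->]; exact: zs.
Qed.

Lemma sorted_spectrum_exists g : exists z, sorted_spectrum g z.
Proof.
have [z1 [z2 [s [cE _ _ z21 sz2]]]] := spectrum_sorted g.
have ss := size_spectrum cE.
exists (fun j => nth 0 [:: z1, z2 & s] j); split=> //.
- move: cE ss; move: [:: z1, z2 & s] => ps cE ss t.
  rewrite -horner_char_poly_toC cE horner_prod [RHS](big_nth 0) ss big_mkord.
  by apply: eq_bigr => j _; rewrite hornerXsubC.
- by move=> j /=; apply: sz2; rewrite mem_nth//; have := ltn_ord j; case: ss => ->.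
Qed.

End SortedSpectrum.

Section MeasurableSpectrum.
Context {R : realType} {n : nat} {dT : measure_display} {T : measurableType dT}.
Local Notation C := (complex.complex R).
Local Notation d := n.+2.
Local Notation normc := ComplexField.Normc.normc.
Local Notation V := 'rV[R]_(d + d + d).
Variables (g : T -> 'M[R]_d) (l : T -> 'cV[R]_d).
Hypotheses (mg : mmx g) (ml : mmx l) (l_neq0 : forall w, l w != 0).

(** A point of [V] encodes the real parts of [d] candidate eigenvalues, then their imaginary parts,
    then a candidate eigenvector. *)
Definition root_coord (x : V) (j : 'I_d) : C :=
  Complex (x 0 (lshift d (lshift d j))) (x 0 (lshift d (rshift d j))).

Definition vec_coord (x : V) : 'cV[R]_d := \col_j x 0 (rshift (d + d) j).

Lemma coords_exist (z : 'I_d -> C) (v : 'cV[R]_d) :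
  exists x, root_coord x = z /\ vec_coord x = v.
Proof.
exists (row_mx (row_mx (\row_j complex.Re (z j)) (\row_j complex.Im (z j))) v^T).
split; first by apply/funext => j; rewrite /root_coord !row_mxEl row_mxEr !mxE; case: (z j).
by apply/matrixP => i j; rewrite [LHS]mxE row_mxEr mxE ord1.
Qed.

Lemma ccaratheodory_root j : ccaratheodory (fun (_ : T) x => root_coord x j).
Proof. by split; exact: caratheodory_coord. Qed.

Lemma caratheodory_vec j : caratheodory (fun (_ : T) x => vec_coord x j 0).
Proof.
under eq_fun do under eq_fun do rewrite mxE.
exact: caratheodory_coord.
Qed.

Lemma closed_condition_spectrum :
  closed_condition (fun w x => sorted_spectrum (g w) (root_coord x)).
Proof.
have c1 := caratheodory_normc (ccaratheodory_root _).
have [F cF FE] : closed_condition (fun w (x : V) =>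
    (forall t : 'I_d.+1, \prod_j (t%:R - root_coord x j) = Complex (\det (t%:R%:M - g w)) 0) /\
    (normc (root_coord x (lift ord0 ord0)) <= normc (root_coord x ord0) /\
     forall j : 'I_n, normc (root_coord x (lift ord0 (lift ord0 j))) <=
       normc (root_coord x (lift ord0 ord0)))).
  apply: closed_condition_and; [|apply: closed_condition_and].
  - apply: closed_condition_forall_ord => t; apply: closed_condition_ceq.
      apply: ccaratheodory_prod => j; have [cr ci] := ccaratheodory_root j.
      have tE : t%:R = Complex t%:R 0 :> C by rewrite -(rmorph_nat (real_complex R)).
      split; under eq_fun do under eq_fun do rewrite tE/=.
        by apply: caratheodoryB; [exact: caratheodory_cst|].
      by apply: caratheodoryB; [exact: caratheodory_cst|].
    split => /=; last exact: caratheodory_cst.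
    by apply: caratheodory_param; apply: mmx_det; apply: mmx_sub => //; exact: mmx_cst.
  - exact: closed_condition_le.
  - by apply: closed_condition_forall_ord => j; exact: closed_condition_le.
by exists F => // w x; rewrite -FE; split=> [[]|[? []]].
Qed.

(** Every sorted spectrum has the same two leading moduli, so the comparison may be made on any one
    of them and the event becomes a projection. *)
Lemma mset_rho_ratio (a : R) : measurable [set w | a * rho 1 (g w) <= rho 2 (g w)].
Proof.
rewrite (_ : mkset _ = [set w | exists x : V, sorted_spectrum (g w) (root_coord x) /\
   a * normc (root_coord x ord0) <= normc (root_coord x (lift ord0 ord0))]).
  apply: mset_exists_closed; apply: closed_condition_and.
    exact: closed_condition_spectrum.
  apply: closed_condition_le; last exact: caratheodory_normc (ccaratheodory_root _).
  apply: caratheodoryM; first exact: caratheodory_cst.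
  exact: caratheodory_normc (ccaratheodory_root _).
rewrite predeqE => w; split=> [h|[x [/sorted_spectrumP[_ [r1 r2]]]]]; last first.
  by rewrite /= r1 r2.
have [z zs] := sorted_spectrum_exists (g w); have [x [xz _]] := coords_exist z 0.
have [_ [r1 r2]] := sorted_spectrumP zs.
by exists x; rewrite xz -r1 -r2.
Qed.

(** The remaining roots have modulus at most [rho 2 h], so an eigenvalue of modulus [rho 1 h] can
    only be the first root. *)
Lemma top_eigenvalue_unique (h : 'M[R]_d) z (v : 'cV[R]_d) (lam : R) :
  sorted_spectrum h z -> rho 2 h < rho 1 h -> v != 0 -> h *m v = lam *: v ->
  `|lam| = rho 1 h -> z ord0 = Complex lam 0.
Proof.
move=> zs r21 v0 hv lam1; have [cE [r1 r2]] := sorted_spectrumP zs.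
have : root (char_poly (toC h)) (Complex lam 0).
  rewrite -eigenvalue_root_char; have [x x0 hx] : exists2 x : 'rV[C]_d, x != 0 & x *m (toC h)^T = Complex lam 0 *: x.
    exists (toC v)^T; first by rewrite trmx_eq0 toC_eq0.
    by rewrite -trmx_mul -toCM hv toCZ linearZ.
  rewrite eigenvalue_root_char -char_poly_trmx -eigenvalue_root_char.
  by apply/eigenvalueP; exists x.
rewrite cE root_prod_XsubC !inE => /orP[/eqP //|h12]; exfalso.
have : `|lam| <= rho 2 h.
  rewrite -normc_real r2; move: h12 => /predU1P[->//|/mapP[j _ ->]].
  by case: zs => _ _; apply.
by rewrite lam1 leNgt r21.
Qed.

(** Vectors independent over the complex numbers would make the top eigenvalue occur again among the
    remaining roots, against the gap. Between real vectors the real part of the complex factor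
    suffices. *)
Lemma top_eigenline_unique (h : 'M[R]_d) (u v : 'cV[R]_d) (lam : R) :
  rho 2 h < rho 1 h -> u != 0 -> v != 0 -> h *m u = lam *: u -> h *m v = lam *: v ->
  `|lam| = rho 1 h -> exists2 c : R, c != 0 & v = c *: u.
Proof.
move=> r21 u0 v0 hu hv lam1; have [z zs] := sorted_spectrum_exists h.
have [cE [r1 r2]] := sorted_spectrumP zs.
have zl := top_eigenvalue_unique zs r21 u0 hu lam1.
have [c vc] : exists c : C, toC v = c *: toC u.
  apply: contrapT => nc.
  have u0' : toC u != 0 by rewrite toC_eq0.
  have hu' : toC h *m toC u = z ord0 *: toC u by rewrite -toCM hu toCZ zl.
  have hv' : toC h *m toC v = z ord0 *: toC v by rewrite -toCM hv toCZ zl.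
  have := second_eigenvalue u0' hu' hv' (fun c => introN eqP (fun e => nc (ex_intro _ c e))) cE.
  rewrite inE => h12.
  have : normc (z ord0) <= rho 2 h.
    rewrite r2; move: h12 => /predU1P[->//|/mapP[j _ ->]].
    by case: zs => _ _; apply.
  by rewrite -r1 leNgt r21.
have vE : v = complex.Re c *: u.
  apply/matrixP => i j; have /matrixP/(_ i j) := vc; rewrite !mxE.
  by case: (c) => a b /= [-> _]; rewrite mulr0 subr0.
exists (complex.Re c) => //; apply: contraNneq v0 => c0.
by rewrite vE c0 scale0r.
Qed.

(** [Eplus] is a choice and not visibly measurable. Outside the ratio event, [a <= 1] yields a
    strict gap, hence a unique top eigenline; the distance condition then holds for [Eplus] exactly
    when it holds for some unit top eigenvector, which is a projection. *)
Lemma mset_spectral_event (a : R) : a <= 1 -> 0 < a ->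
  measurable [set w | a * rho 1 (g w) <= rho 2 (g w) \/ a <= pdist (Eplus (g w)) (l w)].
Proof.
move=> a1 a0.
pose B (w : T) (x : V) := sorted_spectrum (g w) (root_coord x) /\
  (complex.Im (root_coord x ord0) = 0 /\ (\sum_i vec_coord x i 0 * vec_coord x i 0 = 1 /\
  ((forall i, \sum_j g w i j * vec_coord x j 0 = complex.Re (root_coord x ord0) * vec_coord x i 0) /\
   a * fnorm (l w) <= wedge_norm (vec_coord x) (l w)))).
have mB : measurable [set w | exists x, B w x].
  apply: mset_exists_closed; apply: closed_condition_and.
    exact: closed_condition_spectrum.
  have [rr ri] := ccaratheodory_root ord0.
  apply: closed_condition_and.
    by apply: closed_condition_eq => //; exact: caratheodory_cst.
  apply: closed_condition_and.
    apply: closed_condition_eq; last exact: caratheodory_cst.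
    by apply: caratheodory_sum => i; apply: caratheodoryM; exact: caratheodory_vec.
  apply: closed_condition_and.
    apply: closed_condition_forall_ord => i; apply: closed_condition_eq.
      apply: caratheodory_sum => j; apply: caratheodoryM; last exact: caratheodory_vec.
      by apply: caratheodory_param; exact: mg.
    by apply: caratheodoryM => //; exact: caratheodory_vec.
  apply: closed_condition_le.
    by apply: caratheodory_param; apply: measurable_funM => //; exact: mmx_fnorm.
  apply: caratheodory_sqrt; apply: caratheodory_sum => i; apply: caratheodory_sum => j.
  have cl k : caratheodory (fun w (_ : V) => l w k 0) by apply: caratheodory_param; exact: ml.
  under eq_fun do under eq_fun do rewrite expr2.
  by apply: caratheodoryM; apply: caratheodoryB; apply: caratheodoryM => //; exact: caratheodory_vec.
rewrite (_ : mkset _ = [set w | a * rho 1 (g w) <= rho 2 (g w) \/ exists x, B w x]).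
  by apply: mset_or => //; exact: mset_rho_ratio.
rewrite predeqE => w; have [h|/negP] := pselect (a * rho 1 (g w) <= rho 2 (g w)).
  by split=> _; left.
rewrite -ltNge => r2a; have r21 : rho 2 (g w) < rho 1 (g w).
  by apply: lt_le_trans r2a _; rewrite ler_piMl ?rho_ge0.
have nl : 0 < fnorm (l w) by rewrite fnorm_gt0.
split=> -[/le_lt_trans/(_ r2a)|h]; first by rewrite ltxx.
- right.
  (* Without a top eigenvector [Eplus] is the default 0, whose [pdist] to anything is 0 and so below
     [a]. *)
  have E0 : Eplus (g w) != 0.
    by apply: contraTneq h => ->; rewrite pdist0l -ltNge.
  have [_ [lam [gE lam1]]] : top_eigvec (g w) (Eplus (g w)).
    by move: E0; rewrite /Eplus; case: xgetP => [u -> //|_]; rewrite eqxx.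
  have [z zs] := sorted_spectrum_exists (g w).
  have zl := top_eigenvalue_unique zs r21 E0 gE lam1.
  set u := Eplus (g w) in h E0 gE; have nu : 0 < fnorm u by rewrite fnorm_gt0.
  have [x [xz xv]] := coords_exist z ((fnorm u)^-1 *: u).
  exists x; rewrite /B xz xv zl; split=> //; split=> //.
  have nv : fnorm ((fnorm u)^-1 *: u) = 1.
    by rewrite fnormZ ger0_norm ?invr_ge0 ?fnorm_ge0// mulVf// gt_eqF.
  split.
    under eq_bigr do rewrite -expr2.
    by rewrite -sqr_vnorm nv expr1n.
  split.
    move=> i; have /matrixP/(_ i 0) : g w *m ((fnorm u)^-1 *: u) = lam *: ((fnorm u)^-1 *: u).
      by rewrite -scalemxAr gE scalerA mulrC -scalerA.
    by rewrite mxE => ->; rewrite mxE.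
  have v0 : (fnorm u)^-1 *: u != 0 by rewrite -fnorm_gt0 nv.
  rewrite wedge_pdist// nv mul1r ler_pM2r// pdistZl// invr_eq0 gt_eqF//.
- by rewrite ltxx.
- move: h => [x [zs [im0 [v1 [gv wl]]]]]; right.
  set z := root_coord x in zs im0 gv; set v := vec_coord x in v1 gv wl.
  have nv : fnorm v = 1.
    apply/eqP; rewrite -(@eqrXn2 _ 2)// ?fnorm_ge0// expr1n sqr_vnorm -v1.
    by apply/eqP; apply: eq_bigr => i _; rewrite expr2.
  have v0 : v != 0 by rewrite -fnorm_gt0 nv.
  have zE : z ord0 = Complex (complex.Re (z ord0)) 0 by move: im0; case: (z ord0) => r i /= ->.
  have [_ [r1 _]] := sorted_spectrumP zs.
  have lam1 : `|complex.Re (z ord0)| = rho 1 (g w) by rewrite r1 zE normc_real.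
  have gvE : g w *m v = complex.Re (z ord0) *: v.
    by apply/matrixP => i j; rewrite ord1 [LHS]mxE gv [RHS]mxE.
  have tv : top_eigvec (g w) v by split=> //; exists (complex.Re (z ord0)).
  have [u0 [mu [gu mu1]]] : top_eigvec (g w) (Eplus (g w)) by exact: xgetPex (ex_intro _ v tv).
  have zl := top_eigenvalue_unique zs r21 u0 gu mu1.
  have [c c0 vE] : exists2 c : R, c != 0 & v = c *: Eplus (g w).
    by apply: (top_eigenline_unique r21 u0 v0 gu _ mu1); rewrite gvE zl.
  by rewrite -(pdistZl _ _ c0) -vE -(ler_pM2r nl) -[X in _ <= _ * X]mul1r -nv -wedge_pdist.
Qed.

Lemma mset_spectral_event_gt1 (a : R) : 1 < a ->
  [set w | a * rho 1 (g w) <= rho 2 (g w) \/ a <= pdist (Eplus (g w)) (l w)] =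
  [set w | a * rho 1 (g w) <= rho 2 (g w)].
Proof.
move=> a1; rewrite predeqE => w; split=> [[//|]|h]; last by left.
by move=> /(lt_le_trans a1); rewrite ltNge pdist_le1.
Qed.

End MeasurableSpectrum.

(** * Non-nilpotency from the minimal rank *)

Section RankAlgebra.
Context {F : fieldType}.

Lemma rank_mxsub m n p q (A : 'M[F]_(m, n)) (f : 'I_p -> 'I_m) (h : 'I_q -> 'I_n) :
  (\rank (mxsub f h A) <= \rank A)%N.
Proof.
have -> : mxsub f h A = rowsub f (colsub h A) by apply/matrixP => i j; rewrite !mxE.
apply: leq_trans (mxrankS (rowsub_sub _ _)) _.
rewrite -mxrank_tr -[leqRHS]mxrank_tr.
have -> : (colsub h A)^T = rowsub h A^T by apply/matrixP => i j; rewrite !mxE.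
exact/mxrankS/rowsub_sub.
Qed.

Lemma row_free_rowsub m n (A : 'M[F]_(m, n)) p : (p <= \rank A)%N ->
  exists f : 'I_p -> 'I_m, row_free (rowsub f A).
Proof.
move=> pA; exists (maxrankfun A \o widen_ord pA).
rewrite rowsub_comp; apply/row_freeP.
have /row_freeP[X AX] := maxrowsub_free A.
exists (X *m (\matrix_(i, j) (i == widen_ord pA j)%:R)).
rewrite mulmxA mul_rowsub_mx AX; apply/matrixP => i j.
rewrite !mxE (bigD1 (widen_ord pA i))//= !mxE eqxx mul1r big1 ?addr0//.
by move=> k; rewrite !mxE eq_sym => /negbTE ->; rewrite mul0r.
Qed.

(** The classical criterion by minors, which makes rank conditions measurable; indexing by finite
    functions keeps the family of minors countable. *)
Lemma rank_leP n (A : 'M[F]_n) r : reflect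
  (forall f h : {ffun 'I_r.+1 -> 'I_n}, \det (mxsub f h A) = 0) (\rank A <= r)%N.
Proof.
apply: (iffP idP) => [Ar f h|dA].
  apply/eqP; apply: contraTT Ar => d0; rewrite -ltnNge.
  have : mxsub f h A \in unitmx by rewrite unitmxE unitfE.
  rewrite -row_free_unit => /eqP <-; exact: rank_mxsub.
rewrite leqNgt; apply/negP => /row_free_rowsub[f fA].
have rT : (r.+1 <= \rank (rowsub f A)^T)%N by rewrite mxrank_tr (eqP fA).
have [h hA] := row_free_rowsub rT.
suff : \det (mxsub [ffun i => f i] [ffun i => h i] A) != 0 by rewrite dA eqxx.
rewrite -det_tr -unitfE -unitmxE -row_free_unit.
have -> // : (mxsub [ffun i => f i] [ffun i => h i] A)^T = rowsub h (rowsub f A)^T.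
by apply/matrixP => i j; rewrite !mxE !ffunE.
Qed.

End RankAlgebra.

Section Nilpotent.
Context {R : realType} {n : nat}.
Local Notation d := n.+2.

(** All roots vanish, so the characteristic polynomial is a power of the indeterminate and
    Cayley-Hamilton applies. *)
Lemma nilpotent_rho1_eq0 (g : 'M[R]_d) : rho 1 g = 0 -> g ^+ d = 0.
Proof.
have [z1 [z2 [s [cE -> _ z21 sz2]]]] := spectrum_sorted g => z10.
have z0 z : z \in [:: z1, z2 & s] -> z = 0.
  move=> zs; apply: ComplexField.Normc.eq0_normc; apply/eqP.
  rewrite eq_le normc_ge0 andbT -z10; move: zs; rewrite !inE.
  by move=> /predU1P[->//|/predU1P[->//|zs]]; exact: le_trans (sz2 _ zs) z21.
have {}cE : char_poly (toC g) = 'X^d.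
  rewrite cE -(size_spectrum cE) big_seq (eq_bigr (fun=> 'X)); last first.
    by move=> z /z0 ->; rewrite subr0.
  by rewrite -big_seq big_const_seq count_predT iter_mulr_1.
have gC0 : toC g ^+ d = 0.
  by have := Cayley_Hamilton (toC g); rewrite cE rmorphXn/= horner_mx_X.
apply/eqP; rewrite -toC_eq0; apply/eqP; rewrite -gC0.
exact: (rmorphXn (map_mx (real_complex R))).
Qed.

(** In an alternating product every two neighbours already have a product of rank [r], so by
    Frobenius a further factor loses no rank. *)
Lemma alternating_rho1_gt0 (A B : 'M[R]_d) r : (0 < r)%N ->
  (\rank A <= r)%N -> (\rank B <= r)%N -> (r <= \rank (A *m B))%N ->
  (r <= \rank (B *m A))%N -> 0 < rho 1 (A *m B).
Proof.
move=> r0 rA rB rAB rBA; rewrite lt_def rho_ge0 andbT.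
apply/eqP => /nilpotent_rho1_eq0 AB0.
have rA' : (r <= \rank A)%N by rewrite (leq_trans rAB)// mxrankM_maxl.
suff h k : (r <= \rank ((A *m B) ^+ k *m A))%N.
  by move: (h d); rewrite AB0 mul0mx mxrank0 leqNgt r0.
elim: k => [|k IH]; first by rewrite expr0 mul1mx.
have h1 : (r <= \rank ((A *m B) ^+ k.+1))%N.
  have := mxrank_Frobenius ((A *m B) ^+ k) A B.
  have -> : (A *m B) ^+ k *m A *m B = (A *m B) ^+ k.+1 by rewrite -mulmxA exprSr.
  move: (\rank _) (\rank _) (\rank _) (\rank _) IH rAB rA => ? ? ? ?; lia.
have := mxrank_Frobenius ((A *m B) ^+ k *m A) B A.
have -> : (A *m B) ^+ k *m A *m B = (A *m B) ^+ k.+1 by rewrite -mulmxA exprSr.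
move=> F1; rewrite -(leq_add2l r); apply: leq_trans (leq_add h1 rBA) _.
by apply: leq_trans F1 _; rewrite leq_add2r.
Qed.

End Nilpotent.

Section MinimalRank.
Context {R : realType} {n : nat}.
Local Notation d := n.+2.
Local Notation mseq := (@mseq R d).
Variable mu : probability mseq R.
Hypothesis Hmu : iid_law mu.
Hypothesis word_neq0 : forall r, pr mu [set x : mseq | word x 0 r = 0] = 0.

Lemma mset_rank_le (dT : measure_display) (T : measurableType dT) (X : T -> 'M[R]_d) r :
  mmx X -> measurable [set x | (\rank (X x) <= r)%N].
Proof.
move=> mX; rewrite (_ : mkset _ = [set x | forall f h : {ffun 'I_r.+1 -> 'I_d},
    \det (mxsub f h (X x)) = 0]).
  apply: mset_forall_countable => f; apply: mset_forall_countable => h.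
  by apply: mset_eq => //; apply: mmx_det; exact: mmx_mxsub.
by rewrite predeqE => x; split=> /rank_leP.
Qed.

Lemma mset_rank_gt (dT : measure_display) (T : measurableType dT) (X : T -> 'M[R]_d) r :
  mmx X -> measurable [set x | (r < \rank (X x))%N].
Proof.
move=> mX; rewrite (_ : mkset _ = [set x | ~ (\rank (X x) <= r)%N]).
  exact/mset_not/mset_rank_le.
by rewrite predeqE => x; split; rewrite /= ltnNge => /negP.
Qed.

Lemma minimal_rank : exists r n0 : nat, [/\ (0 < r)%N, (0 < n0)%N,
  0 < pr mu [set x : mseq | (\rank (word x 0 n0) <= r)%N] &
  forall k, pr mu [set x : mseq | (\rank (word x 0 k) < r)%N] = 0].
Proof.
pose Q r := `[< exists n0, 0 < pr mu [set x : mseq | (\rank (word x 0 n0) <= r)%N] >].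
have Qd : exists r, Q r.
  exists d; apply/asboolP; exists 0%N.
  rewrite (_ : mkset _ = setT) ?prT//.
  by rewrite predeqE => x; split=> // _ /=; exact: rank_leq_row.
case: (ex_minnP Qd) => r /asboolP[n0 hn0] minr.
have r0 : (0 < r)%N.
  case: r hn0 {minr} => // hn0; move: hn0.
  rewrite (_ : mkset _ = [set x | word x 0 n0 = 0]) ?word_neq0 ?ltxx//.
  by rewrite predeqE => x; rewrite /= leqn0 mxrank_eq0; split=> /eqP.
(* One more letter cannot raise the rank, and it makes the block length positive. *)
exists r, n0.+1; split=> //.
  apply: lt_le_trans hn0 _; apply: pr_le.
  - by apply: mset_rank_le; exact: mmx_word.
  - by apply: mset_rank_le; exact: mmx_word.
  move=> x /=; apply: leq_trans; rewrite -[n0.+1]addn1 word_cat; exact: mxrankM_maxl.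
move=> k; apply/eqP; rewrite eq_le pr_ge0 andbT leNgt; apply/negP => h.
have /minr : Q r.-1.
  apply/asboolP; exists k; apply: lt_le_trans h _; rewrite le_eqVlt.
  apply/orP; left; apply/eqP; congr (pr mu _); rewrite predeqE => x /=.
  by rewrite -[(_ <= r.-1)%N]ltnS prednK.
by rewrite leqNgt prednK// leqnn.
Qed.

Lemma rho1_positive : exists C beta : R, 0 < C /\ 0 < beta /\ forall k : nat, exists B,
  [/\ measurable B, pr mu B <= C * expR (- (beta * k%:R)) &
      forall x : mseq, ~ B x -> 0 < rho 1 (word x 0 k)].
Proof.
have [r [n0 [r0 n00 p0 minr]]] := minimal_rank.
set p := pr mu _ in p0.
have mR k : measurable [set x : mseq | (r < \rank (word x 0 k))%N].
  by apply: mset_rank_gt; exact: mmx_word.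
have p1 : p <= 1 by apply: pr_le1; apply: mset_rank_le; exact: mmx_word.
have prR1 : pr mu [set x : mseq | (r < \rank (word x 0 n0))%N] = 1 - p.
  rewrite -prC; last by apply: mset_rank_le; exact: mmx_word.
  by congr (pr mu _); rewrite predeqE => x; split; rewrite /= ltnNge => /negP.
(* A factor of a word has at least its rank, so rank above [r] requires each of [q] independent
   blocks of length [n0] to have rank above [r]. *)
have geo q s : pr mu [set x : mseq | (r < \rank (word x 0 (q * n0 + s)))%N] <= (1 - p) ^+ q.
  elim: q => [|q IH]; first by rewrite expr0 pr_le1.
  rewrite exprSr -[X in _ * X]prR1; apply: (pr_concat_le Hmu (t := n0)) => //.
  - move=> x y /=; rewrite mulSn -addnA word_cat add0n => /leq_trans; apply.
    by rewrite word_concat_prefix//; exact: mxrankM_maxl.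
  - move=> x _; apply: le_trans IH; apply: pr_le => //.
      exact: (@measurable_concat_section _ _ n0 [set z : mseq | (r < \rank (word z 0 (q.+1 * n0 + s)))%N]).
    move=> y /=; rewrite mulSn -addnA word_cat add0n => /leq_trans; apply.
    have -> : word (concat n0 x y) n0 (q * n0 + s) = word y 0 (q * n0 + s).
      by have := word_concat_suffix n0 x y 0 (q * n0 + s); rewrite addn0.
    exact: mxrankM_maxr.
  - by rewrite exprn_ge0// subr_ge0.
have tail : exists C beta : R, 0 < C /\ 0 < beta /\ forall k : nat,
    pr mu [set x : mseq | (r < \rank (word x 0 k))%N] <= C * expR (- (beta * k%:R)).
  have n0R : 0 < n0%:R :> R by rewrite ltr0n.
  (* From [1 - p <= expR (- p)]; rounding [k / n0] down loses at most one block, which costs the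
     factor [expR p]. *)
  exists (expR p), (p / n0%:R); split; first exact: expR_gt0.
  split; first exact: divr_gt0.
  move=> k; have := geo (k %/ n0)%N (k %% n0)%N; rewrite -divn_eq => /le_trans; apply.
  apply: (@le_trans _ _ (expR (- p) ^+ (k %/ n0))).
    by apply: lerXn2r; rewrite ?nnegrE ?subr_ge0 ?expR_ge0//; exact: expR_ge1Dx.
  rewrite -expRM_natl -expRD ler_expR.
  have : k%:R <= (k %/ n0).+1%:R * n0%:R :> R.
    by rewrite -natrM ler_nat ltnW// ltn_ceil.
  rewrite -ler_pdivrMr// -natr1 => h.
  have := ler_wpM2l (ltW p0) h; lra.
have [C [beta [C0 [b0 tailP]]]] := tail.
exists (2 * C * expR beta), (beta / 2); split; first by rewrite !mulr_gt0 ?expR_gt0.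
split; first by rewrite divr_gt0.
move=> k; pose h := k./2.
have hk : (h <= k)%N by rewrite /h; lia.
have [-> {hk}|k0] := posnP k.
  exists set0; split=> [//||x _]; first by rewrite /pr measure0 !mulr_ge0 ?expR_ge0// ltW.
  rewrite word0 lt_def rho_ge0 andbT; apply/eqP => /nilpotent_rho1_eq0 /eqP.
  by rewrite expr1n; apply/negP; exact: oner_neq0.
have low j : pr mu [set x : mseq | (\rank (word (relabel (cyc k j) x) 0 k) < r)%N] <= 0.
  have mL : measurable [set x : mseq | (\rank (word x 0 k) < r)%N].
    rewrite (_ : mkset _ = [set x : mseq | (\rank (word x 0 k) <= r.-1)%N]).
      by apply: mset_rank_le; exact: mmx_word.
    by rewrite predeqE => x; rewrite /= -[(_ <= r.-1)%N]ltnS prednK.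
  have := pr_relabel Hmu (cyc_inj (k := j) k0) mL.
  by rewrite minr => /= ->.
have mw j a b : mmx (fun x : mseq => word (relabel (cyc k j) x) a b).
  move=> i i'; apply: (measurableT_comp (mmx_word a b i i')).
  exact: measurable_relabel.
have mlow j : measurable [set x : mseq | (\rank (word (relabel (cyc k j) x) 0 k) < r)%N].
  rewrite (_ : mkset _ = [set x : mseq | (\rank (word (relabel (cyc k j) x) 0 k) <= r.-1)%N]).
    exact: mset_rank_le.
  by rewrite predeqE => x; rewrite /= -[(_ <= r.-1)%N]ltnS prednK.
have tailh j b : (h <= b)%N ->
    pr mu [set x : mseq | (r < \rank (word (relabel (cyc k j) x) 0 b))%N] <=
    C * expR beta * expR (- (beta / 2 * k%:R)).
  move=> hb; have := pr_relabel Hmu (cyc_inj (k := j) k0) (mR b) => /= ->.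
  apply: le_trans (tailP b) _; rewrite -mulrA ler_wpM2l ?(ltW C0)// -expRD ler_expR.
  have : k%:R <= (b.*2).+1%:R :> R by rewrite ler_nat /h in hb *; lia.
  rewrite -natr1 -muln2 natrM => kb; have := ler_wpM2l (ltW b0) kb; lra.
(* With [U] the first [h] letters and [V] the others, the two null events say that [U V] or [V U]
   has rank below [r], the other two that [U] or [V] has rank above [r]. After rotation by [h] the
   word [V] is a prefix, so the bounds for prefixes apply to it. *)
pose B := [set x : mseq | (\rank (word (relabel (cyc k 0) x) 0 k) < r)%N \/
  ((\rank (word (relabel (cyc k h) x) 0 k) < r)%N \/
  ((r < \rank (word (relabel (cyc k 0) x) 0 h))%N \/
   (r < \rank (word (relabel (cyc k h) x) 0 (k - h)))%N))].
have m1 := mlow 0%N; have m2 := mlow h.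
have m3 := mset_rank_gt r (mw 0%N 0%N h); have m4 := mset_rank_gt r (mw h 0%N (k - h)%N).
exists B; split.
- by do 3 (apply: mset_or => //).
- have kh : (h <= k - h)%N by rewrite /h; lia.
  have := pr_or m1 (mset_or m2 (mset_or m3 m4)) (low 0%N) (pr_or m2 (mset_or m3 m4) (low h)
    (pr_or m3 m4 (tailh _ _ (leqnn h)) (tailh _ _ kh))).
  rewrite -/B !add0r => /le_trans; apply.
  rewrite le_eqVlt; apply/orP; left; apply/eqP; ring.
move=> x /not_orP[/negP x1 /not_orP[/negP x2 /not_orP[/negP x3 /negP x4]]].
rewrite -!leqNgt word_cyc_low ?addn0 ?add0n// in x1 x2 x3 x4 *.
rewrite word_cyc_low ?addn0 ?add0n// in x3.
have kE : word x 0 k = word x 0 h *m word x h (k - h).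
  by rewrite -[X in word x X (k - h)%N]add0n -word_cat subnKC.
have kE' : word (relabel (cyc k h) x) 0 k = word x h (k - h) *m word x 0 h.
  rewrite -{2}(subnK hk) word_cat add0n word_cyc_low ?addn0; last by rewrite subnKC.
  rewrite word_cyc_high ?subnK//; last by rewrite subnKC.
  by rewrite subnKC// subnn.
rewrite kE; apply: (alternating_rho1_gt0 r0) => //.
- by move: x4; rewrite word_cyc_low ?addn0// subnKC.
- by rewrite -kE.
- by rewrite -kE'.
Qed.

End MinimalRank.

(** * Exponential decay *)

Section ExponentialDecay.
Context {R : realType}.
Implicit Types u v : nat -> R.

Definition exp_small u : Prop := exists C beta : R, 0 < C /\ 0 < beta /\
  forall n, u n <= C * expR (- (beta * n%:R)).

Lemma exp_small_expR b : 0 < b -> exp_small (fun n => expR (- (b * n%:R))).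
Proof. by move=> b0; exists 1, b; split=> //; split=> // n; rewrite mul1r. Qed.

Lemma exp_smallD u v : exp_small u -> exp_small v -> exp_small (fun n => u n + v n).
Proof.
move=> [C [b [C0 [b0 hu]]]] [D [c [D0 [c0 hv]]]].
exists (C + D), (Num.min b c); split; first exact: addr_gt0.
split=> [|n]; first by rewrite lt_min b0.
rewrite mulrDl; apply: lerD.
  apply: le_trans (hu n) _; rewrite ler_wpM2l ?(ltW C0)// ler_expR lerN2.
  by rewrite ler_wpM2r// ge_min lexx.
apply: le_trans (hv n) _; rewrite ler_wpM2l ?(ltW D0)// ler_expR lerN2.
by rewrite ler_wpM2r// ge_min lexx orbT.
Qed.

Lemma exp_smallZ u k : 0 <= k -> exp_small u -> exp_small (fun n => k * u n).
Proof.
move=> k0 [C [b [C0 [b0 hu]]]]; exists ((k + 1) * C), b.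
split; first by rewrite mulr_gt0// ltr_wpDl.
split=> // n; apply: le_trans (ler_wpM2l k0 (hu n)) _.
by rewrite mulrA ler_wpM2r ?expR_ge0// ler_wpM2r ?(ltW C0)// lerDl.
Qed.

(** Half of the exponent absorbs the linear factor, by [1 + x <= expR x]. *)
Lemma exp_small_succM u : exp_small u -> exp_small (fun n => n.+1%:R * u n).
Proof.
move=> [C [b [C0 [b0 hu]]]].
have b20 : 0 < b / 2 by rewrite divr_gt0.
exists ((b / 2)^-1 * expR (b / 2) * C), (b / 2).
split; first by rewrite !mulr_gt0 ?expR_gt0 ?invr_gt0.
split=> // n; apply: le_trans (ler_wpM2l (ler0n _ _) (hu n)) _.
have n1 : n.+1%:R <= (b / 2)^-1 * (expR (b / 2) * expR (b / 2 * n%:R)).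
  rewrite -expRD ler_pdivlMl//; apply: le_trans (expR_ge1Dx _).
  rewrite -natr1; lra.
have -> : expR (- (b * n%:R)) = expR (- (b / 2 * n%:R)) * expR (- (b / 2 * n%:R)).
  by rewrite -expRD; congr expR; field.
have E0 : 0 <= C * (expR (- (b / 2 * n%:R)) * expR (- (b / 2 * n%:R))).
  by rewrite !mulr_ge0 ?expR_ge0// ltW.
apply: le_trans (ler_wpM2r E0 n1) _; rewrite le_eqVlt; apply/orP; left; apply/eqP.
have e1 : expR (b / 2 * n%:R) * expR (- (b / 2 * n%:R)) = 1.
  by rewrite -expRD subrr expR0.
rewrite [LHS](_ : _ = (b / 2)^-1 * expR (b / 2) * C * expR (- (b / 2 * n%:R)) *
  (expR (b / 2 * n%:R) * expR (- (b / 2 * n%:R)))); last by ring.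
by rewrite e1 mulr1.
Qed.

Lemma exp_small_div u q : (0 < q)%N -> exp_small u -> exp_small (fun n => u (n %/ q)%N).
Proof.
move=> q0 [C [b [C0 [b0 hu]]]]; have qR : 0 < q%:R :> R by rewrite ltr0n.
exists (C * expR b), (b / q%:R); split; first by rewrite mulr_gt0 ?expR_gt0.
split=> [|n]; first exact: divr_gt0.
apply: le_trans (hu _) _; rewrite -mulrA ler_wpM2l ?(ltW C0)// -expRD ler_expR.
have : n%:R <= (n %/ q).+1%:R * q%:R :> R by rewrite -natrM ler_nat ltnW// ltn_ceil.
rewrite -ler_pdivrMr// -natr1 => h; have := ler_wpM2l (ltW b0) h; lra.
Qed.

(** Below [N] the trivial bound 1 goes into the constant, so estimates for large [n] suffice. *)
Lemma exp_small_eventually u v N : (forall n, u n <= 1) ->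
  (forall n, (N <= n)%N -> u n <= v n) -> exp_small v -> exp_small u.
Proof.
move=> u1 uv [C [b [C0 [b0 hv]]]].
exists (C + expR (b * N%:R)), b; split; first by rewrite addr_gt0 ?expR_gt0.
split=> // n; rewrite mulrDl.
have [Nn|nN] := leqP N n.
  apply: le_trans (uv _ Nn) _; apply: le_trans (hv n) _.
  by rewrite lerDl mulr_ge0 ?expR_ge0.
apply: le_trans (u1 n) _; rewrite -[leLHS]add0r; apply: lerD.
  by rewrite mulr_ge0 ?expR_ge0// ltW.
rewrite -expRD -[leLHS]expR0 ler_expR subr_ge0 ler_wpM2l ?(ltW b0)//.
by rewrite ler_nat ltnW.
Qed.

End ExponentialDecay.

Lemma leq_fifth m n : (5 * m <= n)%N -> (m <= n - m)%N && (m <= n)%N.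
Proof. lia. Qed.

(** * From the convergence hypothesis to the spectral event *)

Section Assembly.
Context {R : realType} {e : nat} {dT : measure_display} {T : measurableType dT}.
Local Notation d := e.+2.
Local Notation mseq := (@mseq R d).
Variables (P : probability T R) (gam : nat -> T -> 'M[R]_d) (linf : T -> 'cV[R]_d).
Hypothesis Hmeas : forall n, mmx (gam n).
Hypothesis Hiid : iid_seq P gam.
Hypothesis Hprox0 : forall n, P [set w | gbar gam n w = 0] = 0%E.
Hypothesis Hsi : forall N : nat, (1 <= N)%N ->
  forall (f : 'I_N -> 'rV[R]_d) (v : 'cV[R]_d), (forall i, f i != 0) -> v != 0 ->
  exists n, (0 < P [set w | (\prod_(i < N) (f i *m gbar gam n w *m v) 0 0 != 0)%R])%E.
Hypothesis Hlmeas : mmx linf.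
Hypothesis Hlnz : forall w, linf w != 0.

Let mu := seq_law P Hmeas.

Let Hmu : iid_law mu.
Proof. exact: iid_seq_law. Qed.

Lemma gbar_word n w : gbar gam n w = word (trajectory gam w) 0 n.
Proof. by []. Qed.

Lemma mmx_gbar n : mmx (gbar gam n).
Proof. exact: mmx_prod. Qed.

Lemma word_neq0 r : pr mu [set x : mseq | word x 0 r = 0] = 0.
Proof. by rewrite /pr /mu seq_lawE [X in fine X](Hprox0 r). Qed.

(** Strong irreducibility with two functionals: a product of two scalars is nonzero exactly when
    both are. *)
Lemma two_functionals (f1 f2 : 'rV[R]_d) (v : 'cV[R]_d) : f1 != 0 -> f2 != 0 ->
  v != 0 -> exists n, 0 < pr mu [set x : mseq |
    f1 *m word x 0 n *m v <> 0 /\ f2 *m word x 0 n *m v <> 0].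
Proof.
move=> f10 f20 v0.
have [|n] := @Hsi 2 isT (fun i => if i == ord0 then f1 else f2) v _ v0.
  by move=> i; case: ifP.
rewrite (_ : mkset _ = trajectory gam @^-1` [set x : mseq |
    f1 *m word x 0 n *m v <> 0 /\ f2 *m word x 0 n *m v <> 0]).
  rewrite -(seq_lawE P Hmeas) prE ?lte_fin; first by exists n.
  by apply: mset_and; apply: mset_not; apply: mset_mx_eq0;
    (apply: mmx_mul; [apply: mmx_mul; [exact: mmx_cst|exact: mmx_word]|exact: mmx_cst]).
have nz (M : 'M[R]_1) : (M 0 0 != 0) = (M != 0).
  congr (~~ _); apply/eqP/eqP => [M0|->]; last by rewrite mxE.
  by apply/matrixP => i j; rewrite !ord1 M0 mxE.
rewrite predeqE => w; rewrite /= 2!big_ord_recl big_ord0 mulr1 mulf_eq0 negb_or !nz /=.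
by split=> [/andP[/eqP h1 /eqP h2]|[/eqP h1 /eqP h2]]; [split|apply/andP].
Qed.

Section Distance.
Variables (a C0 b0 : R).
Hypotheses (a_gt0 : 0 < a) (C0_gt0 : 0 < C0) (b0_gt0 : 0 < b0).
Hypothesis Ha : forall (v : 'cV[R]_d), v != 0 -> forall n : nat,
  (P [set w | (gbar gam n w *m v != 0)%R /\
     (expR (- (a * n%:R)) <= pdist (gbar gam n w *m v) (linf w))%R]
   <= (C0 * expR (- (b0 * n%:R)))%:E * P [set w | (gbar gam n w *m v != 0)%R])%E.

Definition far_column n w : Prop := exists j, col j (gbar gam n w) != 0 /\
  expR (- (a * n%:R)) <= pdist (col j (gbar gam n w)) (linf w).

Lemma measurable_far n j : measurable [set w | col j (gbar gam n w) != 0 /\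
  expR (- (a * n%:R)) <= pdist (col j (gbar gam n w)) (linf w)].
Proof.
have mc : mmx (fun w => col j (gbar gam n w)) by apply: mmx_col; exact: mmx_gbar.
by apply: mset_and; [exact: mset_mx_neq0|exact: mset_pdist_ge].
Qed.

Lemma measurable_far_column n : measurable [set w | far_column n w].
Proof. apply: mset_exists_countable => j; exact: measurable_far. Qed.

Lemma pr_far_column n : pr P [set w | far_column n w] <= d%:R * (C0 * expR (- (b0 * n%:R))).
Proof.
rewrite -[d in leRHS](card_ord d); apply: pr_exists => j; first exact: measurable_far.
have dj : delta_mx j 0 != 0 :> 'cV[R]_d.
  by apply/eqP => /matrixP/(_ j 0); rewrite !mxE !eqxx => /eqP; rewrite oner_eq0.
have := Ha dj n.
under [X in (P X <= _)%E -> _]eq_set do rewrite -colE.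
rewrite prE; last exact: measurable_far.
have mV : measurable [set w | gbar gam n w *m (delta_mx j 0 : 'cV[R]_d) != 0].
  by apply: mset_mx_neq0; apply: mmx_mul; [exact: mmx_gbar|exact: mmx_cst].
rewrite [X in (_ * X)%E]prE// -EFinM lee_fin => /le_trans; apply.
by rewrite ler_piMr ?pr_le1// mulr_ge0 ?expR_ge0// ltW.
Qed.

(** Both families of columns are compared with the limit line, hence the factor 2 and the two
    exceptional events. *)
Lemma stable_columns r r' : (r <= r')%N ->
  pr mu [set x : mseq | ~ colclose (2 * expR (- (a * r%:R))) (word x 0 r) (word x 0 r')]
    <= 2 * d%:R * C0 * expR (- (b0 * r%:R)).
Proof.
move=> rr'.
apply: (@le_trans _ _ (d%:R * (C0 * expR (- (b0 * r%:R))) + d%:R * (C0 * expR (- (b0 * r'%:R))))).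
  apply: (le_trans _ (lerD (pr_far_column r) (pr_far_column r'))).
  apply: (@le_trans _ _ (pr P [set w | ~ colclose (2 * expR (- (a * r%:R)))
    (gbar gam r w) (gbar gam r' w)])) => //.
  apply: prU.
  - by apply: mset_not; apply: mset_colclose; exact: mmx_gbar.
  - exact: measurable_far_column.
  - exact: measurable_far_column.
  move=> w /= nc; apply: contrapT => /not_orP[f1 f2]; apply: nc => i j ci cj.
  have h1 : pdist (col i (gbar gam r w)) (linf w) < expR (- (a * r%:R)).
    by rewrite ltNge; apply/negP => h; apply: f1; exists i.
  have h2 : pdist (col j (gbar gam r' w)) (linf w) < expR (- (a * r'%:R)).
    by rewrite ltNge; apply/negP => h; apply: f2; exists j.
  have h3 : expR (- (a * r'%:R)) <= expR (- (a * r%:R)).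
    by rewrite ler_expR lerN2 ler_wpM2l ?ler_nat// ltW.
  apply: le_lt_trans (pdist_triangle (y := linf w) ci (Hlnz w) cj) _.
  rewrite [pdist (linf w) _]pdistC; lra.
have h3 : expR (- (b0 * r'%:R)) <= expR (- (b0 * r%:R)).
  by rewrite ler_expR lerN2 ler_wpM2l ?ler_nat// ltW.
have dC : 0 <= d%:R * C0 by rewrite mulr_ge0// ltW.
have := ler_wpM2l dC h3; lra.
Qed.

Lemma spectral_event_exp_small (alpha : R) : 0 <= alpha -> alpha < a ->
  exp_small (fun n => pr P [set w |
     expR (- (alpha * n%:R)) * rho 1 (gbar gam n w) <= rho 2 (gbar gam n w) \/
     expR (- (alpha * n%:R)) <= pdist (Eplus (gbar gam n w)) (linf w)]).
Proof.
move=> al0 ala.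
have mE n : measurable [set w |
     expR (- (alpha * n%:R)) * rho 1 (gbar gam n w) <= rho 2 (gbar gam n w) \/
     expR (- (alpha * n%:R)) <= pdist (Eplus (gbar gam n w)) (linf w)].
  apply: mset_spectral_event => //; [exact: mmx_gbar| |exact: expR_gt0].
  by rewrite -expR0 ler_expR oppr_le0 mulr_ge0.
pose C : R := 2 * d%:R * C0.
have C_ge0 : 0 <= C by rewrite !mulr_ge0// ltW.
have [delta [c [l0 [d01 [c0 nonconc]]]]] := non_concentration Hmu two_functionals
  word_neq0 a_gt0 b0_gt0 C_ge0 stable_columns.
have /andP[d0 d1] := d01.
have [l [tau [tau0 goodP]]] := good_from_exponential Hmu a_gt0 b0_gt0 C_ge0
  word_neq0 stable_columns d0 c0 nonconc.
set D := delta / 2 in goodP.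
have D01 : 0 < D <= 1 by apply/andP; rewrite /D; split; lra.
have /andP[D0 _] := D01.
have notgood := pr_not_good_event Hmu word_neq0 stable_columns goodP (ltW b0_gt0) C_ge0.
(* For [m = n %/ q] this gives [a * m <= (a - alpha) / 2 * n], so [a * (n - m)] exceeds [alpha * n]
   by [(a - alpha) / 2 * n], a surplus that absorbs the constants. The added 5 gives
   [5 * m <= n]. *)
pose q := (Num.truncn (2 * a / (a - alpha)) + 5)%N.
have q0 : (0 < q)%N by rewrite /q addnS.
have qR : 0 < q%:R :> R by rewrite ltr0n.
have qa : a <= (a - alpha) / 2 * q%:R.
  have h : 2 * a / (a - alpha) <= q%:R.
    by apply: le_trans (ltW (truncnS_gt _)) _; rewrite ler_nat /q addnS ltnS leq_addr.
  move: h; rewrite ler_pdivrMr ?subr_gt0//; lra.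
(* [K] dominates both constants of the deterministic estimate; the added 1 keeps it positive. *)
pose K : R := `|gap_const (n := e) D| + `|eig_const (n := e) D| + 1.
have K0 : 0 < K by rewrite /K ltr_wpDl// addr_ge0.
have D4 : 0 < D ^+ 4 / 32 by rewrite divr_gt0// exprn_gt0.
have D4' : 0 < D ^+ 4 / 16 / (4 * d%:R ^+ 3) / 2.
  by rewrite !divr_gt0 ?mulr_gt0 ?exprn_gt0.
have [N1 hN1] := expR_small a_gt0 (divr_gt0 D4 (ltr0Sn R 1)).
have [N2 hN2] := expR_small a_gt0 D4'.
have aal : 0 < (a - alpha) / 2 by rewrite divr_gt0// subr_gt0.
have K4 : 0 < (4 * K)^-1 by rewrite invr_gt0 mulr_gt0.
have [N3 hN3] := expR_small aal K4.
pose M := maxn 1 (maxn l (maxn N1 (maxn N2 N3))).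
(* The bound of [pr_not_good_event] rewritten in [m = n %/ q] by means of [n.+1 <= q.+1 * m.+1],
   plus the probability that some column of the word is far from the limit line. *)
pose V n : R := (q.+1 ^ 3)%:R * C * ((n %/ q).+1%:R * ((n %/ q).+1%:R * ((n %/ q).+1%:R *
     expR (- (b0 * (n %/ q)%:R))))) +
   2 * ((n %/ q).+1%:R * expR (- (tau * (n %/ q)%:R))) +
   d%:R * C0 * expR (- (b0 * n%:R)).
apply: (@exp_small_eventually _ _ V (q * M)%N).
- by move=> n; exact: pr_le1.
- move=> n nM; pose m := (n %/ q)%N.
  have mM : (M <= m)%N by rewrite /m leq_divRL// mulnC.
  have [m0 lm N1m N2m N3m] : [/\ (0 < m)%N, (l <= m)%N, (N1 <= m)%N, (N2 <= m)%N & (N3 <= m)%N].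
    by move: mM; rewrite /M !geq_max => /and5P[].
  have mn : (5 * m <= n)%N.
    apply: leq_trans (leq_trunc_div n q); rewrite -/m mulnC leq_mul2l /q leq_addl orbT.
    by [].
  have /andP[mle m_le_n] := leq_fifth mn.
  have nq : (n.+1 <= q * m.+1)%N by rewrite mulnC; exact: ltn_ceil.
  pose G := [set x : mseq | ~ good_event a D l m n x].
  have mG : measurable G by apply: mset_not; exact: measurable_good_event.
  have mTG : measurable [set w | ~ good_event a D l m n (trajectory gam w)].
    have := measurable_trajectory Hmeas measurableT mG.
    by rewrite setTI.
  apply: (@le_trans _ _ (pr mu G + pr P [set w | far_column n w])).
    apply: (@le_trans _ _ (pr P [set w | ~ good_event a D l m n (trajectory gam w)] +
      pr P [set w | far_column n w])) => //.
    apply: prU => //; first exact: measurable_far_column.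
    move=> w /= hw; apply: contrapT => /not_orP[/contrapT ge nf].
    have near_col j : col j (word (trajectory gam w) 0 n) != 0 ->
        pdist (col j (word (trajectory gam w) 0 n)) (linf w) < 2 * expR (- (a * (n - m)%:R)).
      move=> cj; apply: (@lt_trans _ _ (2 * expR (- (a * n%:R)))).
        have : pdist (col j (gbar gam n w)) (linf w) < expR (- (a * n%:R)).
          by rewrite ltNge; apply/negP => h; apply: nf; exists j.
        by rewrite gbar_word => /lt_le_trans; apply; rewrite ler_peMl ?expR_ge0 ?ler1n.
      by rewrite ltr_pM2l// ltr_expR ltrN2 ltr_pM2l// ltr_nat ltn_subrL m0 (leq_trans m0 m_le_n).
    have s1 : 2 * expR (- (a * m%:R)) <= D ^+ 4 / 32 by have := hN1 m N1m; lra.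
    have s2 : 2 * expR (- (a * (n - m)%:R)) <= D ^+ 4 / 16 / (4 * d%:R ^+ 3).
      by have := hN2 _ (leq_trans N2m mle); rewrite ler_pdivlMr// mulrC.
    have [r1 r2 tv] := good_event_spectrum D01 a_gt0 mn lm m0 s1 s2 ge (Hlnz w) near_col.
    have small k : `|k| <= K -> k * (2 * expR (- (a * (n - m)%:R))) < expR (- (alpha * n%:R)).
      move=> kK.
      have e1 : expR (- (a * (n - m)%:R)) <= expR (- (alpha * n%:R)) * (4 * K)^-1.
        apply: le_trans (ler_wpM2l (expR_ge0 _) (hN3 n (leq_trans N3m (leq_trans mle (leq_subr _ _))))).
        rewrite -expRD ler_expR natrB//.
        have h1 : a * m%:R <= (a - alpha) / 2 * n%:R.
          apply: le_trans (ler_wpM2r (ler0n R m) qa) _.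
          rewrite -[leLHS]mulrA ler_wpM2l ?(ltW aal)// -natrM ler_nat mulnC.
          exact: leq_trunc_div.
        lra.
      have e2 : k * (2 * expR (- (a * (n - m)%:R))) <= K * (2 * expR (- (a * (n - m)%:R))).
        by rewrite ler_wpM2r ?mulr_ge0 ?expR_ge0// (le_trans (ler_norm _)).
      have e3 := ler_wpM2l (ltW K0) e1.
      have e4 : K * (expR (- (alpha * n%:R)) * (4 * K)^-1) = expR (- (alpha * n%:R)) / 4.
        by field; rewrite gt_eqF.
      have := expR_gt0 (- (alpha * n%:R)); lra.
    move: hw; rewrite gbar_word => -[|].
      apply/negP; rewrite -ltNge; apply: le_lt_trans r2 _; rewrite ltr_pM2r//.
      by apply: small; rewrite /K -addrA lerDl addr_ge0.
    apply/negP; rewrite -ltNge.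
    (* If no top eigenvector exists, [Eplus] is 0 and the distance is 0 by convention. *)
    have [E0|E0] := eqVneq (Eplus (word (trajectory gam w) 0 n)) 0.
      by rewrite E0 pdist0l expR_gt0.
    have tE : top_eigvec (word (trajectory gam w) 0 n) (Eplus (word (trajectory gam w) 0 n)).
      by move: E0; rewrite /Eplus; case: xgetP => [u -> //|_]; rewrite eqxx.
    apply: le_lt_trans (tv _ tE) _; apply: small.
    by rewrite /K addrAC lerDr addr_ge0.
  rewrite /V -/m; apply: lerD; last by rewrite -mulrA; exact: pr_far_column.
  apply: le_trans (notgood m n m0 mn) _; apply: lerD.
    have n3 : (n.+1 * n.+1 * n.+1)%:R <= (q.+1 ^ 3)%:R * (m.+1%:R * (m.+1%:R * m.+1%:R)) :> R.
      rewrite -!natrM ler_nat !expnS expn0 muln1.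
      have nq' : (n.+1 <= q.+1 * m.+1)%N by rewrite (leq_trans nq)// leq_mul2r leqnSn orbT.
      apply: leq_trans (leq_mul (leq_mul nq' nq') nq') _.
      by rewrite !mulnA leq_eqVlt; apply/orP; left; apply/eqP; ring.
    have E0 : 0 <= C * expR (- (b0 * m%:R)) by rewrite mulr_ge0 ?expR_ge0.
    apply: le_trans (ler_wpM2r E0 n3) _.
    rewrite le_eqVlt; apply/orP; left; apply/eqP; ring.
  rewrite mulrA ler_wpM2r ?expR_ge0// -natr1; have := ler0n R m; lra.
- apply: exp_smallD; first apply: exp_smallD.
  + apply: exp_smallZ; first by rewrite mulr_ge0.
    apply: (exp_small_div (u := fun m => m.+1%:R * (m.+1%:R * (m.+1%:R * expR (- (b0 * m%:R)))))) => //.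
    by do 3 apply: exp_small_succM; exact: exp_small_expR.
  + apply: exp_smallZ => //.
    apply: (exp_small_div (u := fun m => m.+1%:R * expR (- (tau * m%:R)))) => //.
    by apply: exp_small_succM; exact: exp_small_expR.
  + by apply: exp_smallZ; [rewrite mulr_ge0// ltW|exact: exp_small_expR].
Qed.

End Distance.

Lemma rank_event_exp_small (alpha : R) : alpha < 0 ->
  exp_small (fun n => pr P [set w |
     expR (- (alpha * n%:R)) * rho 1 (gbar gam n w) <= rho 2 (gbar gam n w) \/
     expR (- (alpha * n%:R)) <= pdist (Eplus (gbar gam n w)) (linf w)]).
Proof.
move=> al0; have [C [b [C0 [b0 h]]]] := rho1_positive Hmu word_neq0.
have e1 n : (0 < n)%N -> 1 < expR (- (alpha * n%:R)).
  by move=> n0; rewrite expR_gt1 oppr_gt0 nmulr_rlt0 ?ltr0n.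
(* At [n = 0] the threshold equals 1 instead of exceeding it, so the argument starts at 1. *)
apply: (@exp_small_eventually _ _ (fun n => C * expR (- (b * n%:R))) 1).
- move=> n; apply: pr_le1; have [->|n0] := posnP n.
    by apply: mset_spectral_event; rewrite ?expR_gt0 ?mulr0 ?oppr0 ?expR0//; exact: mmx_gbar.
  by rewrite mset_spectral_event_gt1 ?e1//; apply: mset_rho_ratio; exact: mmx_gbar.
- move=> n n0; rewrite mset_spectral_event_gt1 ?e1//.
  have [B [mB pB hB]] := h n; apply: le_trans pB.
  have mTB : measurable (trajectory gam @^-1` B).
    by have := measurable_trajectory Hmeas measurableT mB; rewrite setTI.
  apply: (@le_trans _ _ (pr P (trajectory gam @^-1` B))) => //.
  apply: pr_le => //; first by apply: mset_rho_ratio; exact: mmx_gbar.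
  move=> w /= hw; apply: contrapT => /hB; rewrite -gbar_word => r1.
  have := le_trans hw (rho2_le_rho1 _); rewrite leNgt => /negP; apply.
  by rewrite ltr_pMl// e1.
- by apply: exp_smallZ; [exact: ltW|exact: exp_small_expR].
Qed.

End Assembly.
Theorem theorem1p10 (R : realType) (d : nat) (hd : (2 <= d)%N)
  (dT : measure_display) (T : measurableType dT) (P : probability T R)
  (gam : nat -> T -> 'M[R]_d) (linf : T -> 'cV[R]_d) (lam12 : \bar R)
  (* the gam n are random matrices, i.i.d. with law nu := law of gam 0 *)
  (Hmeas : forall n (i j : 'I_d), measurable_fun setT (fun w => gam n w i j))
  (Hiid : iid_seq P gam)
  (* nu is proximal (nu^{*n} is the law of gbar gam n) *)
  (Hprox0 : forall n, P [set w | gbar gam n w = 0] = 0%E)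
  (Hprox1 : exists n, (0 < P [set w | (rho 2 (gbar gam n w) < rho 1 (gbar gam n w))%R])%E)
  (* nu is strongly irreducible *)
  (Hsi_a : forall N : nat, (1 <= N)%N -> forall (f : 'I_N -> 'rV[R]_d) (v : 'cV[R]_d),
      (forall i, f i != 0) -> v != 0 ->
      exists n, (0 < P [set w | (\prod_(i < N) (f i *m gbar gam n w *m v) 0 0 != 0)%R])%E)
  (Hsi_b : forall N : nat, (1 <= N)%N -> forall (f : 'rV[R]_d) (v : 'I_N -> 'cV[R]_d),
      f != 0 -> (forall j, v j != 0) ->
      exists n, (0 < P [set w | (\prod_(j < N) (f *m gbar gam n w *m v j) 0 0 != 0)%R])%E)
  (* lam12 = lambda_{1-2}(nu): a.s. limit of -(1/n) log sigma(gbar gam n) *)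
  (Hlam : {ae P, forall w,
      (fun n : nat => ((n%:R)^-1)%:E * mlog_sigma (gbar gam n w))%E @ \oo --> lam12})
  (* linf is a P(E)-valued random variable (represented by a nonzero vector) *)
  (Hlmeas : forall i : 'I_d, measurable_fun setT (fun w => linf w i 0))
  (Hlnz : forall w, linf w != 0)
  (Hconv : forall alpha : R, (alpha%:E < lam12)%E ->
      exists C beta : R, 0 < C /\ 0 < beta /\
        forall (v : 'cV[R]_d), v != 0 -> forall n : nat,
          (P [set w | (gbar gam n w *m v != 0)%R /\
                      (expR (- (alpha * n%:R)) <= pdist (gbar gam n w *m v) (linf w))%R]
           <= (C * expR (- (beta * n%:R)))%:E * P [set w | (gbar gam n w *m v != 0)%R])%E) :
  forall alpha : R, (alpha%:E < lam12)%E ->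
    exists C beta : R, 0 < C /\ 0 < beta /\
      forall n : nat, (0 < n)%N ->
        (P [set w | (expR (- (alpha * n%:R)) * rho 1 (gbar gam n w) <= rho 2 (gbar gam n w))%R
                    \/ (expR (- (alpha * n%:R)) <= pdist (Eplus (gbar gam n w)) (linf w))%R]
         <= (C * expR (- (beta * n%:R)))%:E)%E.

Proof.
move=> alpha al.
have mg n : mmx (gam n) by move=> i j; exact: Hmeas.
have ml : mmx linf by move=> i j; rewrite ord1; exact: Hlmeas.
clear Hprox1 Hsi_b Hlam Hmeas Hlmeas.
case: d hd gam linf mg ml Hiid Hprox0 Hsi_a Hlnz Hconv => [//|[//|e]] _ {}gam {}linf.
move=> mg ml {}Hiid {}Hprox0 Hsi {}Hlnz {}Hconv.
have [C [beta [C0 [b0 h]]]] : exp_small (fun n => pr P [set w |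
     expR (- (alpha * n%:R)) * rho 1 (gbar gam n w) <= rho 2 (gbar gam n w) \/
     expR (- (alpha * n%:R)) <= pdist (Eplus (gbar gam n w)) (linf w)]).
  have [al0|al0] := ltP alpha 0; first exact: (rank_event_exp_small mg).
  (* The gap between [alpha] and [a] pays for the [m] letters lost at the cuts and for the
     constants. *)
  have [a ala aL] : exists2 a, alpha < a & (a%:E < lam12)%E.
    case: lam12 al {Hconv} => [r||//].
    - rewrite lte_fin => ar; exists ((alpha + r) / 2); rewrite ?lte_fin; lra.
    - by move=> _; exists (alpha + 1); rewrite ?ltry// ltrDl.
  have [C0 [b0 [C00 [b00 Ha]]]] := Hconv _ aL.
  exact: (spectral_event_exp_small mg Hiid Hprox0 Hsi ml Hlnz (le_lt_trans al0 ala) C00 b00 Ha).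
exists C, beta; split=> //; split=> // n n0; rewrite prE ?lee_fin; first exact: h.
have mgn := mmx_gbar mg n.
(* Above 1 the distance condition is void, as [pdist] is at most 1, and only the ratio event has to
   be measured. *)
have [a1|a1] := leP (expR (- (alpha * n%:R))) 1.
  by apply: mset_spectral_event => //; exact: expR_gt0.
by rewrite mset_spectral_event_gt1//; exact: mset_rho_ratio.
Qed.
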